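(* A seven-dimensional strongly unimodular solvable real Lie algebra $\mathfrak{g}$ does not admit any exact $\mathrm{G}_2$-structure.
   Context: A $3$-form $\varphi\in\Lambda^3\mathfrak{g}^*$ on a seven-dimensional real Lie algebra $\mathfrak{g}$ defines a $\mathrm{G}_2$-structure if the symmetric bilinear map $b_\varphi:\mathfrak{g}\times\mathfrak{g}\to\Lambda^7\mathfrak{g}^*$, $b_\varphi(v,w)=\frac16\,\iota_v\varphi\wedge\iota_w\varphi\wedge\varphi$, satisfies $\det(b_\varphi)^{1/9}\neq0\in\Lambda^7\mathfrak{g}^*$ and $g_\varphi=\det(b_\varphi)^{-1/9}\,b_\varphi$ is a positive definite symmetric bilinear form on $\mathfrak{g}$. It is exact if $\varphi=d\alpha$ for some $\alpha\in\Lambda^2\mathfrak{g}^*$, where $d$ is the Chevalley-Eilenberg differential of $\mathfrak{g}$. Strongly unimodular: let $\mathfrak{g}$ be a solvable Lie algebra with nilradical $\mathfrak{n}$, and let $\mathfrak{n}^{0}=\mathfrak{n}$, $\mathfrak{n}^{i}=[\mathfrak{n},\mathfrak{n}^{i-1}]$ for $i\geq1$ be its descending central series. Then $\mathfrak{g}$ is strongly unimodular if for all $X\in\mathfrak{g}$ the map induced by $\mathrm{ad}_X$ on each space $\mathfrak{n}^{i}/\mathfrak{n}^{i+1}$ is traceless. *)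

(* Defs.v *)
From HB Require Import structures.
From mathcomp Require Import all_boot all_order all_fingroup all_algebra.
From mathcomp Require Import boolp reals exp.

Set Implicit Arguments.
Unset Strict Implicit.
Unset Printing Implicit Defensive.

Import Order.TTheory GRing.Theory Num.Theory passmx.
Local Open Scope ring_scope.

HB.mixin Record Vector_isLieAlgebra (F : fieldType) g of Vector F g := {
  lie : g -> g -> g;
  lie_linearl : forall y, linear (lie^~ y);
  lie_linearr : forall x, linear (lie x);
  lie_xx : forall x, lie x x = 0;
  lie_jacobi : forall x y z,
    lie x (lie y z) + lie y (lie z x) + lie z (lie x y) = 0
}.

#[short(type="lieAlgType")]
HB.structure Definition LieAlgebra (F : fieldType) :=
  {g of Vector F g & Vector_isLieAlgebra F g}.

Definition lftrace (F : fieldType) (V : vectType F) (f : 'End(V)) : F :=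
  \tr (mxof (vbasis {:V}) (vbasis {:V}) f).

(* Traces on quotients: for W <= U, the quotient U / W is modelled by the
   complement U :\: W of W in U, the quotient map being the projection along W;
   see quot_proj_surj, quot_proj_ker and quot_endE. *)
Section QuotientTrace.
Variables (F : fieldType) (V : vectType F).
Implicit Types (U W : {vspace V}) (f : 'End(V)).

Definition quot U W := subvs_of (U :\: W)%VS.
HB.instance Definition _ U W := Vector.on (quot U W).

Definition quot_proj U W : 'Hom(V, quot U W) :=
  (linfun (vsproj (U :\: W)%VS) \o addv_pi1 U W)%VF.

Definition quot_lift U W : 'Hom(quot U W, V) := linfun vsval.

Definition quot_end U W f : 'End(quot U W) :=
  (quot_proj U W \o f \o quot_lift U W)%VF.

Lemma quot_projE U W v : vsval (quot_proj U W v) = addv_pi1 U W v.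
Proof. by rewrite !lfunE /= lfunE /= vsprojK ?memv_pi. Qed.

Lemma quot_liftK U W : cancel (quot_lift U W) (quot_proj U W).
Proof.
move=> x; apply: val_inj; rewrite /= quot_projE lfunE /=.
by rewrite daddv_pi_id ?capv_diff ?subvsP.
Qed.

Lemma quot_lift_mem U W x : quot_lift U W x \in U.
Proof. by rewrite lfunE /= (subvP (diffvSl U W)) ?subvsP. Qed.

Lemma quot_proj_surj U W (x : quot U W) :
  exists2 u, u \in U & quot_proj U W u = x.
Proof. by exists (quot_lift U W x); rewrite ?quot_liftK ?quot_lift_mem. Qed.

Lemma quot_proj_ker U W u : u \in U -> (quot_proj U W u == 0) = (u \in W).
Proof.
move=> uU; rewrite -val_eqE /= quot_projE.
have uUW : u \in (U + W)%VS by rewrite (subvP (addvSl U W)).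
have uE := addv_pi1_pi2 uUW.
apply/eqP/idP => [u0|uW].
  by rewrite -uE u0 add0r memv_pi2.
have: addv_pi1 U W u \in ((U :\: W) :&: W)%VS.
  rewrite memv_cap memv_pi /=.
  have -> : addv_pi1 U W u = u - addv_pi2 U W u by rewrite -{2}uE addrK.
  by rewrite memvB ?memv_pi2.
by rewrite capv_diff memv0 => /eqP.
Qed.

Lemma quot_endE U W f u : (W <= U)%VS ->
    (f @: U <= U)%VS -> (f @: W <= W)%VS -> u \in U ->
  quot_end U W f (quot_proj U W u) = quot_proj U W (f u).
Proof.
move=> sWU fU fW uU; pose w := quot_lift U W (quot_proj U W u) - u.
have wU : w \in U by rewrite memvB ?quot_lift_mem.
have wW : w \in W.
  by rewrite -(quot_proj_ker _ wU) linearB /= quot_liftK subrr.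
have -> : quot_end U W f (quot_proj U W u) = quot_proj U W (f (w + u)).
  by rewrite subrK -!comp_lfunE.
have /eqP fw0 : quot_proj U W (f w) == 0.
  by rewrite quot_proj_ker ?(subvP fW) ?(subvP fU) ?memv_img.
rewrite (linearD f) (linearD (quot_proj U W)).
by rewrite [X in X + _](_ : _ = 0) ?add0r.
Qed.

Definition quot_trace U W f : F := lftrace (quot_end U W f).

End QuotientTrace.

Section LieTheory.
Variables (F : fieldType) (g : lieAlgType F).
Implicit Types (U V W I J : {vspace g}) (x y z : g).

HB.instance Definition _ x := GRing.isSemilinear.Build F g g _ (lie x)
  (GRing.semilinear_linear (lie_linearr x)).

Definition ad x : 'End(g) := linfun (lie x).

Lemma adE x y : ad x y = lie x y.
Proof. by rewrite lfunE. Qed.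

Lemma lieDl x y z : lie (x + y) z = lie x z + lie y z.
Proof. by have := lie_linearl z 1 x y; rewrite /= !scale1r. Qed.

Lemma lie0l z : lie 0 z = 0.
Proof. by apply: (addrI (lie 0 z)); rewrite -lieDl !addr0. Qed.

Lemma lieZl a x z : lie (a *: x) z = a *: lie x z.
Proof. by have := lie_linearl z a x 0; rewrite /= lie0l !addr0. Qed.

Lemma lieC x y : lie x y = - lie y x.
Proof.
apply/eqP; rewrite -addr_eq0; have := lie_xx (x + y).
by rewrite lieDl !linearD /= !lie_xx add0r addr0 => ->.
Qed.

Definition liev U V : {vspace g} := <<allpairs lie (vbasis U) (vbasis V)>>%VS.

Lemma memv_lie U V : {in U & V, forall x y, lie x y \in liev U V}.
Proof.
move=> x y /coord_vbasis-> /coord_vbasis->.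
rewrite (big_morph (lie^~ _) (id1 := 0) (op1 := +%R)); last exact: lie0l.
  2: by move=> u v; apply: lieDl.
apply: memv_suml => i _.
rewrite linear_sum; apply: memv_suml => j _.
rewrite /= lieZl linearZ !memvZ // memv_span //.
by apply/allpairsP; exists ((vbasis U)`_i, (vbasis V)`_j); rewrite !memt_nth.
Qed.

Lemma lievP {U V W} :
  reflect {in U & V, forall x y, lie x y \in W} (liev U V <= W)%VS.
Proof.
apply: (iffP idP) => [sW x y Ux Vy | sW].
  by rewrite (subvP sW) ?memv_lie.
apply/span_subvP=> _ /allpairsP[[x y] /= [Ux Vy ->]].
by rewrite sW ?vbasis_mem.
Qed.

Lemma lievS U1 U2 V1 V2 :
  (U1 <= U2)%VS -> (V1 <= V2)%VS -> (liev U1 V1 <= liev U2 V2)%VS.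
Proof.
move=> /subvP sU /subvP sV; apply/lievP => x y Ux Vy.
by rewrite memv_lie ?sU ?sV.
Qed.

Definition derived_series (i : nat) : {vspace g} :=
  iter i (fun U => liev U U) {:g}%VS.

Definition lie_solvable : Prop := exists i, derived_series i = 0%VS.

Definition lcs U (i : nat) : {vspace g} := iter i (liev U) U.

Definition lie_nilpotent U : Prop := exists i, lcs U i = 0%VS.

Definition lie_ideal U : Prop := (liev {:g} U <= U)%VS.

Definition is_nilradical U : Prop :=
  [/\ lie_ideal U, lie_nilpotent U &
      forall I, lie_ideal I -> lie_nilpotent I -> (I <= U)%VS].

Lemma lie_idealP U :
  lie_ideal U <-> (forall x y, y \in U -> lie x y \in U).
Proof.
split=> [/lievP H x y Uy | H]; first by apply: H; rewrite ?memvf.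
by apply/lievP => x y _; apply: H.
Qed.

Lemma lie_ideal_add I J : lie_ideal I -> lie_ideal J -> lie_ideal (I + J)%VS.
Proof.
move=> /lie_idealP iI /lie_idealP iJ; apply/lie_idealP => x y.
by move=> /memv_addP[u Iu [v Jv ->]]; rewrite linearD memv_add ?iI ?iJ.
Qed.

Lemma lie_ideal_liev I J : lie_ideal I -> lie_ideal J -> lie_ideal (liev I J).
Proof.
move=> /lie_idealP iI /lie_idealP iJ; apply/lie_idealP => x y.
suff: (liev I J <= ad x @^-1: liev I J)%VS.
  by move/subvP=> H /H; rewrite -memv_preim adE.
apply/lievP => u v Iu Jv; rewrite -memv_preim adE.
have -> : lie x (lie u v) = lie (lie x u) v + lie u (lie x v).
  have := lie_jacobi x u v; rewrite -addrA => /eqP; rewrite addr_eq0 => /eqP->.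
  rewrite opprD addrC; congr (_ + _); first by rewrite lieC opprK.
  by rewrite -linearN /= -lieC.
by rewrite memvD ?memv_lie ?iI ?iJ.
Qed.

Lemma lie_ideal_lcs I i : lie_ideal I -> lie_ideal (lcs I i).
Proof. by move=> iI; elim: i => //= i IH; apply: lie_ideal_liev. Qed.

Lemma lie_nilpotentS I J :
  (I <= J)%VS -> lie_nilpotent J -> lie_nilpotent I.
Proof.
move=> sIJ [i i0]; exists i; apply/eqP; rewrite -subv0 -i0.
by elim: i {i0} => //= i IH; apply: lievS.
Qed.

Lemma lie_nilpotent_add I J : lie_ideal I -> lie_ideal J ->
  lie_nilpotent I -> lie_nilpotent J -> lie_nilpotent (I + J)%VS.
Proof.
move=> iI iJ [p p0] [q q0].
pose L K a := if a is a'.+1 then lcs K a' else {:g}%VS.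
have iL K a : lie_ideal K -> lie_ideal (L K a).
  by case: a => [|a] iK /=; [apply: subvf | apply: lie_ideal_lcs].
have LS K a : lie_ideal K -> (liev K (L K a) <= L K a.+1)%VS.
  case: a => [|a] iK //=; apply/lievP => x y Kx _.
  by rewrite lieC memvN; apply: ((lie_idealP K).1 iK).
pose S n := (\sum_(a < n.+1) (L I a :&: L J (n - a)%N))%VS.
have SE n a b : (a + b = n)%N -> (L I a :&: L J b <= S n)%VS.
  move=> abn; have an : (a < n.+1)%N by rewrite ltnS -abn leq_addr.
  have -> : b = (n - a)%N by rewrite -abn addKn.
  exact: (sumv_sup (Ordinal an)).
have key n : (lcs (I + J) n <= S n.+1)%VS.
  elim: n => [|n IH].
    rewrite subv_add; apply/andP; split.
      by apply: subv_trans (SE 1%N 1%N 0%N _) => //=; rewrite capvf subvv.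
    by apply: subv_trans (SE 1%N 0%N 1%N _) => //=; rewrite subv_cap subvf subvv.
  apply: subv_trans (lievS (subvv _) IH) _.
  apply/lievP => _ y /memv_addP[u Iu [v Jv ->]] /memv_sumP[w wP ->].
  rewrite linear_sum; apply: memv_suml => a _ /=.
  have := wP a isT; rewrite memv_cap => /andP[wI wJ].
  have an : (a <= n.+1)%N by rewrite -ltnS.
  rewrite lieDl memvD //.
    apply: (subvP (SE n.+2 a.+1 (n.+1 - a)%N _)); first by rewrite addSn subnKC.
    rewrite memv_cap (subvP (LS I a iI)) ?memv_lie //=.
    by apply: (lie_idealP _).1 => //; apply: iL.
  apply: (subvP (SE n.+2 a (n.+1 - a).+1 _)); first by rewrite addnS subnKC.
  rewrite memv_cap (subvP (LS J _ iJ)) ?memv_lie // andbT.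
  by apply: (lie_idealP _).1 => //; apply: iL.
have z0 K r a : lcs K r = 0%VS -> (r < a)%N -> L K a = 0%VS.
  case: a => // a r0; rewrite ltnS => /= /subnK <-.
  elim: (a - r)%N => [|k IH]; rewrite ?add0n //.
  apply/eqP; rewrite addSn /= -subv0; apply/lievP => x y _.
  by rewrite -/(lcs _ _) IH memv0 => /eqP->; rewrite linear0 mem0v.
exists (p + q).+1; apply/eqP; rewrite -subv0 (subv_trans (key _)) //.
apply/subv_sumP => a _; case: (ltnP p a) => [pa | ap].
  by rewrite (z0 _ _ _ p0 pa) cap0v.
rewrite (z0 J q) ?capv0 //.
by rewrite ltn_subRL (leq_trans (_ : _ < (p + q).+1)%N) // ltnS leq_add2r.
Qed.

Lemma exists_nilradical : exists U, is_nilradical U.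
Proof.
pose P n := `[< exists U, [/\ lie_ideal U, lie_nilpotent U & \dim U = n] >].
have ex : exists n, P n.
  exists 0%N; apply/asboolP; exists 0%VS; split; last exact: dimv0.
    by apply/lievP => x y _; rewrite memv0 => /eqP->; rewrite linear0 mem0v.
  by exists 0%N.
have ub n : P n -> (n <= \dim {:g})%N.
  by move=> /asboolP[U [_ _ <-]]; rewrite dimvS ?subvf.
case: (ex_maxnP ex ub) => n /asboolP[U [iU nU dU]] nmax; exists U; split=> //.
move=> I iI nI; have sU : (U <= U + I)%VS by rewrite addvSl.
have: (\dim (U + I) <= \dim U)%N.
  rewrite dU; apply: nmax; apply/asboolP; exists (U + I)%VS; split=> //.
    exact: lie_ideal_add.
  exact: lie_nilpotent_add.
move=> dUI; have /eqP -> : U == (U + I)%VS by rewrite eqEdim sU.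
exact: addvSr.
Qed.

Definition nilradical : {vspace g} := projT1 (cid exists_nilradical).

Lemma nilradicalP : is_nilradical nilradical.
Proof. exact: (projT2 (cid exists_nilradical)). Qed.

Definition strongly_unimodular : Prop := forall (i : nat) (x : g),
  quot_trace (lcs nilradical i) (lcs nilradical i.+1) (ad x) = 0.

End LieTheory.

Arguments lie_solvable {F} g.
Arguments nilradical {F} g.
Arguments strongly_unimodular {F} g.

Section Forms.
Variables (R : realType) (V : vectType R).

(* k-forms are functions of k vectors; membership in the k-th exterior power of
   the dual space is the predicate is_form. *)
Definition kfun (k : nat) := ('I_k -> V) -> R.

Definition set_vec k (v : 'I_k -> V) (i : 'I_k) (x : V) : 'I_k -> V :=
  fun j => if j == i then x else v j.

Definition multilinear_form k (w : kfun k) : Prop :=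
  forall (v : 'I_k -> V) (i : 'I_k) (a : R) (x y : V),
    w (set_vec v i (a *: x + y)) = a * w (set_vec v i x) + w (set_vec v i y).

Definition alternating_form k (w : kfun k) : Prop :=
  forall (v : 'I_k -> V) (i j : 'I_k), i != j -> v i = v j -> w v = 0.

Definition is_form k (w : kfun k) : Prop :=
  multilinear_form w /\ alternating_form w.

Definition wedge p q (a : kfun p) (b : kfun q) : kfun (p + q) := fun v =>
  (p`! * q`!)%:R^-1 * \sum_(s : 'S_(p + q))
    (-1) ^+ s * (a (fun i => v (s (lshift q i))) *
                 b (fun j => v (s (rshift p j)))).

Definition cons_vec k (x : V) (v : 'I_k -> V) : 'I_k.+1 -> V :=
  fun i => oapp v x (unlift ord0 i).

Definition interior k (x : V) (w : kfun k.+1) : kfun k :=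
  fun v => w (cons_vec x v).

End Forms.

(* For i < j the vector v (lift j i) is v_i, and l |-> v (lift j (lift i l))
   lists v with the entries of index i and j removed. *)
Definition ce_diff (R : realType) (g : lieAlgType R) k
    (w : kfun g k.+1) : kfun g k.+2 := fun v =>
  \sum_(j < k.+2) \sum_(i < k.+1 | (i < j)%N)
    (-1) ^+ (i + j) *
    w (cons_vec (lie (v (lift j i)) (v j)) (fun l => v (lift j (lift i l)))).

Definition exact_form (R : realType) (g : lieAlgType R) k
    (w : kfun g k.+2) : Prop :=
  exists a : kfun g k.+1, is_form a /\ w = ce_diff a.

Section G2.
Variables (R : realType) (V : vectType R).
Implicit Types (phi : kfun V 3).

Definition root9 (x : R) : R := Num.sg x * `|x| `^ (9%:R^-1).

Lemma root9K x : root9 x ^+ 9 = x.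
Proof.
rewrite /root9 exprMn; have -> : (`|x| `^ 9%:R^-1) ^+ 9 = `|x|.
  by rewrite -powR_mulrn ?powR_ge0 // -powRrM mulVf ?pnatr_eq0 // powRr1.
by rewrite [RHS]numEsg; case: sgrP; rewrite ?expr1n ?expr0n //= -signr_odd.
Qed.

Definition b_form phi (x y : V) : kfun V 7 := fun v =>
  6%:R^-1 * wedge (wedge (interior x phi) (interior y phi)) phi v.

(* The determinant of b_phi : V -> V^* (x) Lambda^7 V^* lies in the ninth tensor
   power of the line Lambda^7 V^*; its value on (v_1, ..., v_7) is
   det (b_phi(v_i, v_j)(v_1, ..., v_7)), and det_b_root is the 7-form whose ninth
   power it is. *)
Definition det_b_root phi : kfun V 7 := fun v =>
  root9 (\det (\matrix_(i < 7, j < 7) b_form phi (v i) (v j) v)).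

(* For V of dimension 7, the quotient of two 7-forms is computed by evaluating
   them on a basis. *)
Definition g2_metric phi (x y : V) : R :=
  let e := fun i : 'I_7 => (vbasis {:V})`_i in
  (det_b_root phi e)^-1 * b_form phi x y e.

Lemma wedge22C (a b : kfun V 2) : wedge a b = wedge b a.
Proof.
apply: funext => v; rewrite /wedge; congr (_ * _).
pose f (i : 'I_(2 + 2)) : 'I_(2 + 2) := inord ((i + 2) %% 4).
have fl (i : 'I_2) : f (lshift 2 i) = rshift 2 i.
  by apply: val_inj; case: i => [[|[|]]] // ?; rewrite /= inordK.
have fr (i : 'I_2) : f (rshift 2 i) = lshift 2 i.
  by apply: val_inj; case: i => [[|[|]]] // ?; rewrite /= inordK.
have finj : injective f.
  apply: (can_inj (g := f)) => i; rewrite -[i]splitK.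
  by case: (split i) => k /=; rewrite ?fl ?fr ?fl.
pose t := perm finj.
have todd : odd_perm t = false.
  have -> : t = (tperm (lshift 2 ord0) (rshift 2 ord0) *
                 tperm (lshift 2 ord_max) (rshift 2 ord_max))%g.
    apply/permP => -[[|[|[|[|]]]] // ?]; rewrite permM /tperm !permE /=;
      by apply: val_inj; rewrite /= inordK.
  by rewrite odd_permM !odd_tperm.
rewrite (reindex_inj (mulgI t)); apply: eq_bigr => s _.
rewrite odd_permM todd addFb mulrC [RHS]mulrC; congr (_ * _).
rewrite [RHS]mulrC; congr (a _ * b _); apply: funext => i.
  by rewrite permM permE fl.
by rewrite permM permE fr.
Qed.

Lemma g2_metricC phi x y : g2_metric phi x y = g2_metric phi y x.
Proof. by rewrite /g2_metric /b_form wedge22C. Qed.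

Lemma g2_metric_linearl phi c x y z : is_form phi ->
  g2_metric phi (c *: y + z) x = c * g2_metric phi y x + g2_metric phi z x.
Proof.
move=> [lphi _]; rewrite /g2_metric; set e := fun i => _; set k := _^-1.
have cE (u : V) (w : 'I_2 -> V) : cons_vec u w = set_vec (cons_vec 0 w) ord0 u.
  apply: funext => i; rewrite /cons_vec /set_vec.
  by case: (unliftP ord0 i) => [j|] -> //=.
rewrite /b_form /wedge !(mulrCA c) -!mulrDr.
congr (_ * (_ * (_ * _))).
rewrite mulr_sumr -big_split; apply: eq_bigr => s _ /=.
rewrite (mulrCA c) -mulrDr; congr (_ * _).
rewrite mulrA -mulrDl; congr (_ * _).
rewrite (mulrCA c) -mulrDr; congr (_ * _).
rewrite mulr_sumr -big_split; apply: eq_bigr => t _ /=.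
rewrite (mulrCA c) -mulrDr; congr (_ * _).
rewrite mulrA -mulrDl; congr (_ * _).
by rewrite /interior (cE (c *: y + z)) (cE y) (cE z) lphi.
Qed.

(* g2_metricC and g2_metric_linearl show that g2_metric is always symmetric and
   bilinear. *)
Definition g2_structure phi : Prop :=
  [/\ is_form phi,
      exists v, det_b_root phi v != 0 &
      forall x, x != 0 -> 0 < g2_metric phi x x].

End G2.

(* Main.v *)
Require Import Defs.
From HB Require Import structures.
From mathcomp Require Import all_boot all_order all_fingroup all_algebra.
From mathcomp Require Import boolp reals.
From mathcomp Require Import ring lra zify.

(* Let [n] be the nilradical, [z] the last nonzero term of its descending central
   series, and [phi = d alpha].  As [g] is solvable, [g, g] lies in [n]; hence [g]
   acts on [z] by commuting maps, which are traceless, and [g] is unimodular.  A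
   central vector [v] is excluded because the contraction of [phi] by [v] would be
   an exact symplectic form on the unimodular algebra [g / v].

   Since [phi (z, z, n) = 0], the cross product with a nonzero [v] in [z] embeds
   [z / v] in the dual of [g / n], so that [dim z + dim n <= 8] and [dim z <= 4].
   The formula [phi (v, w, x) = alpha ([x, v], w) + alpha (v, [x, w])] up to sign
   and the vanishing of the traces exclude the dimensions 1, 2 and 3.

   There remains an abelian coassociative [n = z] of dimension 4.  Without central
   vectors, some element acts invertibly on [z], so [z] has an abelian complement
   [a]; so are its translates [{x + [x, u] : x in a}] for [u] in [z], and [phi]
   vanishes on all of them.  This makes the quadratic form [u |-> sum over i of
   phi (x_i, [x_j, u], [x_k, u])] vanish, which lets us choose [u] such that the
   mixed components of [phi] along the translate lie in the 8-dimensional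
   irreducible part of [z (x) R^3].  There [sum_i b_phi (x_i, x_i)] and
   [b_phi (v, v)], for [v] in [z], have opposite signs. *)

Set Implicit Arguments.
Unset Strict Implicit.
Unset Printing Implicit Defensive.

Import Order.TTheory GRing.Theory Num.Theory passmx.
Local Open Scope ring_scope.

(** * Alternating forms and wedge products *)


(** Two substitutes are used: the nilpotency of [[g, g]] is proved on chief factors, where vanishing
    traces of powers detect nilpotent matrices, and commuting matrices are compared through
    generalized kernels of a generic pencil.

    Positivity of the metric enters only in this form: for nonzero [x] and [y], the values of
    [b_phi (x, x)] and [b_phi (y, y)] on the same seven vectors have the same sign, and they are
    nonzero on a basis. No orthonormal basis of [g] is ever chosen.

    In the last case everything rests on one algebraic fact. On the triples [f] in [z (x) R^3] with
    [sum_k J_k f_k = 0], an 8-dimensional space, the quadratic form built from [phi (x_i, f_j, f_k)]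
    is definite. Applied to the triple of the [[x_k, u]], on which this form vanishes, it shows that
    [u |-> sum_k J_k [x_k, u]] is injective on the 4-dimensional [z], hence onto, so the required
    correction [u] exists. Its dual version, applied to the corrected mixed components, yields the
    contradictory signs. *)

Section Multilinear.
Variables (R : realType) (V : vectType R).

Lemma cons_vecE (k : nat) (x : V) (v : 'I_k -> V) :
  cons_vec x v = set_vec (cons_vec 0 v) ord0 x.
Proof.
apply: funext => i; rewrite /cons_vec /set_vec.
by case: (unliftP ord0 i) => [j|] -> //=.
Qed.

Lemma cons_vec0 (k : nat) (x : V) (v : 'I_k -> V) : cons_vec x v ord0 = x.
Proof. by rewrite /cons_vec unlift_none. Qed.

Lemma cons_vec_lift (k : nat) (x : V) (v : 'I_k -> V) i :
  cons_vec x v (lift ord0 i) = v i.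
Proof. by rewrite /cons_vec liftK. Qed.

Lemma cons_vec_eta (k : nat) (v : 'I_k.+1 -> V) :
  v = cons_vec (v ord0) (fun i => v (lift ord0 i)).
Proof.
apply: funext => i.
by case: (unliftP ord0 i) => [j|] ->; rewrite ?cons_vec0 ?cons_vec_lift.
Qed.

Lemma set_vec_cons (k : nat) (x y : V) (v : 'I_k -> V) i :
  cons_vec x (set_vec v i y) = set_vec (cons_vec x v) (lift ord0 i) y.
Proof.
apply: funext => j; rewrite /set_vec.
case: (unliftP ord0 j) => [j'|] ->; rewrite ?cons_vec0 ?cons_vec_lift //.
Qed.

Lemma multilinear_cons (k : nat) (w : kfun V k.+1) a x y v :
  multilinear_form w ->
  w (cons_vec (a *: x + y) v) = a * w (cons_vec x v) + w (cons_vec y v).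
Proof. by move=> mw; rewrite (cons_vecE (_ + _)) (cons_vecE x) (cons_vecE y) mw. Qed.

Lemma multilinear_interior (k : nat) (w : kfun V k.+1) x :
  multilinear_form w -> multilinear_form (interior x w).
Proof. by move=> mw v i a y z; rewrite /interior !set_vec_cons mw. Qed.

Lemma multilinear_cons0 (k : nat) (w : kfun V k.+1) v :
  multilinear_form w -> w (cons_vec 0 v) = 0.
Proof.
move=> mw; have := multilinear_cons 1 0 0 v mw.
rewrite scale1r addr0 mul1r => /eqP; rewrite -subr_eq0 opprD addrA subrr.
by rewrite add0r oppr_eq0 => /eqP.
Qed.

Lemma multilinear_cons_sum (k n : nat) (w : kfun V k.+1) (c : 'I_n -> R) e v :
  multilinear_form w ->
  w (cons_vec (\sum_j c j *: e j) v) = \sum_j c j * w (cons_vec (e j) v).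
Proof.
move=> mw.
apply: (big_ind2 (fun x y => w (cons_vec x v) = y)).
- exact: multilinear_cons0.
- by move=> x a y b <- <-; rewrite -[x]scale1r multilinear_cons // scale1r mul1r.
move=> j _; rewrite -[_ *: _]addr0 multilinear_cons // multilinear_cons0 //.
by rewrite addr0.
Qed.

Lemma big_ffun_ord_recl (k n : nat) (F : {ffun 'I_k.+1 -> 'I_n} -> R) :
  \sum_f F f =
  \sum_(j < n) \sum_(f : {ffun 'I_k -> 'I_n})
    F [ffun i => oapp f j (unlift ord0 i)].
Proof.
rewrite pair_big /=.
pose h (p : 'I_n * {ffun 'I_k -> 'I_n}) : {ffun 'I_k.+1 -> 'I_n} :=
  [ffun i => oapp p.2 p.1 (unlift ord0 i)].
pose h' (f : {ffun 'I_k.+1 -> 'I_n}) : 'I_n * {ffun 'I_k -> 'I_n} :=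
  (f ord0, [ffun i => f (lift ord0 i)]).
rewrite (reindex h); first by apply: eq_bigr => -[].
exists h' => [[j f] _ | f _].
  rewrite /h /h'; congr pair; first by rewrite ffunE unlift_none.
  by apply/ffunP => i; rewrite !ffunE liftK.
by apply/ffunP => i; rewrite !ffunE; case: unliftP => [j|] -> /=; rewrite ?ffunE.
Qed.

Lemma multilinear_expand (k n : nat) (w : kfun V k) (P : 'I_k -> 'I_n -> R)
    (e : 'I_n -> V) :
  multilinear_form w ->
  w (fun i => \sum_j P i j *: e j) =
  \sum_(f : {ffun 'I_k -> 'I_n}) (\prod_i P i (f i)) * w (fun i => e (f i)).
Proof.
elim: k w P => [|k IH] w P mw.
  rewrite (eq_bigr (fun=> w (fun i => \sum_j P i j *: e j))).
    by rewrite sumr_const card_ffun !card_ord expn0 mulr1n.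
  move=> f _; rewrite big_ord0 mul1r; congr w.
  by apply: funext => -[].
rewrite (cons_vec_eta (fun i => _)) multilinear_cons_sum //.
rewrite big_ffun_ord_recl; apply: eq_bigr => j _.
rewrite -[w (cons_vec _ _)]/(interior (e j) w _).
rewrite (IH _ (fun i => P (lift ord0 i))); last exact: multilinear_interior.
rewrite big_distrr /=; apply: eq_bigr => f _.
rewrite big_ord_recl mulrA ffunE unlift_none /=; congr (_ * _ * _).
  by apply: eq_bigr => i _; rewrite ffunE liftK.
rewrite /interior; congr w; apply: funext => i.
rewrite ffunE; case: (unliftP ord0 i) => [i'|] ->.
  by rewrite cons_vec_lift.
by rewrite cons_vec0.
Qed.

Lemma alternating_tperm (k : nat) (w : kfun V k) v (i j : 'I_k) : i != j ->
  is_form w -> w (fun l => v (tperm i j l)) = - w v.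
Proof.
move=> nij [mw aw].
pose s x y := set_vec (set_vec v i x) j y.
have mD x y z t : w (s (x + y) (z + t)) =
    w (s x z) + w (s x t) + (w (s y z) + w (s y t)).
  have l2 p q r : w (s p (q + r)) = w (s p q) + w (s p r).
    by rewrite -[q]scale1r mw scale1r mul1r.
  have sC p q : s p q = set_vec (set_vec v j q) i p.
    apply: funext => l; rewrite /s /set_vec.
    by case: eqP => // ->; rewrite eq_sym (negbTE nij).
  have l1 p q r : w (s (p + q) r) = w (s p r) + w (s q r).
    by rewrite !sC -[p]scale1r mw scale1r mul1r.
  by rewrite l1 !l2.
have s0 x : w (s x x) = 0.
  apply: (aw _ i j) => //; rewrite /s /set_vec eqxx.
  by rewrite (negbTE nij) eqxx.
have := mD (v i) (v j) (v i) (v j); rewrite !s0 add0r addr0.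
have -> : s (v i) (v j) = v.
  apply: funext => l; rewrite /s /set_vec.
  by case: eqP => [->|] //; case: eqP => [->|].
have -> : s (v j) (v i) = (fun l => v (tperm i j l)).
  apply: funext => l; rewrite /s /set_vec;
    case: tpermP => [->|->|/eqP/negbTE-> /eqP/negbTE->] //.
    by rewrite (negbTE nij) eqxx.
  by rewrite eqxx.
by move=> /eqP; rewrite eq_sym addrC addr_eq0 => /eqP.
Qed.

Lemma alternating_perm (k : nat) (w : kfun V k) v (s : 'S_k) :
  is_form w -> w (fun l => v (s l)) = (-1) ^+ s * w v.
Proof.
move=> fw; case: (prod_tpermP s) => ts -> {s}; elim: ts v => [|t ts IH] v /=.
  move=> _; rewrite big_nil odd_perm1 expr0 mul1r; congr w.
  by apply: funext => l; rewrite perm1.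
move=> /andP[dt dts]; rewrite big_cons odd_mul_tperm dt signr_addb expr1.
rewrite mulN1r mulNr -IH //.
rewrite -(@alternating_tperm _ _ _ t.1 t.2) //; congr w.
by apply: funext => l; rewrite permM.
Qed.

(** In the multilinear expansion only the injective index functions survive. These are the
    permutations, and their signs turn the sum into the Leibniz formula. *)
Lemma form_det (k : nat) (w : kfun V k) (P : 'M[R]_k) (e : 'I_k -> V) :
  is_form w -> w (fun i => \sum_j P i j *: e j) = \det P * w e.
Proof.
move=> fw; rewrite multilinear_expand; last by case: fw.
rewrite (bigID (fun f : {ffun _} => injectiveb f)) /= addrC big1 ?add0r; last first.
  move=> f /injectivePn[i [j nij fij]]; case: fw => _ aw.
  by rewrite (aw _ i j) ?mulr0 // fij.
rewrite /determinant big_distrl /=.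
rewrite (reindex (@pval _)) /=; last first.
  pose in_Sn := insubd (1%g : 'S_k).
  by exists in_Sn => /= f Uf; first apply: val_inj; apply: insubdK.
apply: eq_big => [s|s _]; first by rewrite (valP s).
rewrite -!(@pvalE _ s) -mulrA mulrCA -(alternating_perm e s fw).
by congr (_ * w _); apply: funext => i; rewrite pvalE.
Qed.

Lemma interior_form (k : nat) (w : kfun V k.+1) x :
  is_form w -> is_form (interior x w).
Proof.
move=> [mw aw]; split; first exact: multilinear_interior.
move=> v i j nij vij; apply: (aw _ (lift ord0 i) (lift ord0 j)).
  by rewrite (inj_eq (@lift_inj _ ord0)).
by rewrite !cons_vec_lift.
Qed.

(** Moving [x] from slot [j] to the front is a cycle of length [j + 1], of sign [(-1) ^+ j]. *)
Lemma alternating_insert (k : nat) (w : kfun V k.+1) x u j : is_form w ->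
  w (fun i => oapp u x (unlift j i)) = (-1) ^+ j * w (cons_vec x u).
Proof.
move=> fw; pose s := lift_perm j ord0 1%g.
have -> : (fun i => oapp u x (unlift j i)) = (fun i => cons_vec x u (s i)).
  apply: funext => i; rewrite /s; case: (unliftP j i) => [i'|] -> /=.
    by rewrite lift_perm_lift perm1 cons_vec_lift.
  by rewrite lift_perm_id cons_vec0.
rewrite alternating_perm // odd_lift_perm odd_perm1 addbF /= addbF.
by rewrite signr_odd.
Qed.

Lemma wedge_form (p q : nat) (a : kfun V p) (c : kfun V q) :
  multilinear_form a -> multilinear_form c -> is_form (wedge a c).
Proof.
move=> ma mc; split=> [v i x y z | v i j nij vij]; rewrite /wedge.
  rewrite [X in _ = X + _]mulrCA -mulrDr; congr (_ * _).
  rewrite big_distrr -big_split; apply: eq_bigr => s _ /=.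
  rewrite [X in _ = X + _]mulrCA -mulrDr; congr (_ * _).
  have sv t : (fun l => set_vec v i t (s l)) =
      set_vec (fun l => v (s l)) ((s^-1)%g i) t.
    by apply: funext => l; rewrite /set_vec (can2_eq (permK s) (permKV s)).
  (* The vector in slot [i] becomes argument number [s^-1 i], which lies in exactly one of the two
     blocks; only the factor of that block depends on it. *)
  have sl (f : 'I_p -> 'I_(p + q)) t : injective f ->
    (fun l => set_vec v i t (s (f l))) =
      if [pick k | f k == (s^-1)%g i] is Some k
        then set_vec (fun l => v (s (f l))) k t else fun l => v (s (f l)).
    move=> fI; apply: funext => l; have /(congr1 (@^~ (f l))) /= -> := sv t.
    case: pickP => [k /eqP <-|H]; rewrite /set_vec ?(inj_eq fI) //.
    by rewrite H.
  have sr (f : 'I_q -> 'I_(p + q)) t : injective f ->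
    (fun l => set_vec v i t (s (f l))) =
      if [pick k | f k == (s^-1)%g i] is Some k
        then set_vec (fun l => v (s (f l))) k t else fun l => v (s (f l)).
    move=> fI; apply: funext => l; have /(congr1 (@^~ (f l))) /= -> := sv t.
    case: pickP => [k /eqP <-|H]; rewrite /set_vec ?(inj_eq fI) //.
    by rewrite H.
  rewrite !(sl _ _ (@lshift_inj p q)) !(sr _ _ (@rshift_inj p q)).
  case: pickP => [k /eqP kE|nk]; case: pickP => [l /eqP lE|nl].
  - by have := eq_lrshift k l; rewrite kE lE eqxx.
  - by rewrite ma; ring.
  - by rewrite mc; ring.
  have := nk; have := nl; move: ((s^-1)%g i) => r {}nk {}nl.
  case: (split_ordP r) => k rE; first by have := nl k; rewrite rE eqxx.
  by have := nk k; rewrite rE eqxx.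
set S := \sum_(s : _) _; suff -> : S = 0 by rewrite mulr0.
suff SN : S = - S by lra.
rewrite {1}/S (reindex_inj (mulIg (tperm i j))) /= -sumrN.
apply: eq_bigr => s _; rewrite odd_permM odd_tperm nij signr_addb expr1.
have vt l : v ((s * tperm i j)%g l) = v (s l).
  by rewrite permM; case: tpermP => // ->.
rewrite mulrN1 mulNr; congr (- (_ * (a _ * c _))).
all: by apply: funext => l; rewrite vt.
Qed.

Lemma sign_cancel (j : nat) (a b c : R) :
  (-1) ^+ j * a * ((-1) ^+ j * b * c) = a * (b * c).
Proof.
have := sqrr_sign R j; rewrite expr2; move: ((-1) ^+ j) => e ee.
by transitivity (e * e * (a * (b * c))); [ring | rewrite ee mul1r].
Qed.

(* [E] lets the index [n] be any number known to be [p + q]: the two summands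
   of the Leibniz rule below have indices [p + q.+1] and [p.+1 + q]. *)
Definition wedge_sum (p q n : nat) (E : (p + q = n)%N) (a : kfun V p)
    (c : kfun V q) (v : 'I_n -> V) : R :=
  \sum_(s : 'S_n) (-1) ^+ s * (a (fun i => v (s (cast_ord E (lshift q i)))) *
                               c (fun j => v (s (cast_ord E (rshift p j))))).

Lemma big_perm_image (n : nat) (j : 'I_n.+1) (F : 'S_n.+1 -> R) :
  \sum_(s : 'S_n.+1 | s j == ord0) F s =
  \sum_(s : 'S_n) F (lift_perm j ord0 s).
Proof.
rewrite (reindex (lift_perm j ord0)); last first.
  pose ulsf i (s : 'S_n.+1) k := odflt k (unlift (s i) (s (lift i k))).
  have ulsfK i (s : 'S_n.+1) k : lift (s i) (ulsf i s k) = s (lift i k).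
    rewrite /ulsf; have:= neq_lift i k.
    by rewrite -(can_eq (permK s)) => /unlift_some[] ? ? ->.
  have inj_ulsf : injective (ulsf j _).
    move=> s; apply: can_inj (ulsf (s j) s^-1%g) _ => k'.
    by rewrite {1}/ulsf ulsfK !permK liftK.
  exists (fun s => perm (inj_ulsf s)) => [s _ | s].
    by apply/permP=> k'; rewrite permE /ulsf lift_perm_lift lift_perm_id liftK.
  move/(s _ =P _) => si0; apply/permP => k.
  case: (unliftP j k) => [k'|] ->; rewrite ?lift_perm_id //.
  by rewrite lift_perm_lift -si0 permE ulsfK.
by apply: eq_bigl => s; rewrite lift_perm_id eqxx.
Qed.

(** The permutations are sorted by the argument position [j] that receives [x]. Moving [x] to the
    front of its factor costs a sign that cancels against the sign of the lifted permutation, so all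
    positions of one block contribute equally: hence the multiplicities [p + 1] and [q + 1]. Passing
    the first block leaves the sign [(-1) ^+ p.+1]. *)
Lemma wedge_sum_cons (p q n : nat) (E : (p.+1 + q.+1 = n.+1)%N)
    (E1 : (p + q.+1 = n)%N) (E2 : (p.+1 + q = n)%N)
    (a : kfun V p.+1) (c : kfun V q.+1) x (v : 'I_n -> V) :
  is_form a -> is_form c ->
  wedge_sum E a c (cons_vec x v) =
    p.+1%:R * wedge_sum E1 (interior x a) c v +
    q.+1%:R * (-1) ^+ p.+1 * wedge_sum E2 a (interior x c) v.
Proof.
move=> fa fc; rewrite /wedge_sum.
rewrite (partition_big (fun s : 'S_n.+1 => (s^-1)%g ord0) xpredT) //=.
rewrite (eq_bigr (fun j => \sum_(s : 'S_n.+1 | s j == ord0)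
    (-1) ^+ s * (a (fun i => cons_vec x v (s (cast_ord E (lshift q.+1 i)))) *
      c (fun i => cons_vec x v (s (cast_ord E (rshift p.+1 i))))))); last first.
  move=> j _; apply: eq_bigl => s.
  by rewrite -(inj_eq (@perm_inj _ s)) permKV eq_sym.
rewrite (reindex_onto (cast_ord E) (cast_ord (esym E))) /=; last first.
  by move=> i _; rewrite cast_ordKV.
rewrite (eq_bigl xpredT); last by move=> i; rewrite cast_ordK eqxx.
rewrite big_split_ord /=; congr (_ + _).
  rewrite (eq_bigr (fun=> \sum_(s : 'S_n) (-1) ^+ s *
      (interior x a (fun i => v (s (cast_ord E1 (lshift q.+1 i)))) *
       c (fun j => v (s (cast_ord E1 (rshift p j))))))).
    by rewrite sumr_const card_ord mulr_natl.
  move=> j _; rewrite big_perm_image; apply: eq_bigr => s _.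
  set a1 := a _; set c1 := c _.
  have -> : a1 = (-1) ^+ j *
      interior x a (fun i => v (s (cast_ord E1 (lshift q.+1 i)))).
    rewrite /interior -alternating_insert // /a1; congr a; apply: funext => i.
    case: (unliftP j i) => [i'|] -> /=.
      have -> : cast_ord E (lshift q.+1 (lift j i')) =
         lift (cast_ord E (lshift q.+1 j)) (cast_ord E1 (lshift q.+1 i')).
        exact: val_inj.
      by rewrite lift_perm_lift cons_vec_lift.
    by rewrite lift_perm_id cons_vec0.
  have -> : c1 = c (fun i => v (s (cast_ord E1 (rshift p i)))).
    rewrite /c1; congr c; apply: funext => i.
    have -> : cast_ord E (rshift p.+1 i) =
         lift (cast_ord E (lshift q.+1 j)) (cast_ord E1 (rshift p i)).
      apply: val_inj; rewrite /= /bump.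
      by rewrite (leq_trans _ (leq_addr i p)) // -ltnS.
    by rewrite lift_perm_lift cons_vec_lift.
  rewrite odd_lift_perm /= addbF signr_addb signr_odd.
  set A := interior _ _ _; set C := c _.
  exact: sign_cancel.
rewrite (eq_bigr (fun=> (-1) ^+ p.+1 * \sum_(s : 'S_n) (-1) ^+ s *
    (a (fun i => v (s (cast_ord E2 (lshift q i)))) *
     interior x c (fun j => v (s (cast_ord E2 (rshift p.+1 j))))))).
  by rewrite sumr_const card_ord -[LHS]mulr_natl mulrA.
move=> j _; rewrite big_perm_image big_distrr; apply: eq_bigr => s _ /=.
set a1 := a _; set c1 := c _.
have -> : c1 = (-1) ^+ j *
    interior x c (fun i => v (s (cast_ord E2 (rshift p.+1 i)))).
  rewrite /interior -alternating_insert // /c1; congr c; apply: funext => i.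
  case: (unliftP j i) => [i'|] -> /=.
    have -> : cast_ord E (rshift p.+1 (lift j i')) =
       lift (cast_ord E (rshift p.+1 j)) (cast_ord E2 (rshift p.+1 i')).
      by apply: val_inj; rewrite /= /bump leq_add2l addnCA.
    by rewrite lift_perm_lift cons_vec_lift.
  by rewrite lift_perm_id cons_vec0.
have -> : a1 = a (fun i => v (s (cast_ord E2 (lshift q i)))).
  rewrite /a1; congr a; apply: funext => i.
  have -> : cast_ord E (lshift q.+1 i) =
       lift (cast_ord E (rshift p.+1 j)) (cast_ord E2 (lshift q i)).
    by apply: val_inj; rewrite /= /bump leqNgt (leq_trans (ltn_ord i)) ?leq_addr.
  by rewrite lift_perm_lift cons_vec_lift.
rewrite odd_lift_perm -[odd (@ord0 n)]/false addbF signr_addb signr_odd.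
rewrite -[nat_of_ord (cast_ord _ _)]/(p.+1 + j)%N.
set A := a _; set C := interior _ _ _.
rewrite exprD -!mulrA; congr (_ * _); rewrite (mulrCA A).
have := sign_cancel j ((-1) ^+ s) A C.
by rewrite -!mulrA.
Qed.

Lemma wedge_sum_0l (q : nat) (E : (0 + q = q)%N) (a : kfun V 0) (c : kfun V q) u v :
  is_form c -> wedge_sum E a c v = q`!%:R * (a u * c v).
Proof.
move=> fc; rewrite /wedge_sum (eq_bigr (fun=> a u * c v)).
  by rewrite sumr_const card_Sn mulr_natl.
move=> s _.
have -> : a (fun i => v (s (cast_ord E (lshift q i)))) = a u.
  by congr a; apply: funext => -[].
have -> : c (fun j => v (s (cast_ord E (rshift 0 j)))) = (-1) ^+ s * c v.
  rewrite -alternating_perm //; congr c; apply: funext => j; congr (v (s _)).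
  exact: val_inj.
have := sign_cancel s 1 (a u) (c v); rewrite mulr1 mul1r => <-.
by rewrite -mulrA (mulrCA (a u)).
Qed.

Lemma wedge_sum_0r (p : nat) (E : (p + 0 = p)%N) (a : kfun V p) (c : kfun V 0) u v :
  is_form a -> wedge_sum E a c v = p`!%:R * (a v * c u).
Proof.
move=> fa; rewrite /wedge_sum (eq_bigr (fun=> a v * c u)).
  by rewrite sumr_const card_Sn mulr_natl.
move=> s _.
have -> : c (fun i => v (s (cast_ord E (rshift p i)))) = c u.
  by congr c; apply: funext => -[].
have -> : a (fun j => v (s (cast_ord E (lshift 0 j)))) = (-1) ^+ s * a v.
  rewrite -alternating_perm //; congr a; apply: funext => j; congr (v (s _)).
  exact: val_inj.
by have := sign_cancel s 1 (a v) (c u); rewrite mulr1 mul1r => <-.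
Qed.

End Multilinear.


(** * Wedge products evaluated on explicit vectors *)

Section Explicit.
Variables (R : realType) (V : vectType R).

Definition vec0 : 'I_0 -> V := fun=> 0.
Definition vec2 x y : 'I_2 -> V := cons_vec x (cons_vec y vec0).
Definition vec3 x y z : 'I_3 -> V := cons_vec x (vec2 y z).
Definition vec4 x y z w : 'I_4 -> V := cons_vec x (vec3 y z w).
Definition vec7 e0 e1 e2 e3 e4 e5 e6 : 'I_7 -> V :=
  cons_vec e0 (cons_vec e1 (cons_vec e2 (vec4 e3 e4 e5 e6))).

Definition wedge_cast (p q n : nat) (E : (p + q = n)%N) (a : kfun V p)
    (c : kfun V q) (v : 'I_n -> V) : R :=
  (p`! * q`!)%:R^-1 * wedge_sum E a c v.

Lemma wedgeE (p q : nat) (a : kfun V p) (c : kfun V q) v :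
  wedge a c v = wedge_cast (erefl (p + q)%N) a c v.
Proof.
rewrite /wedge /wedge_cast /wedge_sum; congr (_ * _); apply: eq_bigr => s _.
congr (_ * (a _ * c _)); apply: funext => i; congr (v (s _)).
all: exact: val_inj.
Qed.

(** The factorial normalization absorbs the multiplicities, and contraction becomes an
    antiderivation. Iterating this rule peels off one vector at a time, down to factors of degree
    zero. *)
Lemma wedge_cast_cons (p q n : nat) (E : (p.+1 + q.+1 = n.+1)%N)
    (E1 : (p + q.+1 = n)%N) (E2 : (p.+1 + q = n)%N)
    (a : kfun V p.+1) (c : kfun V q.+1) x (v : 'I_n -> V) :
  is_form a -> is_form c ->
  wedge_cast E a c (cons_vec x v) = wedge_cast E1 (interior x a) c v +
    (-1) ^+ p.+1 * wedge_cast E2 a (interior x c) v.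
Proof.
move=> fa fc; rewrite /wedge_cast (wedge_sum_cons E E1 E2) //.
move: (wedge_sum E1 _ _ _) (wedge_sum E2 _ _ _) ((-1) ^+ p.+1) => S T e.
have nz k : k`!%:R != 0 :> R by rewrite pnatr_eq0 -lt0n fact_gt0.
have nzS k : k.+1%:R != 0 :> R by rewrite pnatr_eq0.
rewrite !factS !natrM.
have := nz p; have := nz q; have := nzS p; have := nzS q.
move: (p`!%:R) (q`!%:R) (p.+1%:R : R) (q.+1%:R : R) => r1 r2 r3 r4 h1 h2 h3 h4.
by field; rewrite h1 h2 h3 h4.
Qed.

Lemma wedge_cast_0l (q : nat) (E : (0 + q = q)%N) (a : kfun V 0) (c : kfun V q) v :
  is_form c -> wedge_cast E a c v = a vec0 * c v.
Proof.
move=> fc; rewrite /wedge_cast (wedge_sum_0l _ _ vec0) // fact0 mul1n mulKf //.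
by rewrite pnatr_eq0 -lt0n fact_gt0.
Qed.

Lemma wedge_cast_0r (p : nat) (E : (p + 0 = p)%N) (a : kfun V p) (c : kfun V 0) v :
  is_form a -> wedge_cast E a c v = a v * c vec0.
Proof.
move=> fa; rewrite /wedge_cast (wedge_sum_0r _ _ vec0) // fact0 muln1 mulKf //.
by rewrite pnatr_eq0 -lt0n fact_gt0.
Qed.

Let rule p q n := @wedge_cast_cons p q n.
Ltac forms := by do ?[assumption | apply: interior_form].

Lemma wedge22E (a b : kfun V 2) x y z w : is_form a -> is_form b ->
  wedge a b (vec4 x y z w) =
  a (vec2 x y) * b (vec2 z w) - a (vec2 x z) * b (vec2 y w)
  + a (vec2 x w) * b (vec2 y z) + a (vec2 y z) * b (vec2 x w)
  - a (vec2 y w) * b (vec2 x z) + a (vec2 z w) * b (vec2 x y).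
Proof.
move=> fa fb; rewrite wedgeE /vec4 /vec3 /vec2.
rewrite (@rule 1 1 3 erefl erefl erefl) //.
rewrite (@rule 0 1 2 erefl erefl erefl) ?(@rule 1 0 2 erefl erefl erefl);
  try forms.
rewrite !(@rule 0 0 1 erefl erefl erefl); try forms.
rewrite !wedge_cast_0l ?wedge_cast_0r; try forms.
by rewrite /interior -!/(vec2 _ _); ring.
Qed.

(** The 35 terms are the (4,3)-shuffles. Iterated contraction produces them without listing the 5040
    permutations. *)
Lemma wedge43E (a : kfun V 4) (c : kfun V 3) e0 e1 e2 e3 e4 e5 e6 :
  is_form a -> is_form c ->
  wedge a c (vec7 e0 e1 e2 e3 e4 e5 e6) =
  a (vec4 e0 e1 e2 e3) * c (vec3 e4 e5 e6)
  - a (vec4 e0 e1 e2 e4) * c (vec3 e3 e5 e6)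
  + a (vec4 e0 e1 e2 e5) * c (vec3 e3 e4 e6)
  - a (vec4 e0 e1 e2 e6) * c (vec3 e3 e4 e5)
  + a (vec4 e0 e1 e3 e4) * c (vec3 e2 e5 e6)
  - a (vec4 e0 e1 e3 e5) * c (vec3 e2 e4 e6)
  + a (vec4 e0 e1 e3 e6) * c (vec3 e2 e4 e5)
  + a (vec4 e0 e1 e4 e5) * c (vec3 e2 e3 e6)
  - a (vec4 e0 e1 e4 e6) * c (vec3 e2 e3 e5)
  + a (vec4 e0 e1 e5 e6) * c (vec3 e2 e3 e4)
  - a (vec4 e0 e2 e3 e4) * c (vec3 e1 e5 e6)
  + a (vec4 e0 e2 e3 e5) * c (vec3 e1 e4 e6)
  - a (vec4 e0 e2 e3 e6) * c (vec3 e1 e4 e5)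
  - a (vec4 e0 e2 e4 e5) * c (vec3 e1 e3 e6)
  + a (vec4 e0 e2 e4 e6) * c (vec3 e1 e3 e5)
  - a (vec4 e0 e2 e5 e6) * c (vec3 e1 e3 e4)
  + a (vec4 e0 e3 e4 e5) * c (vec3 e1 e2 e6)
  - a (vec4 e0 e3 e4 e6) * c (vec3 e1 e2 e5)
  + a (vec4 e0 e3 e5 e6) * c (vec3 e1 e2 e4)
  - a (vec4 e0 e4 e5 e6) * c (vec3 e1 e2 e3)
  + a (vec4 e1 e2 e3 e4) * c (vec3 e0 e5 e6)
  - a (vec4 e1 e2 e3 e5) * c (vec3 e0 e4 e6)
  + a (vec4 e1 e2 e3 e6) * c (vec3 e0 e4 e5)
  + a (vec4 e1 e2 e4 e5) * c (vec3 e0 e3 e6)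
  - a (vec4 e1 e2 e4 e6) * c (vec3 e0 e3 e5)
  + a (vec4 e1 e2 e5 e6) * c (vec3 e0 e3 e4)
  - a (vec4 e1 e3 e4 e5) * c (vec3 e0 e2 e6)
  + a (vec4 e1 e3 e4 e6) * c (vec3 e0 e2 e5)
  - a (vec4 e1 e3 e5 e6) * c (vec3 e0 e2 e4)
  + a (vec4 e1 e4 e5 e6) * c (vec3 e0 e2 e3)
  + a (vec4 e2 e3 e4 e5) * c (vec3 e0 e1 e6)
  - a (vec4 e2 e3 e4 e6) * c (vec3 e0 e1 e5)
  + a (vec4 e2 e3 e5 e6) * c (vec3 e0 e1 e4)
  - a (vec4 e2 e4 e5 e6) * c (vec3 e0 e1 e3)
  + a (vec4 e3 e4 e5 e6) * c (vec3 e0 e1 e2).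
Proof.
move=> fa fb; rewrite wedgeE /vec7 /vec4 /vec3 /vec2.
rewrite (@rule 3 2 6 erefl erefl erefl) //.
rewrite (@rule 2 2 5 erefl erefl erefl) ?(@rule 3 1 5 erefl erefl erefl); try forms.
rewrite !(@rule 1 2 4 erefl erefl erefl) ?(@rule 2 1 4 erefl erefl erefl)
  ?(@rule 3 0 4 erefl erefl erefl); try forms.
rewrite !(@rule 0 2 3 erefl erefl erefl) ?(@rule 1 1 3 erefl erefl erefl)
  ?(@rule 2 0 3 erefl erefl erefl); try forms.
rewrite !(@rule 0 1 2 erefl erefl erefl) ?(@rule 1 0 2 erefl erefl erefl); try forms.
rewrite !(@rule 0 0 1 erefl erefl erefl); try forms.
rewrite !wedge_cast_0l ?wedge_cast_0r; try forms.
rewrite /interior -!/(vec2 _ _) -!/(vec3 _ _ _) -!/(vec4 _ _ _ _).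
by rewrite !exprS expr0; ring.
Qed.

End Explicit.

(** * The cross product and the sign of the metric of a G2-structure *)


Section Eval.
Variables (R : realType) (V : vectType R).

Section Two.
Variables (w : kfun V 2).
Hypothesis fw : is_form w.
Local Notation f x y := (w (vec2 x y)).
Implicit Types x y z : V.

Lemma form2Pl c x y z : f (c *: x + y) z = c * f x z + f y z.
Proof. by apply: multilinear_cons; case: fw. Qed.

Lemma form2Pr c x y z : f z (c *: x + y) = c * f z x + f z y.
Proof.
by apply: (@multilinear_cons _ _ _ (interior z w)); case: (interior_form z fw).
Qed.

Lemma form2_xx x : f x x = 0.
Proof.
case: fw => _ aw; apply: (aw _ ord0 (lift ord0 ord0)) => //.
by rewrite /vec3 /vec2 cons_vec_lift !cons_vec0.
Qed.

Lemma form2C x y : f x y = - f y x.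
Proof.
have := form2_xx (1 *: x + y); rewrite form2Pl !form2Pr !form2_xx; lra.
Qed.

End Two.

Section Three.
Variables (w : kfun V 3).
Hypothesis fw : is_form w.
Local Notation f x y z := (w (vec3 x y z)).
Implicit Types x y z : V.

Lemma form3P1 c x y z t : f (c *: x + y) z t = c * f x z t + f y z t.
Proof. by apply: multilinear_cons; case: fw. Qed.

Lemma form3P2 c x y z t : f z (c *: x + y) t = c * f z x t + f z y t.
Proof. exact: (form2Pl (interior_form z fw)). Qed.

Lemma form3P3 c x y z t : f z t (c *: x + y) = c * f z t x + f z t y.
Proof. exact: (form2Pr (interior_form z fw)). Qed.

Lemma form3_xx2 x y : f y x x = 0.
Proof. exact: (form2_xx (interior_form y fw)). Qed.

Lemma form3C2 x y z : f x y z = - f x z y.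
Proof. exact: (form2C (interior_form x fw)). Qed.

Lemma form3_xx1 x y : f x x y = 0.
Proof.
case: fw => _ aw; apply: (aw _ ord0 (lift ord0 ord0)) => //.
by rewrite /vec3 /vec2 cons_vec_lift !cons_vec0.
Qed.

Lemma form3C1 x y z : f x y z = - f y x z.
Proof.
have := form3_xx1 (1 *: x + y) z; rewrite form3P1 !form3P2 !form3_xx1; lra.
Qed.

Lemma form3_xx3 x y : f x y x = 0.
Proof. by rewrite form3C2 form3_xx1 oppr0. Qed.

Lemma form3D1 x y z t : f (x + y) z t = f x z t + f y z t.
Proof. by rewrite -[x]scale1r form3P1 scale1r mul1r. Qed.
Lemma form3D2 x y z t : f z (x + y) t = f z x t + f z y t.
Proof. by rewrite -[x]scale1r form3P2 scale1r mul1r. Qed.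
Lemma form3D3 x y z t : f z t (x + y) = f z t x + f z t y.
Proof. by rewrite -[x]scale1r form3P3 scale1r mul1r. Qed.
Lemma form3_01 z t : f 0 z t = 0.
Proof. by have := form3D1 0 0 z t; rewrite addr0; lra. Qed.
Lemma form3_02 z t : f z 0 t = 0.
Proof. by rewrite form3C1 form3_01 oppr0. Qed.
Lemma form3_03 z t : f z t 0 = 0.
Proof. by rewrite form3C2 form3_02 oppr0. Qed.
Lemma form3Z1 c x z t : f (c *: x) z t = c * f x z t.
Proof. by rewrite -[c *: x]addr0 form3P1 form3_01 addr0. Qed.
Lemma form3Z2 c x z t : f z (c *: x) t = c * f z x t.
Proof. by rewrite -[c *: x]addr0 form3P2 form3_02 addr0. Qed.
Lemma form3Z3 c x z t : f z t (c *: x) = c * f z t x.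
Proof. by rewrite -[c *: x]addr0 form3P3 form3_03 addr0. Qed.

End Three.

Lemma form2D1 (w : kfun V 2) x y z : is_form w ->
  w (vec2 (x + y) z) = w (vec2 x z) + w (vec2 y z) :> R.
Proof. by move=> fw; rewrite -[x]scale1r form2Pl // scale1r mul1r. Qed.
Lemma form2_01 (w : kfun V 2) z : is_form w -> w (vec2 0 z) = 0 :> R.
Proof. by move=> fw; have := form2D1 0 0 z fw; rewrite addr0; lra. Qed.
Lemma form2Z1 (w : kfun V 2) c x z : is_form w -> w (vec2 (c *: x) z) = c * w (vec2
  x z) :> R.
Proof. by move=> fw; rewrite -[c *: x]addr0 form2Pl // form2_01 // addr0. Qed.
Lemma vec7_eta (e : 'I_7 -> V) :
  e = vec7 (e (inord 0)) (e (inord 1)) (e (inord 2)) (e (inord 3))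
           (e (inord 4)) (e (inord 5)) (e (inord 6)).
Proof.
rewrite /vec7 /vec4 /vec3 /vec2.
do 7 (rewrite [LHS]cons_vec_eta; congr cons_vec;
  [by congr e; apply: val_inj; rewrite /= inordK|]).
by apply: funext => -[].
Qed.

Section G2.
Variables (phi : kfun V 3).
Hypothesis dV : \dim {:V} = 7%N.
Hypothesis g2 : g2_structure phi.
Let fphi : is_form phi. Proof. by case: g2. Qed.

Lemma b_form_form x y : is_form (b_form phi x y).
Proof.
have [mw aw] : is_form (wedge (wedge (interior x phi) (interior y phi)) phi).
  apply: wedge_form; last by case: fphi.
  have fm z := proj1 (interior_form z fphi).
  exact: (proj1 (wedge_form (fm x) (fm y))).
split=> [v i c u z | v i j nij vij]; rewrite /b_form.
  by rewrite mw mulrDr mulrCA.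
by rewrite (aw _ i j) // mulr0.
Qed.

Let e0 (i : 'I_7) := (vbasis {:V})`_i.

Lemma vbasis_sum v : v = \sum_(i < 7) coord (vbasis {:V}) (cast_ord (esym dV) i) v
  *: e0 i.
Proof.
rewrite {1}(coord_vbasis (memvf v)).
rewrite (reindex_onto (cast_ord (esym dV)) (cast_ord dV)) /=.
  by apply: eq_bigl => i; rewrite cast_ordKV eqxx.
by move=> i _; rewrite cast_ordK.
Qed.

(** Seven-forms on [V] form a line, so [d] is a determinant that does not depend on [x] and [y].
    Comparisons of signs of [b_form] may therefore be made on any seven vectors where it does not
    vanish. *)
Lemma b_form_basis (e : 'I_7 -> V) :
  exists d, forall x y, b_form phi x y e = d * b_form phi x y e0.
Proof.
exists (\det (\matrix_(i, j) coord (vbasis {:V}) (cast_ord (esym dV) j) (e i))).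
move=> x y; rewrite -form_det; last exact: b_form_form.
congr (b_form _ _ _ _); apply: funext => i.
by rewrite {1}(vbasis_sum (e i)); apply: eq_bigr => j _; rewrite mxE.
Qed.

(** The factor between [g2_metric] and [b_form] has an unknown sign, given by the orientation; in a
    product of two values it appears squared. *)
Lemma b_form_sign0 x y : x != 0 -> y != 0 ->
  0 < b_form phi x x e0 * b_form phi y y e0.
Proof.
case: g2 => _ _ pos /pos px /pos py; move: px py.
rewrite /g2_metric -/e0; set k := _^-1 => px py.
have := mulr_gt0 px py; rewrite mulrACA -expr2 => kp.
have k0 : k != 0 by apply: contraTneq px => ->; rewrite mul0r ltxx.
by rewrite pmulr_rgt0 ?exprn_even_gt0 // in kp.
Qed.

Lemma b_form_sign x y e : x != 0 -> y != 0 -> b_form phi x x e != 0 ->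
  0 < b_form phi x x e * b_form phi y y e.
Proof.
move=> x0 y0; have [d dE] := b_form_basis e; rewrite !dE mulf_eq0 negb_or.
move=> /andP[d0 _]; rewrite mulrACA -expr2 pmulr_rgt0 ?exprn_even_gt0 //.
exact: b_form_sign0.
Qed.

Lemma b_form_basis_neq0 x (e : 'I_7 -> V) : x != 0 ->
  (forall v, exists c : 'I_7 -> R, v = \sum_i c i *: e i) ->
  b_form phi x x e != 0.
Proof.
move=> x0 /boolp.choice[c cE].
have := b_form_sign0 x0 x0; apply: contraTneq => be0.
suff -> : b_form phi x x e0 = 0 by rewrite mul0r ltxx.
rewrite (_ : e0 = fun i => \sum_j (\matrix_(i, j) c (e0 i) j) i j *: e j).
  by rewrite form_det ?be0 ?mulr0 //; apply: b_form_form.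
apply: funext => i; rewrite {1}(cE (e0 i)).
by apply: eq_bigr => j _; rewrite mxE.
Qed.

(** Otherwise [x, v] extend to a basis. The contraction of [phi] by [v] kills both vectors, so in
    [b_phi (v, v)] both must be arguments of the third factor [phi], which vanishes on them as well.
    Thus [b_phi (v, v)] would be zero on a basis. *)
Lemma g2_cross_neq0 v x : v != 0 -> (forall y, phi (vec3 v x y) = 0) ->
  x \in <[v]>%VS.
Proof.
move=> v0 H; apply: contraT => xv.
have fr : free [:: x; v].
  by rewrite free_cons span_seq1 xv seq1_free.
pose U := <<[:: x; v]>>%VS.
pose B := [:: x; v] ++ vbasis (U^C)%VS.
have bB : basis_of fullv B.
  rewrite /basis_of span_cat (span_basis (vbasisP _)) -/U addv_complf eqxx /=.
  rewrite cat_free fr (basis_free (vbasisP _)) /=.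
  by apply/directv_addP; rewrite (span_basis (vbasisP _)) capv_compl.
have sB : size B = 7%N.
  by have := basis_free bB; rewrite /free (span_basis bB) dV => /eqP.
pose e (i : 'I_7) := B`_i.
have span_e u : exists c : 'I_7 -> R, u = \sum_i c i *: e i.
  have : u \in <<B>>%VS by rewrite (span_basis bB) memvf.
  have tB : size B == 7%N by rewrite sB.
  move=> /(coord_span (X := Tuple tB)) uE.
  by exists (fun i => coord (Tuple tB) i u).
have := b_form_basis_neq0 v0 span_e.
have fm : multilinear_form (interior v phi) := proj1 (interior_form v fphi).
rewrite (vec7_eta e) /b_form wedge43E //; last exact: (wedge_form fm fm).
have -> : e (inord 0) = x by rewrite /e /= inordK.
have -> : e (inord 1) = v by rewrite /e /= inordK.
have H' y : phi (vec3 v y x) = 0 by rewrite form3C2 // H oppr0.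
have Hx y : phi (vec3 x v y) = 0 by rewrite form3C1 // H oppr0.
rewrite !wedge22E; try exact: interior_form.
rewrite /interior -!/(vec3 _ _ _) !form3_xx1 // ?form3_xx3 // !H ?H' ?Hx.
by rewrite !(mul0r, mulr0, addr0, subr0, oppr0) eqxx.
Qed.

End G2.
End Eval.


(** * Signs of the metric along a coassociative subspace *)

Section Coassociative.
Variables (R : realType) (V : vectType R).

(** The product of equations serves as a rewrite rule for every order of the three arguments, so
    that [phi] can be evaluated from a table of its values on ordered triples. *)
Lemma form3_perm (w : kfun V 3) x y z r : is_form w -> w (vec3 x y z) = r ->
  (w (vec3 x y z) = r) * (w (vec3 x z y) = - r) * (w (vec3 y x z) = - r) *
  (w (vec3 y z x) = r) * (w (vec3 z x y) = r) * (w (vec3 z y x) = - r).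
Proof.
move=> fw <-; do !split.
- by rewrite form3C2.
- by rewrite form3C1.
- by rewrite form3C2 // form3C1 // opprK.
- by rewrite form3C1 // form3C2 // opprK.
- by rewrite form3C2 // form3C1 // form3C2 // opprK.
Qed.

(* The coefficient [p k j] is the value on [v_j] of the contraction of [phi] by
   the two [x_i] with [i <> k], in cyclic order.  The last four hypotheses say
   that [sum_k J_k p_k = 0] for the hyperkaehler triple [J_k] of the forms
   [phi (x_k, ., .)]. *)
Lemma g2_coassociative_normal_form (phi : kfun V 3) v1 v2 v3 v4 x1 x2 x3
    (t p11 p12 p13 p14 p21 p22 p23 p24 p31 p32 p33 p34 : R) :
  \dim {:V} = 7%N -> g2_structure phi -> 0 < t ->
  v1 != 0 -> x1 != 0 -> x2 != 0 -> x3 != 0 ->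
  phi (vec3 v1 v2 v3) = 0 -> phi (vec3 v1 v2 v4) = 0 ->
  phi (vec3 v1 v3 v4) = 0 -> phi (vec3 v2 v3 v4) = 0 ->
  phi (vec3 x1 x2 x3) = 0 ->
  phi (vec3 x1 v1 v2) = 1 -> phi (vec3 x1 v1 v3) = 0 ->
  phi (vec3 x1 v1 v4) = 0 -> phi (vec3 x1 v2 v3) = 0 ->
  phi (vec3 x1 v2 v4) = 0 -> phi (vec3 x1 v3 v4) = - t ->
  phi (vec3 x2 v1 v2) = 0 -> phi (vec3 x2 v1 v3) = 1 ->
  phi (vec3 x2 v1 v4) = 0 -> phi (vec3 x2 v2 v3) = 0 ->
  phi (vec3 x2 v2 v4) = t -> phi (vec3 x2 v3 v4) = 0 ->
  phi (vec3 x3 v1 v2) = 0 -> phi (vec3 x3 v1 v3) = 0 ->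
  phi (vec3 x3 v1 v4) = 1 -> phi (vec3 x3 v2 v3) = - t ->
  phi (vec3 x3 v2 v4) = 0 -> phi (vec3 x3 v3 v4) = 0 ->
  phi (vec3 v1 x2 x3) = p11 -> phi (vec3 v2 x2 x3) = p12 ->
  phi (vec3 v3 x2 x3) = p13 -> phi (vec3 v4 x2 x3) = p14 ->
  phi (vec3 v1 x3 x1) = p21 -> phi (vec3 v2 x3 x1) = p22 ->
  phi (vec3 v3 x3 x1) = p23 -> phi (vec3 v4 x3 x1) = p24 ->
  phi (vec3 v1 x1 x2) = p31 -> phi (vec3 v2 x1 x2) = p32 ->
  phi (vec3 v3 x1 x2) = p33 -> phi (vec3 v4 x1 x2) = p34 ->
  p12 + p23 + p34 = 0 -> t * p11 - p24 + p33 = 0 ->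
  t * p21 + p14 - p32 = 0 -> t * p31 + p22 - p13 = 0 -> False.
Proof.
move=> dV g2 t0 v0 y1 y2 y3.
have fphi : is_form phi by case: g2.
do 35 (move=> /(form3_perm fphi); let h := fresh "h" in move=> h).
move=> n1 n2 n3 n4.
pose e := vec7 v1 v2 v3 v4 x1 x2 x3.
pose rules := (h, h0, h1, h2, h3, h4, h5, h6, h7, h8, h9, h10, h11, h12, h13,
  h14, h15, h16, h17, h18, h19, h20, h21, h22, h23, h24, h25, h26, h27, h28,
  h29, h30, h31, h32, h33).
have fm z : multilinear_form (interior z phi) := proj1 (interior_form z fphi).
have bE x : b_form phi x x e = 6%:R^-1 *
    wedge (wedge (interior x phi) (interior x phi)) phi e by [].
have bv : b_form phi v1 v1 e = -1.
  rewrite bE wedge43E //; last exact: (wedge_form (fm _) (fm _)).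
  rewrite !wedge22E; try exact: interior_form.
  rewrite /interior -!/(vec3 _ _ _) !(form3_xx1 fphi, form3_xx3 fphi) !rules.
  by field.
pose s1 := p23 * p34 - p24 * p33 - t * (p21 * p32 - p22 * p31).
pose s2 := p34 * p12 - p32 * p14 - t * (p31 * p13 - p33 * p11).
pose s3 := p12 * p23 - p13 * p22 - t * (p11 * p24 - p14 * p21).
have bx1 : b_form phi x1 x1 e = - s1.
  rewrite bE wedge43E //; last exact: (wedge_form (fm _) (fm _)).
  rewrite !wedge22E; try exact: interior_form.
  rewrite /interior -!/(vec3 _ _ _) !(form3_xx1 fphi, form3_xx3 fphi) !rules.
  by rewrite /s1; field.
have bx2 : b_form phi x2 x2 e = - s2.
  rewrite bE wedge43E //; last exact: (wedge_form (fm _) (fm _)).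
  rewrite !wedge22E; try exact: interior_form.
  rewrite /interior -!/(vec3 _ _ _) !(form3_xx1 fphi, form3_xx3 fphi) !rules.
  by rewrite /s2; field.
have bx3 : b_form phi x3 x3 e = - s3.
  rewrite bE wedge43E //; last exact: (wedge_form (fm _) (fm _)).
  rewrite !wedge22E; try exact: interior_form.
  rewrite /interior -!/(vec3 _ _ _) !(form3_xx1 fphi, form3_xx3 fphi) !rules.
  by rewrite /s3; field.
have b0 : b_form phi v1 v1 e != 0 by rewrite bv oppr_eq0 oner_eq0.
have := b_form_sign dV g2 v0 y1 b0; have := b_form_sign dV g2 v0 y2 b0.
have := b_form_sign dV g2 v0 y3 b0; rewrite bv bx1 bx2 bx3 !mulN1r !opprK.
move=> s3p s2p s1p.
(* Since [b_phi (v1, v1)] is negative, each [s_k] must be positive. The first four squares below are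
   those of the components of [sum_k J_k p_k], which vanish, so their sum is nonpositive instead. *)
have : 2%:R * (s1 + s2 + s3) =
    (p12 + p23 + p34) ^+ 2 + (t * p11 - p24 + p33) ^+ 2 +
    (t * p21 + p14 - p32) ^+ 2 + (t * p31 + p22 - p13) ^+ 2
    - ((t * p11) ^+ 2 + p12 ^+ 2 + p13 ^+ 2 + p14 ^+ 2 +
       (t * p21) ^+ 2 + p22 ^+ 2 + p23 ^+ 2 + p24 ^+ 2 +
       (t * p31) ^+ 2 + p32 ^+ 2 + p33 ^+ 2 + p34 ^+ 2).
  by rewrite /s1 /s2 /s3; ring.
rewrite n1 n2 n3 n4 !expr0n /= !addr0 => sE.
have spos : 0 < 2%:R * (s1 + s2 + s3).
  by apply: mulr_gt0 => //; apply: addr_gt0 => //; apply: addr_gt0.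
move: spos; rewrite ltNge sE sub0r oppr_le0 => /negP; apply.
by do !apply: addr_ge0 => //; apply: sqr_ge0.
Qed.

End Coassociative.

(** * Traces, nilpotency and pencils of commuting matrices *)


Section Matrix.
Variable F : numFieldType.

(** In the rank factorization [e = C R], idempotence gives [R C = 1], and [C R] and [R C] have the
    same trace. *)
Lemma mxtrace_idem n (e : 'M[F]_n) : e *m e = e -> \tr e = (\rank e)%:R.
Proof.
move=> ee; have eE := mulmx_base e.
have RC : row_base e *m col_base e = 1%:M.
  apply: (row_full_inj (col_base_full e)).
  apply: (row_free_inj (row_base_free e)) => /=.
  by rewrite mulmx1 mulmxA eE -mulmxA eE ee.
by rewrite -[in LHS]eE mxtrace_mulC RC mxtrace1.
Qed.

(** The Fitting decomposition in polynomial form: [A] is nilpotent on the part belonging to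
    ['X ^+ m] and invertible on the part belonging to [q]. *)
Lemma char_poly_X n (A : 'M[F]_n.+1) : exists m q,
  [/\ horner_mx A q *m A ^+ m = 0 & coprimep q 'X].
Proof.
have [m [q nq pE]] := multiplicity_XsubC (char_poly A) 0.
exists m, q; rewrite polyC0 subr0 in pE; split; last first.
  rewrite -[X in coprimep _ X]subr0 -polyC0 coprimep_XsubC.
  by move: nq; rewrite monic_neq0 ?char_poly_monic.
rewrite -[A in A ^+ m](horner_mx_X A) -rmorphXn /= mulmxE -rmorphM -pE.
exact: Cayley_Hamilton.
Qed.

(** The projector [e] onto the invertible Fitting part is a polynomial in [A] without constant term,
    so its trace is zero. The trace of an idempotent is its rank, hence [e = 0] in characteristic
    zero. No eigenvalues are involved. *)
Lemma mxtrace_exp_nilp n (A : 'M[F]_n.+1) :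
  (forall k, \tr (A ^+ k.+1) = 0) -> exists m, A ^+ m = 0.
Proof.
move=> trA; have [m [q [qA cq]]] := char_poly_X A.
(* The exponent [m.+1] rather than [m] removes the constant term of [v * 'X ^+ m.+1] even when
   [m = 0]. *)
have /Bezout_eq1_coprimepP[[u v] /= uv] : coprimep q ('X ^+ m.+1).
  exact: coprimep_expr.
pose e := horner_mx A (v * 'X ^+ m.+1).
have e1 : horner_mx A (u * q) = 1 - e.
  have := congr1 (horner_mx A) uv; rewrite rmorphD rmorph1 -/e => <-.
  by rewrite addrK.
have ee : e *m e = e.
  apply/eqP; rewrite eq_sym -subr_eq0 -{1}[e]mulr1 -mulmxE -mulmxBr -e1 mulmxE.
  rewrite /e -rmorphM.
  have -> : v * 'X ^+ m.+1 * (u * q) = (v * 'X * u) * (q * 'X ^+ m).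
    by rewrite exprS; ring.
  by rewrite !rmorphM /= rmorphXn /= horner_mx_X -mulmxE -/(_ *m _) qA mulmx0.
have tre : \tr e = 0.
  rewrite /e -[v in v * _]coefK poly_def mulr_suml rmorph_sum /= raddf_sum /=.
  apply: big1 => i _; rewrite -scalerAl -exprD linearZ /= rmorphXn /= horner_mx_X.
  by rewrite linearZ /= addnS trA mulr0.
have /eqP := mxtrace_idem ee; rewrite tre eq_sym pnatr_eq0 mxrank_eq0 => /eqP e0.
exists m; rewrite e0 subr0 rmorphM /= in e1.
by rewrite -[A ^+ m]mul1r -e1 -mulmxE -mulmxA qA mulmx0.
Qed.

Lemma exists_nonroot (p : {poly F}) : p != 0 -> exists2 s, s != 0 & ~~ root p s.
Proof.
move=> p0; pose rs := [seq i%:R : F | i <- iota 1 (size p)].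
have urs : uniq rs.
  by rewrite map_inj_uniq ?iota_uniq // => i j /eqP; rewrite eqr_nat => /eqP.
have [al|/allPn[s]] := boolP (all (root p) rs).
  by have := max_poly_roots p0 al urs; rewrite size_map size_iota ltnn.
move=> /mapP[i]; rewrite mem_iota => /andP[i0 _] -> nr; exists i%:R => //.
by rewrite pnatr_eq0 -lt0n.
Qed.

Lemma comm_mxZ n (A B : 'M[F]_n) c : comm_mx A B -> comm_mx A (c *: B).
Proof. by move=> cAB; rewrite /comm_mx -scalemxAr cAB scalemxAl. Qed.

Definition gker n (A : 'M[F]_n.+1) (v : 'rV[F]_n.+1) : Prop :=
  exists k, v *m A ^+ k = 0.

Lemma gker_mul n (A B : 'M[F]_n.+1) v : comm_mx A B -> gker A v -> gker A (v *m B).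
Proof.
move=> cAB [k vk]; exists k.
have cBA : GRing.comm B (A ^+ k) by apply: commrX; apply: esym.
by rewrite -mulmxA [B *m _]cBA -mulmxE mulmxA vk mul0mx.
Qed.

Lemma gkerD n (A B : 'M[F]_n.+1) v : comm_mx A B ->
  gker A v -> gker B v -> gker (A + B) v.
Proof.
move=> cAB [k vk] [l vl]; exists (k + l)%N.
rewrite exprDn_comm // mulmx_sumr big1 // => i _.
rewrite -mulr_natr -mulmxE !mulmxA.
have [li|il] := leqP l i.
  have cAi : GRing.comm (A ^+ (k + l - i)) (B ^+ i).
    by apply: commrX; apply/commr_sym/commrX/commr_sym.
  rewrite -(mulmxA v) [_ *m B ^+ i]cAi -mulmxE mulmxA -(subnKC li) exprD.
  by rewrite -mulmxE mulmxA vl !mul0mx.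
have ki : (k <= k + l - i)%N by rewrite -addnBA ?leq_addr // ltnW.
by rewrite -(subnKC ki) exprD -mulmxE mulmxA vk !mul0mx.
Qed.

Lemma gkerZ n (A : 'M[F]_n.+1) v c : gker A v -> gker (c *: A) v.
Proof. by move=> [k vk]; exists k; rewrite exprZn -scalemxAr vk scaler0. Qed.

(** For generic [t] the matrix [A + t *: B] is injective on the invertible Fitting part of [A], so
    its generalized kernel lies in that of [A]. Then [B], a combination of [A] and [A + t *: B], is
    nilpotent there too. *)
Lemma gker_pencil n (A B : 'M[F]_n.+1) : comm_mx A B ->
  exists t, forall v, gker (A + t *: B) v -> gker A v /\ gker B v.
Proof.
move=> cAB; have [m [q [qA cq]]] := char_poly_X A.
have /Bezout_eq1_coprimepP[[u w] /= uw] := cq.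
pose A' := horner_mx A w.
have A'E : horner_mx A u *m horner_mx A q + A' *m A = 1.
  have -> : A' *m A = horner_mx A (w * 'X) by rewrite rmorphM /= horner_mx_X.
  by rewrite mulmxE -rmorphM -rmorphD uw rmorph1.
have [s s0 sr] := exists_nonroot (monic_neq0 (char_poly_monic (B *m A'))).
exists (- s^-1) => v; set t := - s^-1; set T := A + t *: B => -[N vN].
have t0 : t != 0 by rewrite oppr_eq0 invr_eq0.
have cAT : comm_mx A T by apply: comm_mxD => //; apply: comm_mxZ.
have cqT : comm_mx (horner_mx A q) T.
  by apply/comm_mx_sym/comm_mx_horner/comm_mx_sym.
have injT (x : 'rV_n.+1) : x *m horner_mx A q = 0 -> x *m T = 0 -> x = 0.
  move=> xq xT; have xA : x *m A = - t *: (x *m B).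
    apply/eqP; rewrite scaleNr -addr_eq0; apply/eqP.
    by rewrite scalemxAr -mulmxDr.
  have cA' : comm_mx A A' by apply/comm_mx_horner.
  have cuq : comm_mx (horner_mx A u) (horner_mx A q).
    by rewrite /comm_mx !mulmxE -!rmorphM mulrC.
  have xE : x *m (B *m A') = s *: x.
    have := congr1 (mulmx x) A'E.
    rewrite mulmxDr cuq -cA' mulmxA xq mul0mx add0r mulmxA xA mulmx1.
    by rewrite opprK -scalemxAl -mulmxA => {2}<-; rewrite scalerA mulfV ?scale1r.
  apply/eqP; apply: contraNT sr => x0; rewrite -eigenvalue_root_char.
  by apply/eigenvalueP; exists x.
have gA : gker A v.
  exists m; set x := v *m A ^+ m.
  have xq : x *m horner_mx A q = 0.
    rewrite /x -mulmxA -[A ^+ m *m _](_ : horner_mx A q *m A ^+ m = _).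
      by rewrite qA mulmx0.
    by rewrite -[A in A ^+ m]horner_mx_X -rmorphXn !mulmxE -!rmorphM mulrC.
  have : x *m T ^+ N = 0.
    have cAm : GRing.comm (A ^+ m) (T ^+ N).
      by apply: commrX; apply/commr_sym/commrX/commr_sym.
    by rewrite /x -mulmxA [_ *m T ^+ N]cAm -mulmxE mulmxA vN mul0mx.
  elim: N {vN} => [|N IH]; first by rewrite mulmx1.
  rewrite exprSr -mulmxE mulmxA => H; apply: IH; apply: injT => //.
  have cTq : GRing.comm (horner_mx A q) (T ^+ N) by apply: commrX.
  by rewrite -mulmxA -[_ *m horner_mx A q]cTq -mulmxE mulmxA xq mul0mx.
split=> //; have -> : B = t^-1 *: (T + (-1) *: A).
  by rewrite /T scaleN1r addrC addKr scalerA mulVf ?scale1r.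
apply: gkerZ; apply: gkerD; last exact: gkerZ.
  by apply: comm_mxZ; apply: comm_mx_sym.
by exists N.
Qed.

Lemma gker_eigenvector n (A : 'M[F]_n.+1) (v : 'rV[F]_n.+1) :
  v != 0 -> gker A v -> exists k, v *m A ^+ k != 0 /\ v *m A ^+ k *m A = 0.
Proof.
move=> v0 [k vk].
have ex : exists k, v *m A ^+ k == 0 by exists k; apply/eqP.
have [[|j] vj jmin] := ex_minnP ex.
  by move: v0; rewrite -[v]mulmx1 (eqP vj) eqxx.
exists j; split; first by apply/negP => /jmin; rewrite ltnn.
by rewrite -mulmxA mulmxE -exprSr; apply/eqP.
Qed.

(* If the pencil had only singular members, a generic member would have a
   common generalized null vector of all three. *)
Lemma comm3_unitmx n (A B C : 'M[F]_n.+1) :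
  comm_mx A B -> comm_mx A C -> comm_mx B C ->
  (forall v : 'rV_n.+1, v *m A = 0 -> v *m B = 0 -> v *m C = 0 -> v = 0) ->
  exists s t, A + s *: B + t *: C \in unitmx.
Proof.
move=> cAB cAC cBC inj; have [s sP] := gker_pencil cAB.
have cT : comm_mx (A + s *: B) C.
  by apply/comm_mx_sym/comm_mxD; last apply: comm_mxZ; apply: comm_mx_sym.
have [t tP] := gker_pencil cT; exists s, t.
rewrite -row_free_unit -kermx_eq0; apply/rowV0P => v /sub_kermxP vT.
apply/eqP; apply: contraT => v0.
have /tP[/sP[vA vB] vC] : gker (A + s *: B + t *: C) v by exists 1%N; rewrite expr1.
have [k [w0 wA]] := gker_eigenvector v0 vA.
have comX (M N : 'M[F]_n.+1) j : comm_mx M N -> comm_mx M (N ^+ j).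
  by move=> c; apply: commrX.
have wB : gker B (v *m A ^+ k).
  by apply: gker_mul => //; apply: comX; apply: comm_mx_sym.
have wC : gker C (v *m A ^+ k).
  by apply: gker_mul => //; apply: comX; apply: comm_mx_sym.
have [j [x0 xB]] := gker_eigenvector w0 wB.
have xC : gker C (v *m A ^+ k *m B ^+ j).
  by apply: gker_mul => //; apply: comX; apply: comm_mx_sym.
have [l [y0 yC]] := gker_eigenvector x0 xC.
case/eqP: y0; apply: inj => //.
  rewrite -mulmxA -(comX _ _ _ cAC) mulmxA -(mulmxA _ (B ^+ j)).
  by rewrite -(comX _ _ _ cAB) mulmxA wA !mul0mx.
by rewrite -mulmxA -(comX _ _ _ cBC) mulmxA xB mul0mx.
Qed.

End Matrix.

(** * The derived algebra of a solvable Lie algebra *)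


Section Solvable.
Variables (F : numFieldType) (g : lieAlgType F).
Implicit Types (x y z : g) (I U W S : {vspace g}).

Lemma lie_ideal_derived i : lie_ideal (derived_series g i).
Proof.
elim: i => [|i IH]; last exact: lie_ideal_liev.
by apply/lie_idealP => x y _; apply: memvf.
Qed.

(** * Irreducible representations of a solvable Lie algebra *)

Section Representation.
Variables (n : nat) (rho : g -> 'M[F]_n.+1).
Hypothesis rho_linear : linear rho.
(** Matrices act on row vectors from the right, which reverses the commutator. Below, subspaces of
    the representation are row spaces of square matrices [K]. *)
Hypothesis rho_lie :
  forall x y, rho (lie x y) = rho y *m rho x - rho x *m rho y.
Hypothesis rho_irr : forall K : 'M[F]_n.+1,
  (forall x, K *m rho x <= K)%MS -> K = 0 \/ (1%:M <= K)%MS.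

HB.instance Definition _ := GRing.isSemilinear.Build F g _ _ rho
  (GRing.semilinear_linear rho_linear).

Lemma rho_span (X : seq g) z (P : 'M[F]_n.+1 -> Prop) : z \in <<X>>%VS ->
  P 0 -> (forall c A B, P A -> P B -> P (c *: A + B)) ->
  {in X, forall x, P (rho x)} -> P (rho z).
Proof.
move=> zX P0 PD PX.
have /(coord_span (X := in_tuple X)) -> : z \in <<in_tuple X>>%VS by [].
rewrite linear_sum; apply: big_ind => //.
  by move=> A B PA PB; rewrite -[A]scale1r; apply: PD.
move=> i _; rewrite linearZ_LR /= -[X in P X]addr0; apply: PD => //=; apply: PX.
exact: mem_nth.
Qed.

(** This is [tr ([A, B] P) = tr (A [B, P])], which vanishes when [B] commutes with [P]. *)
Lemma trace_liev U W (P : 'M[F]_n.+1) z : z \in liev U W ->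
  {in W, forall w, comm_mx (rho w) P} -> \tr (rho z *m P) = 0.
Proof.
move=> zUW cP; apply: (rho_span (P := fun A => \tr (A *m P) = 0) zUW).
- by rewrite mul0mx mxtrace0.
- move=> c A B tA tB.
  by rewrite mulmxDl -scalemxAl mxtraceD mxtraceZ tA tB mulr0 addr0.
move=> _ /allpairsP[[x w] /= [xU wW ->]].
rewrite rho_lie mulmxBl raddfB /= -mulmxA mxtrace_mulC -!mulmxA.
by rewrite -(cP w) ?subrr // vbasis_mem.
Qed.

Lemma common_null_vector (s : seq g) :
  {in s &, forall y z, comm_mx (rho y) (rho z)} ->
  {in s, forall y, exists m, rho y ^+ m = 0} ->
  exists2 v : 'rV[F]_n.+1, v != 0 & {in s, forall y, v *m rho y = 0}.
Proof.
elim: s => [|y s IH] cs ns.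
  exists (delta_mx 0 0) => //; apply/eqP => /matrixP/(_ 0 0).
  by rewrite !mxE eqxx => /eqP; rewrite oner_eq0.
have [||v v0 vs] := IH.
- by move=> a b as_ bs; apply: cs; rewrite inE ?as_ ?bs orbT.
- by move=> a as_; apply: ns; rewrite inE as_ orbT.
have [|m ym] := ns y; first by rewrite inE eqxx.
have [|k [w0 wy]] := @gker_eigenvector _ _ (rho y) _ v0.
  by exists m; rewrite ym mulmx0.
exists (v *m rho y ^+ k) => // a; rewrite inE => /predU1P[->//|as_].
have c : GRing.comm (rho a) (rho y ^+ k).
  by apply: commrX; apply: cs; rewrite inE ?eqxx ?as_ ?orbT.
by rewrite -mulmxA -[_ *m rho a]c -mulmxE mulmxA vs ?mul0mx.
Qed.

(** Commuting nilpotent matrices have a common null vector. The common null space of an ideal is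
    invariant under the whole algebra, so by irreducibility it is everything. *)
Lemma rho_comm_nilp_ideal I : lie_ideal I ->
  {in I &, forall y z, comm_mx (rho y) (rho z)} ->
  {in I, forall y, exists m, rho y ^+ m = 0} -> {in I, forall y, rho y = 0}.
Proof.
move=> /lie_idealP iI cI nI.
have [||v v0 vI] := @common_null_vector (vbasis I).
- by move=> y z /vbasis_mem yI /vbasis_mem zI; apply: cI.
- by move=> y /vbasis_mem yI; apply: nI.
have span_null (w : 'rV_n.+1) :
    (forall i : 'I_(\dim I), w *m rho (vbasis I)`_i = 0) ->
    {in I, forall y, w *m rho y = 0}.
  move=> wI y yI; apply: (rho_span (P := fun A => w *m A = 0) (X := vbasis I)).
  - by rewrite (span_basis (vbasisP I)).
  - by rewrite mulmx0.
  - by move=> c A B wA wB; rewrite mulmxDr -scalemxAr wA wB scaler0 addr0.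
  by move=> u /(nthP 0)[i]; rewrite size_tuple => il <-; apply: (wI (Ordinal il)).
pose K := (\bigcap_(i < \dim I) kermx (rho (vbasis I)`_i))%MS.
have KP (w : 'rV_n.+1) : (w <= K)%MS <-> {in I, forall y, w *m rho y = 0}.
  split=> [/sub_bigcapmxP wK|wI].
    by apply: span_null => i; apply/sub_kermxP/wK.
  by apply/sub_bigcapmxP => i _; apply/sub_kermxP/wI/vbasis_mem/mem_nth;
    rewrite size_tuple.
have [|K0|K1] := rho_irr (K := K).
- move=> x; apply/row_subP => i; apply/KP => y yI.
  have rK : {in I, forall y, row i K *m rho y = 0} by apply/KP; apply: row_sub.
  have xy := rho_lie y x; rewrite row_mul -mulmxA.
  have -> : rho x *m rho y = rho (lie y x) + rho y *m rho x.
    by rewrite xy subrK.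
  rewrite mulmxDr mulmxA (rK y) // mul0mx addr0 rK ?sub0mx //.
  by rewrite lieC memvN iI.
- have : (v <= K)%MS.
    by apply/KP/span_null => i; apply: vI; rewrite mem_nth ?size_tuple.
  by rewrite K0 submx0 (negbTE v0).
move=> y yI; apply/row_matrixP => i; rewrite row0 rowE.
by apply: (KP _).1 => //; apply: submx_trans K1; apply: submx1.
Qed.

(** Let [h = [D, D]] be the last derived term acting nontrivially, assumed to lie in [[g, g]]. It
    acts by commuting matrices, so by [trace_liev] the elements of [[g, h]] have traceless powers,
    are nilpotent and act by zero. Hence the action of [h] commutes with that of [g]; then the
    elements of [[D, D]] have traceless powers too, and [h] acts by zero. *)
Lemma rho_lie0 : lie_solvable g -> forall x y, rho (lie x y) = 0.
Proof.
move=> [i0 Di0].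
pose P i := `[< {in derived_series g i, forall x, rho x = 0} >].
have ex : exists i, P i.
  exists i0; apply/asboolP => x; rewrite Di0 memv0 => /eqP->; exact: linear0.
have [[|[|k]] /asboolP D0 kmin] := ex_minnP ex.
- by move=> x y; apply: D0; apply: memvf.
- by move=> x y; apply: D0; apply: memv_lie; apply: memvf.
pose D := derived_series g k; pose h := liev D D.
have ih : lie_ideal h := lie_ideal_derived k.+1.
have ch : {in h &, forall y z, comm_mx (rho y) (rho z)}.
  move=> y z yh zh; apply/eqP; rewrite eq_sym -subr_eq0 -rho_lie.
  by rewrite D0 //; apply: memv_lie.
have nilp y : (forall k, \tr (rho y *m rho y ^+ k) = 0) ->
    exists m, rho y ^+ m = 0.
  by move=> tr0; apply: mxtrace_exp_nilp => j; rewrite exprS -mulmxE tr0.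
have commX A B j : comm_mx A B -> comm_mx A (B ^+ j) :> Prop.
  by move=> c; apply: commrX.
pose I := liev {:g}%VS h.
have Ih : (I <= h)%VS by [].
have rI : {in I, forall y, rho y = 0}.
  apply: rho_comm_nilp_ideal; first by apply: lie_ideal_liev => //;
    apply: (lie_ideal_derived 0).
    by move=> y z yI zI; apply: ch; apply: (subvP Ih).
  move=> y yI; apply: nilp => j; apply: (trace_liev yI) => w wh.
  by apply: commX; apply: ch => //; apply: (subvP Ih).
have rh : {in h, forall y, rho y = 0}.
  apply: rho_comm_nilp_ideal => // y yh; apply: nilp => j.
  apply: (trace_liev yh) => w _; apply: commX.
  apply/eqP; rewrite -subr_eq0 -rho_lie; apply/eqP;
    rewrite lieC linearN /= rI ?oppr0 //.
  by apply: memv_lie; rewrite ?memvf.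
have : P k.+1 by apply/asboolP.
by move/kmin; rewrite ltnn.
Qed.

Lemma rho_derived0 z : lie_solvable g -> z \in liev {:g} {:g} -> rho z = 0.
Proof.
move=> sg zd; apply: (rho_span (P := fun A => A = 0) zd) => //.
  by move=> c A B -> ->; rewrite scaler0 addr0.
by move=> _ /allpairsP[[x y] /= [_ _ ->]]; apply: rho_lie0.
Qed.

End Representation.

(** The quotient [S / W] is an irreducible module under [ad], on which [rho_derived0] makes [[g, g]]
    act by zero. *)
Lemma derived_chief_factor S W : lie_solvable g -> lie_ideal S -> lie_ideal W ->
  (W <= S)%VS -> (forall U, lie_ideal U -> (W <= U <= S)%VS -> U = W \/ U = S) ->
  (liev (liev {:g} {:g}) S <= W)%VS.
Proof.
move=> sg iS iW sWS irr.
pose V := quot S W; pose b := vbasis {:V}.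
pose rho x := mxof b b (quot_end S W (ad x)).
have bb : basis_of {:V} b := vbasisP _.
have fb := basis_free bb.
have stab U : lie_ideal U -> forall x, (ad x @: U <= U)%VS.
  move=> /lie_idealP iU x; apply/subvP => _ /memv_imgP[u uU ->].
  by rewrite adE iU.
have qE x u : u \in S ->
    quot_end S W (ad x) (quot_proj S W u) = quot_proj S W (lie x u).
  by move=> uS; rewrite quot_endE ?stab // adE.
have adL : linear (fun x => quot_end S W (ad x)).
  move=> a x y; apply/lfunP => q /=; have [u uS <-] := quot_proj_surj q.
  rewrite add_lfunE scale_lfunE !qE // lieDl lieZl.
  by rewrite linearP.
have rhoL : linear rho by move=> a x y; rewrite /rho adL linearP.
have rho_lie x y : rho (lie x y) = rho y *m rho x - rho x *m rho y.
  rewrite -!mxof_comp // -linearB; congr (mxof _ _ _).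
  apply/lfunP => q; have [u uS <-] := quot_proj_surj q.
  have SI := (lie_idealP S).1 iS.
  have cE a c : (quot_end S W (ad a) \o quot_end S W (ad c))%VF
      (quot_proj S W u) = quot_proj S W (lie a (lie c u)).
    by rewrite comp_lfunE !qE ?SI.
  rewrite add_lfunE opp_lfunE !cE qE //.
  rewrite -linearB /=; congr (quot_proj _ _ _).
  have := lie_jacobi x y u; rewrite (lieC u (lie x y)) (lieC u x) linearN /=.
  by move=> /eqP; rewrite subr_eq0 => /eqP <-.
have rho_irr (K : 'M_(\dim {:V})) : (forall x, K *m rho x <= K)%MS ->
    K = 0 \/ (1%:M <= K)%MS.
  move=> Kst; pose U := (S :&: quot_proj S W @^-1: vsof b K)%VS.
  have UP u : (u \in U) = (u \in S) && (rVof b (quot_proj S W u) <= K)%MS.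
    by rewrite memv_cap -memv_preim rVof_sub.
  have iU : lie_ideal U.
    apply/lie_idealP => x u; rewrite !UP => /andP[uS uK].
    rewrite ((lie_idealP S).1 iS) //= -qE // (rVof_app b bb).
    exact: submx_trans (submxMr _ uK) (Kst x).
  have sWU : (W <= U)%VS.
    apply/subvP => w wW; have wS := subvP sWS w wW; rewrite UP wS /=.
    by have := quot_proj_ker W wS; rewrite wW => /eqP ->; rewrite linear0 sub0mx.
  have sUS : (U <= S)%VS by apply: capvSl.
  have rowK (v : 'rV_(\dim {:V})) : exists2 u, u \in S &
      v = rVof b (quot_proj S W u).
    have [u uS uE] := quot_proj_surj (vecof b v); exists u => //.
    by rewrite uE vecofK.
  have [|UW|US] := irr U iU; first by rewrite sWU.
    left; apply/row_matrixP => i; rewrite row0.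
    have [u uS uE] := rowK (row i K); rewrite uE.
    have : u \in U by rewrite UP uS -uE row_sub.
    by rewrite UW -(quot_proj_ker _ uS) => /eqP->; rewrite linear0.
  right; apply/row_subP => i; have [u uS ->] := rowK (row i 1%:M).
  by have := UP u; rewrite US uS => /esym.
apply/lievP => z s zd sS.
have rz : rho z = 0.
  clear -rhoL rho_lie rho_irr sg zd; move: rho rhoL rho_lie rho_irr.
  (* The case [S = W] is separated, as irreducible representations were treated with matrices of
     positive size. *)
  case: (\dim {:V}) => [|n] rho rhoL rho_lie rho_irr; first exact: flatmx0.
  exact: rho_derived0 zd.
have /lfunP/(_ (quot_proj S W s)) : quot_end S W (ad z) = 0.
  by apply/eqP; rewrite -(mxof_eq0 bb bb); apply/eqP.
rewrite qE // zero_lfunE => /eqP; rewrite quot_proj_ker //.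
exact: (lie_idealP S).1.
Qed.

Lemma lcs_dec I i : lie_ideal I -> (lcs I i.+1 <= lcs I i)%VS.
Proof.
move=> iI; apply/lievP => x y _ yI.
by apply: (lie_idealP _).1 => //; apply: lie_ideal_lcs.
Qed.

(** For dimension reasons the descending central series of [d = [g, g]] stabilizes at some [S =
    [d, S]]. If [S] is nonzero, a maximal proper subideal [W] of [S] gives a chief factor, and [S =
    [d, S]] would lie in [W]. *)
Lemma derived_nilpotent : lie_solvable g -> lie_nilpotent (liev {:g} {:g} : {vspace g}).
Proof.
move=> sg; set d := liev _ _.
have id : lie_ideal d := lie_ideal_derived 1.
have [i iE] : exists i, lcs d i.+1 = lcs d i.
  apply: contrapT => ni.
  have lt i : (\dim (lcs d i) + i <= \dim d)%N.
    elim: i => [|i IH]; first by rewrite addn0.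
    rewrite addnS; apply: leq_trans IH; rewrite -addSn leq_add2r.
    rewrite ltn_neqAle dimvS ?lcs_dec // andbT.
    by apply/negP => e; apply: ni; exists i; apply/eqP;
      rewrite eqEdim lcs_dec // (eqP e) leqnn.
  by have := lt (\dim d).+1; rewrite addnS ltnNge leq_addl.
exists i; apply/eqP; apply: contraT => S0.
set S := lcs d i in iE S0.
have iS : lie_ideal S by apply: lie_ideal_lcs.
pose P n := `[< exists W, [/\ lie_ideal W, (W <= S)%VS, W != S & \dim W = n] >].
have ex : exists n, P n.
  exists 0%N; apply/asboolP; exists 0%VS; split; rewrite ?sub0v ?dimv0 1?eq_sym //.
  by apply/lievP => x y _; rewrite memv0 => /eqP->; rewrite linear0 mem0v.
have ub n : P n -> (n <= \dim S)%N.
  by move=> /asboolP[W [_ sW _ <-]]; apply: dimvS.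
have [n /asboolP[W [iW sWS nW dW]] nmax] := ex_maxnP ex ub.
have : (liev d S <= W)%VS.
  apply: derived_chief_factor => // U iU /andP[WU US].
  have [->|nU] := eqVneq U S; [by right|left].
  apply/esym/eqP; rewrite eqEdim WU dW; apply: nmax; apply/asboolP.
  by exists U; split.
rewrite -/(lcs d i.+1) [liev d S]iE => SW.
by case/eqP: nW; apply/eqP; rewrite eqEsubv sWS.
Qed.

Lemma derived_nilradical x y : lie_solvable g -> lie x y \in (nilradical g).
Proof.
move=> sg; have [_ _ nmax] := nilradicalP g.
apply: (subvP (nmax _ (lie_ideal_derived 1) (derived_nilpotent sg))).
by apply: memv_lie; apply: memvf.
Qed.

End Solvable.

(** * Traces on quotients *)


Lemma lftrace_basis (F : fieldType) (V : vectType F) (f : 'End(V))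
    (e : (\dim {:V}).-tuple V) :
  basis_of {:V} e ->
  lftrace f = \tr (mxof e e f).
Proof.
move=> be; pose b := vbasis {:V}; have bb : basis_of {:V} b := vbasisP _.
have -> : mxof e e f = mxof e b \1 *m mxof b b f *m mxof b e \1.
  by rewrite -!mxof_comp // comp_lfun1r comp_lfun1l.
rewrite mxtrace_mulC mulmxA -mxof_comp // comp_lfun1l.
by rewrite mxof1 ?mul1mx // (basis_free bb).
Qed.

Section Trace.
Variables (F : fieldType) (V : vectType F).
Implicit Types (U W : {vspace V}) (f : 'End(V)).

(* [c] induces a basis of [U / W]. *)
Definition basis_mod U W l (c : l.-tuple V) :=
  [/\ (W <= U)%VS, {subset c <= U}, (U <= <<c>> + W)%VS & \dim U = (l + \dim W)%N].

Lemma basis_mod_coord U W l (c : l.-tuple V) u : basis_mod U W c -> u \in U ->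
  exists r : 'rV[F]_l, u - \sum_j r 0 j *: c`_j \in W.
Proof.
move=> [_ _ sU _] uU; have /memv_addP[v vc [w wW ->]] := subvP sU u uU.
exists (\row_j coord c j v).
suff <- : v = \sum_j (\row_j coord c j v) 0 j *: c`_j by rewrite addrC addKr.
by rewrite {1}(coord_span vc); apply: eq_bigr => j _; rewrite mxE.
Qed.

Lemma basis_mod_diffv U W : (W <= U)%VS -> basis_mod U W (vbasis (U :\: W)%VS).
Proof.
move=> sWU; split=> //.
- by move=> u /vbasis_mem; apply: (subvP (diffvSl U W)).
- rewrite (span_basis (vbasisP _)) -{1}(addv_diff_cap U W).
  by rewrite addvS // capvSr.
by rewrite -(dimv_cap_compl U W) (capv_idPr sWU) addnC.
Qed.

(** Frees the trace from the chosen complement: any vectors inducing a basis of [U / W] compute it,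
    with coordinates taken modulo [W]. *)
Lemma quot_trace_mod U W l (c : l.-tuple V) f (M : 'M[F]_l) :
  basis_mod U W c -> (f @: U <= U)%VS -> (f @: W <= W)%VS ->
  (forall i : 'I_l, f c`_i - \sum_j M i j *: c`_j \in W) -> quot_trace U W f = \tr M.
Proof.
move=> bc fU fW fc; have [sWU cU sU dU] := bc.
have lE : l = \dim {:quot U W}.
  apply/eqP; rewrite dimvf /dim /= -(eqn_add2r (\dim W)) -dU.
  by rewrite -(dimv_cap_compl U W) (capv_idPr sWU) addnC.
subst l.
have c_U (i : 'I_(\dim {:quot U W})) : c`_i \in U by apply: cU;
  rewrite mem_nth ?size_tuple.
pose p := quot_proj U W; pose e := map_tuple p c.
have eE (i : 'I_(\dim {:quot U W})) : e`_i = p c`_i by rewrite (nth_map 0) ?size_tuple.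
have pE u (r : 'I_(\dim {:quot U W}) -> F) : u \in U -> u - \sum_j r j *: c`_j \in W ->
    p u = \sum_j r j *: e`_j.
  move=> uU uW; apply/eqP; rewrite -subr_eq0.
  rewrite (eq_bigr (fun j => p (r j *: c`_j))); last by move=> j _; rewrite linearZ eE.
  rewrite -linear_sum -linearB quot_proj_ker //.
  by rewrite memvB ?memv_suml // => j _; rewrite memvZ.
have be : basis_of fullv e.
  rewrite basisEdim size_tuple; apply/andP; split.
    apply/subvP => q _; have [u uU <-] := quot_proj_surj q.
    have [r ur] := basis_mod_coord bc uU; rewrite -/p (pE _ _ uU ur).
    apply: memv_suml => j _; apply: memvZ; apply: memv_span.
    by rewrite mem_nth ?size_tuple.
  exact: leqnn.
rewrite /quot_trace (lftrace_basis _ be); congr (\tr _).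
apply/matrixP => i j; rewrite !mxE /= vecof_delta eE quot_endE //.
rewrite -/p (pE _ (M i) _ (fc i)) ?(subvP fU) ?memv_img //.
by rewrite coord_sum_free ?(basis_free be).
Qed.

(** In a basis of [U / W2] adapted to [W1] the matrix of [f] is block triangular. *)
Lemma quot_traceD U W1 W2 f : (W2 <= W1)%VS -> (W1 <= U)%VS ->
  (f @: U <= U)%VS -> (f @: W1 <= W1)%VS -> (f @: W2 <= W2)%VS ->
  quot_trace U W2 f = quot_trace U W1 f + quot_trace W1 W2 f.
Proof.
move=> s21 s1U fU f1 f2; have bc := basis_mod_diffv s1U.
have bd := basis_mod_diffv s21.
set c := vbasis _ in bc; set d := vbasis _ in bd.
have [_ cU sU dU] := bc; have [_ dW sW dW1] := bd.
have fmem (f' : 'End(V)) T u : (f' @: T <= T)%VS -> u \in T -> f' u \in T.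
  by move=> /subvP H uT; apply: H; apply: memv_img.
have cu (i : 'I_(\dim (U :\: W1))) : f c`_i \in U by apply: fmem => //; apply: cU;
  rewrite mem_nth ?size_tuple.
have /boolp.choice[m mP] : forall i : 'I_(\dim (U :\: W1)), exists r : 'rV[F]_(\dim
  (U :\: W1)),
    f c`_i - \sum_j r 0 j *: c`_j \in W1.
  by move=> i; apply: basis_mod_coord bc _.
have du (i : 'I_(\dim (W1 :\: W2))) : f d`_i \in W1 by apply: fmem => //;
  apply: dW; rewrite mem_nth ?size_tuple.
have /boolp.choice[k kP] : forall i : 'I_(\dim (W1 :\: W2)), exists r :
  'rV[F]_(\dim (W1 :\: W2)),
    f d`_i - \sum_j r 0 j *: d`_j \in W2.
  by move=> i; apply: basis_mod_coord bd _.
have /boolp.choice[n nP] : forall i : 'I_(\dim (U :\: W1)), exists r : 'rV[F]_(\dim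
  (W1 :\: W2)),
    f c`_i - \sum_j m i 0 j *: c`_j - \sum_j r 0 j *: d`_j \in W2.
  by move=> i; apply: basis_mod_coord bd _.
rewrite (quot_trace_mod (M := \matrix_(i, j) m i 0 j) bc) //; last first.
  by move=> i; under eq_bigr do rewrite mxE; apply: mP.
rewrite (quot_trace_mod (M := \matrix_(i, j) k i 0 j) bd) //; last first.
  by move=> i; under eq_bigr do rewrite mxE; apply: kP.
rewrite (quot_trace_mod (c := cat_tuple c d)
  (M := block_mx (\matrix_(i, j) m i 0 j) (\matrix_(i, j) n i 0 j) 0
                 (\matrix_(i, j) k i 0 j))) ?mxtrace_block //.
  split; first exact: subv_trans s1U.
  - by move=> u; rewrite mem_cat => /orP[/cU//|/dW]; apply: (subvP s1U).
  - rewrite span_cat -addvA; apply: subv_trans sU _.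
    by apply: addvS.
  by rewrite dU dW1 addnA.
have catl (j : 'I_(\dim (U :\: W1))) : (cat_tuple c d)`_(lshift (\dim (W1 :\: W2))
  j) = c`_j.
  by rewrite nth_cat size_tuple /= ltn_ord.
have catr (j : 'I_(\dim (W1 :\: W2))) : (cat_tuple c d)`_(rshift (\dim (U :\: W1))
  j) = d`_j.
  by rewrite nth_cat size_tuple /= ltnNge leq_addr addKn.
move=> i; rewrite big_split_ord /=; case: (split_ordP i) => a ->.
  under eq_bigr do rewrite block_mxEul mxE -/(cat_tuple c d) catl.
  under [X in _ - (_ + X)]eq_bigr do rewrite block_mxEur mxE catr.
  by rewrite catl opprD addrA.
under eq_bigr do rewrite block_mxEdl mxE scale0r.
under [X in _ - (_ + X)]eq_bigr do rewrite block_mxEdr mxE catr.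
by rewrite catr big1 // add0r.
Qed.

Lemma quot_trace_sub0 U W f : (W <= U)%VS -> (f @: U <= W)%VS ->
  quot_trace U W f = 0.
Proof.
move=> sWU fUW; rewrite (quot_trace_mod (M := 0) (basis_mod_diffv sWU)).
- exact: mxtrace0.
- exact: subv_trans fUW sWU.
- by apply: subv_trans fUW; apply: limgS.
move=> i; rewrite big1 => [|j _]; last by rewrite mxE scale0r.
rewrite subr0 (subvP fUW) // memv_img // (subvP (diffvSl U W)) //.
by rewrite vbasis_mem // mem_nth ?size_tuple.
Qed.

Lemma quot_trace_basis U l (c : l.-tuple V) f (M : 'M[F]_l) :
  basis_of U c -> (f @: U <= U)%VS ->
  (forall i : 'I_l, f c`_i = \sum_j M i j *: c`_j) -> quot_trace U 0 f = \tr M.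
Proof.
move=> bc fU fc; apply: (quot_trace_mod (c := c)) => //.
- split; rewrite ?sub0v //; first by move=> u; apply: basis_mem bc.
    by rewrite addv0 (span_basis bc).
  by rewrite dimv0 addn0 -(span_basis bc) (eqnP (basis_free bc)) size_tuple.
- by rewrite limg0 subvv.
by move=> i; rewrite fc subrr mem0v.
Qed.

End Trace.

Section Unimodular.
Variables (F : numFieldType) (g : lieAlgType F).

Lemma ad_stable (U : {vspace g}) x : lie_ideal U -> (ad x @: U <= U)%VS.
Proof.
move=> /lie_idealP iU; apply/subvP => _ /memv_imgP[u uU ->].
by rewrite adE iU.
Qed.

(** The trace is added up along [g], the nilradical and its descending central series. The top
    quotient contributes zero because [[g, g]] lies in the nilradical. *)
Lemma strongly_unimodular_trace0 x : lie_solvable g -> strongly_unimodular g ->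
  quot_trace {:g} 0 (ad x) = 0.
Proof.
move=> sg ug; have [iN [k k0] _] := nilradicalP g.
have st i : (ad x @: lcs (nilradical g) i <= lcs (nilradical g) i)%VS.
  by apply: ad_stable; apply: lie_ideal_lcs.
rewrite -{1}k0; elim: k {k0} => [|k IH].
  apply: quot_trace_sub0; first exact: subvf.
  by apply/subvP => _ /memv_imgP[u _ ->]; rewrite adE derived_nilradical.
rewrite (quot_traceD (W1 := lcs (nilradical g) k)) ?subvf //.
  by rewrite IH add0r ug.
exact: lcs_dec.
Qed.

End Unimodular.

(** * Exact G2-structures *)


Section Differential.
Variables (R : realType) (g : lieAlgType R).

Lemma vec3E (x y z : g) (i : 'I_3) : vec3 x y z i = nth 0 [:: x; y; z] i.
Proof.
rewrite /vec3 /vec2; case: (unliftP ord0 i) => [j ->|->]; last by rewrite cons_vec0.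
rewrite cons_vec_lift; case: (unliftP ord0 j) => [k ->|->]; last by rewrite cons_vec0.
rewrite cons_vec_lift; case: (unliftP ord0 k) => [[]//|->]; by rewrite cons_vec0.
Qed.

Lemma ce_diff2E (a : kfun g 2) (x y z : g) :
  ce_diff a (vec3 x y z) =
  - a (vec2 (lie x y) z) + a (vec2 (lie x z) y) - a (vec2 (lie y z) x).
Proof.
have vE u (v : 'I_1 -> g) : cons_vec u v = vec2 u (v ord0).
  rewrite /vec2 [v in LHS]cons_vec_eta; congr cons_vec; congr cons_vec.
  by apply: funext => -[].
rewrite /ce_diff; under eq_bigr do rewrite big_mkcond.
rewrite !big_ord_recr !big_ord0 /= !vE !vec3E /=.
rewrite !(addn0, add0n) /= !(expr0, expr1, mulN1r, mul1r, add0r, addr0).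
by rewrite !exprS !expr0; ring.
Qed.
End Differential.

Section ExactG2.
Variables (R : realType) (g : lieAlgType R).
Variables (phi : kfun g 3) (alpha : kfun g 2).
Hypotheses (dg : \dim {:g} = 7%N) (sg : lie_solvable g)
  (ug : strongly_unimodular g) (g2 : g2_structure phi)
  (fa : is_form alpha) (phiE : phi = ce_diff alpha).
Implicit Types (u v w x y : g).

Let fphi : is_form phi. Proof. by case: g2. Qed.

Lemma exact_phiE x y z : phi (vec3 x y z) =
  - alpha (vec2 (lie x y) z) + alpha (vec2 (lie x z) y)
  - alpha (vec2 (lie y z) x).
Proof. by rewrite phiE ce_diff2E. Qed.

Lemma row_sum_sqr_gt0 n (r : 'rV[R]_n) : r != 0 -> 0 < (r *m r^T) 0 0.
Proof.
have ge0 (i : 'I_n) : true -> 0 <= r 0 i * r^T i 0.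
  by rewrite mxE -expr2 sqr_ge0.
move=> r0; rewrite mxE lt0r sumr_ge0 ?andbT //.
apply: contraNneq r0 => /(psumr_eq0P ge0) H; apply/eqP/rowP => i.
by have /eqP := H i isT; rewrite !mxE -expr2 sqrf_eq0 => /eqP.
Qed.

(* The contraction of [phi] by a central [v] is the differential of a 1-form
   [beta] and is nondegenerate modulo [v]; its dual vector [x] of [beta] scales
   it, so that [ad x] has trace [-3]. *)
Lemma exact_g2_center0 v : (forall x, lie v x = 0) -> v = 0.
Proof.
move=> cv; apply/eqP; apply: contraT => v0.
pose b := vbasis {:g}; have bb : basis_of {:g} b := vbasisP _.
pose rv := rVof b v.
have rv0 : rv != 0 by rewrite rVof_eq0.
have rvv := row_sum_sqr_gt0 rv0; set s := (_ *m _) 0 0 in rvv.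
have s0 : s != 0 by rewrite gt_eqF.
have sE : rv *m rv^T = s%:M by rewrite [LHS]mx11_scalar.
pose Om : 'M_(\dim {:g}) := \matrix_(i, j) phi (vec3 v b`_i b`_j).
have form_sum1 (h : g -> R) (r : 'rV_(\dim {:g})) :
    (forall c x y, h (c *: x + y) = c * h x + h y) ->
    h (vecof b r) = \sum_i r 0 i * h b`_i.
  move=> hL; have h0 : h 0 = 0 by have := hL 1 0 0; rewrite scale1r addr0; lra.
  rewrite /vecof; apply: (big_ind2 (fun x c => h x = c)) => //.
    by move=> x c y d <- <-; rewrite -[x]scale1r hL scale1r mul1r.
  by move=> i _; rewrite -[_ *: _]addr0 hL h0 addr0.
have rOm (r : 'rV_(\dim {:g})) j :
    (r *m Om) 0 j = phi (vec3 v (vecof b r) b`_j).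
  rewrite (form_sum1 (fun x => phi (vec3 v x b`_j))).
    by rewrite mxE; apply: eq_bigr => i _; rewrite mxE.
  by move=> c x y; apply: form3P2.
have rOmr (r q : 'rV_(\dim {:g})) :
    (r *m Om *m q^T) 0 0 = phi (vec3 v (vecof b r) (vecof b q)).
  rewrite (form_sum1 (fun x => phi (vec3 v (vecof b r) x))).
    by rewrite mxE; apply: eq_bigr => i _; rewrite rOm mxE mulrC.
  by move=> c x y; apply: form3P3.
have vecK : vecof b rv = v by rewrite rVofK.
have Omv (r : 'rV_(\dim {:g})) : r *m Om *m rv^T = 0.
  by rewrite [LHS]mx11_scalar rOmr vecK form3_xx3 // raddf0.
have vOm : rv *m Om = 0.
  by apply/rowP => j; rewrite rOm vecK form3_xx1 // mxE.
(* The alternating matrix [Om] has the line of [v] as radical. The rank-one term [E] makes it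
   invertible and keeps [rv] an eigenvector on both sides. *)
pose E := rv^T *m rv; pose M := Om + E.
have rvT : rv *m M = s *: rv.
  by rewrite mulmxDr vOm add0r mulmxA sE mul_scalar_mx.
have MvT : M *m rv^T = s *: rv^T.
  rewrite mulmxDl -mulmxA sE mul_mx_scalar [Om *m _](_ : _ = 0) ?add0r //.
  by apply/row_matrixP => i; rewrite row0 !rowE mulmxA Omv.
have E_Om (r q : 'rV_(\dim {:g})) : r *m M = q -> q *m rv^T = 0 -> r *m Om = q.
  move=> rM qv; have rs : r *m rv^T = 0.
    have := congr1 (mulmx^~ rv^T) rM; rewrite /= -mulmxA MvT qv -scalemxAr.
    by move/eqP; rewrite scaler_eq0 (negbTE s0) => /eqP.
  by rewrite -rM mulmxDr mulmxA rs mul0mx addr0.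
have MU : M \in unitmx.
  rewrite -row_free_unit -kermx_eq0; apply/rowV0P => r /sub_kermxP rM.
  have rOm0 : r *m Om = 0 by apply: E_Om => //; rewrite mul0mx.
  have : vecof b r \in <[v]>%VS.
    apply: (g2_cross_neq0 dg g2 v0) => y.
    rewrite -[y](rVofK bb) -rOmr rOm0 mul0mx mxE //.
  move=> /vlineP[k rk]; have rE : r = k *: rv.
    by apply: (can_inj (vecofK bb)); rewrite linearZ /= vecK.
  move: rM; rewrite rE -scalemxAl rvT scalerA => /eqP.
  by rewrite scaler_eq0 (negbTE rv0) mulf_eq0 (negbTE s0) !orbF => /eqP->;
    rewrite scale0r.
pose beta : 'rV_(\dim {:g}) := \row_j alpha (vec2 b`_j v).
have betaE (q : 'rV_(\dim {:g})) :
    (beta *m q^T) 0 0 = alpha (vec2 (vecof b q) v).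
  rewrite (form_sum1 (fun x => alpha (vec2 x v))).
    by rewrite mxE; apply: eq_bigr => i _; rewrite !mxE mulrC.
  by move=> c x y; apply: form2Pl.
(* This [x] is the analogue of a Liouville vector: [phi (v, x, y) = alpha (y, v)] for all [y]. *)
pose x := vecof b (beta *m invmx M).
have xE y : phi (vec3 v x y) = alpha (vec2 y v).
  rewrite -{1}[y](rVofK bb) -rOmr (E_Om _ beta) ?mulmxKV //.
    by rewrite betaE rVofK.
  by rewrite [LHS]mx11_scalar betaE vecK form2_xx // raddf0.
have phiv y z : phi (vec3 v y z) = - alpha (vec2 (lie y z) v).
  by rewrite exact_phiE !cv !form2_01 // oppr0 !add0r.
pose A := mxof b b (ad x).
have rA (r : 'rV_(\dim {:g})) : vecof b (r *m A) = lie x (vecof b r).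
  by rewrite mul_mxof rVofK //= adE.
have trA : \tr A = 0.
  rewrite -(strongly_unimodular_trace0 x sg ug).
  apply/esym/(quot_trace_basis bb).
    exact: subvf.
  move=> i; rewrite adE -(vecof_delta b) -rA /vecof; apply: eq_bigr => j _.
  by rewrite -rowE mxE.
(* By the Jacobi identity the left side is the form [- alpha ([x, [y, z]], v)], that is [phi (v, x,
   [y, z])]. By the choice of [x] this is [alpha ([y, z], v) = - phi (v, y, z)]. *)
have AOm : A *m Om + Om *m A^T = - Om.
  apply/matrixP => i j; rewrite !mxE.
  have -> : \sum_k A i k * Om k j = phi (vec3 v (lie x b`_i) b`_j).
    have := rOm (delta_mx 0 i *m A) j; rewrite rA vecof_delta => <-.
    by rewrite -rowE [RHS]mxE; apply: eq_bigr => k _; rewrite [row _ _ _ _]mxE.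
  have -> : \sum_k Om i k * A^T k j = phi (vec3 v b`_i (lie x b`_j)).
    have := rOmr (delta_mx 0 i) (delta_mx 0 j *m A); rewrite rA !vecof_delta => <-.
    rewrite -!rowE [RHS]mxE; apply: eq_bigr => k _.
    congr (_ * _); first by rewrite !mxE.
    by rewrite !mxE.
  rewrite !phiv -opprD -form2D1 //.
  have -> : lie (lie x b`_i) b`_j + lie b`_i (lie x b`_j) =
      lie x (lie b`_i b`_j).
    have := lie_jacobi x b`_i b`_j.
    rewrite (lieC b`_j (lie _ _)) (lieC b`_j x) linearN /=.
    move/eqP; rewrite subr_eq0 => /eqP <-.
    by rewrite subrK.
  have := phiv x (lie b`_i b`_j); rewrite xE => ->.
  by rewrite opprK.
have invM_v : invmx M *m rv^T = s^-1 *: rv^T.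
  apply: (canLR (mulKmx MU)); rewrite -scalemxAr MvT scalerA mulVf ?scale1r //.
have v_invM : rv *m invmx M = s^-1 *: rv.
  by apply: (canLR (mulmxK MU)); rewrite -scalemxAl rvT scalerA mulVf ?scale1r.
have vA : rv *m A = 0.
  apply: (can_inj (vecofK bb)); rewrite rA vecK lieC cv oppr0.
  by rewrite linear0.
have main : A *m M + M *m A^T = - M + E + A *m E + E *m A^T.
  by rewrite /M mulmxDr mulmxDl addrACA AOm opprD subrK addrA.
(* After multiplication by [invmx M] the traces read [2 tr A = - 7 + 1], the last two terms being
   zero since [rv] is killed by [A]; but [tr A = 0]. *)
clearbody M; have /(congr1 (fun X => \tr (invmx M *m X))) := main.
rewrite !mulmxDr !mxtraceD mulmxN mulVmx // mulKmx // mxtrace_tr.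
rewrite (mxtrace_mulC _ (A *m M)) -mulmxA mulmxV // mulmx1 trA addr0.
have -> : \tr (invmx M *m E) = 1.
  rewrite /E mulmxA invM_v -scalemxAl mxtraceZ mxtrace_mulC sE.
  by rewrite /mxtrace big_ord1 mxE eqxx mulr1n mulVf.
have -> : \tr (invmx M *m (A *m E)) = 0.
  rewrite /E mulmxA [in X in \tr X]mulmxA mxtrace_mulC !mulmxA v_invM.
  by rewrite -!scalemxAl vA !mul0mx scaler0 mxtrace0.
have -> : \tr (invmx M *m (E *m A^T)) = 0.
  rewrite /E !mulmxA invM_v -!scalemxAl mxtraceZ -mxtrace_tr !trmx_mul !trmxK.
  by rewrite mxtrace_mulC -mulmxA vA mulmx0 mxtrace0 mulr0.
rewrite raddfN /= mxtrace1 dg; lra.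
Qed.

End ExactG2.


Section Combination.
Variables (F : fieldType) (V : vectType F) (m : nat) (c : m.-tuple V).

Definition comb (r : 'rV[F]_m) : V := \sum_i r 0 i *: c`_i.

Lemma comb_linear : linear comb.
Proof.
move=> a r q; rewrite /comb scaler_sumr -big_split; apply: eq_bigr => i _ /=.
by rewrite !mxE scalerDl scalerA.
Qed.

HB.instance Definition _ := GRing.isSemilinear.Build F _ _ _ comb
  (GRing.semilinear_linear comb_linear).

Lemma comb_inj : free c -> injective comb.
Proof.
move=> fc r q rq; apply/rowP => i.
by rewrite -(coord_sum_free (r 0) i fc) -/(comb r) rq coord_sum_free.
Qed.

Lemma comb_delta i : comb (delta_mx 0 i) = c`_i.
Proof.
rewrite /comb (bigD1 i) //= mxE !eqxx scale1r big1 ?addr0 // => j /negbTE ij.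
by rewrite mxE ij andbF scale0r.
Qed.

Lemma comb_mem (U : {vspace V}) r : basis_of U c -> comb r \in U.
Proof.
move=> bc; apply: memv_suml => i _; apply/memvZ/(basis_mem bc).
by rewrite mem_nth ?size_tuple.
Qed.

Lemma comb_surj (U : {vspace V}) u : basis_of U c -> u \in U ->
  exists r, u = comb r.
Proof.
move=> bc uU; exists (\row_i coord c i u); rewrite {1}(coord_basis bc uU).
by apply: eq_bigr => i _; rewrite mxE.
Qed.

End Combination.

Lemma vspace_basis (F : fieldType) (V : vectType F) (U : {vspace V}) m :
  \dim U = m -> exists c : m.-tuple V, basis_of U c.
Proof. by move=> <-; exists (vbasis U); apply: vbasisP. Qed.

Lemma basis_of_comb (F : fieldType) (V : vectType F) (U : {vspace V}) m
    (c : m.-tuple V) :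
  \dim U = m -> {subset c <= U} -> (forall r, comb c r = 0 -> r = 0) -> basis_of U c.
Proof.
move=> dU cU c0; rewrite basisEfree dU size_tuple leqnn andbT; apply/andP; split.
  apply/freeP => k k0 i.
  have /rowP/(_ i) : (\row_j k j) = 0.
    by apply: c0; rewrite -[RHS]k0; apply: eq_bigr => j _; rewrite mxE.
  by rewrite !mxE.
by apply/span_subvP.
Qed.

Section Cross.
Variables (R : realType) (V : vectType R) (phi : kfun V 3).
Hypotheses (dV : \dim {:V} = 7%N) (g2 : g2_structure phi).
Let fphi : is_form phi. Proof. by case: g2. Qed.

Definition cross_mx m l (c : m.-tuple V) (Y : l.-tuple V) v : 'M[R]_(m, l) :=
  \matrix_(i, j) phi (vec3 v c`_i Y`_j).

Lemma mul_cross_mx m l (c : m.-tuple V) (Y : l.-tuple V) v r j :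
  (r *m cross_mx c Y v) 0 j = phi (vec3 v (comb c r) Y`_j).
Proof.
rewrite mxE /comb; apply/esym.
apply: (big_ind2 (fun x c => phi (vec3 v x Y`_j) = c)) => //.
- exact: form3_02.
- by move=> x a y d <- <-; rewrite form3D2.
by move=> i _; rewrite form3Z2 // mxE.
Qed.

(** For [w] in [z] the functional [phi (v, w, .)] already vanishes on [n]. If it also vanishes on
    the supplementary vectors [Y] it is zero, and [g2_cross_neq0] puts [w] on the line of [v]. *)
Lemma kermx_cross m l (c : m.-tuple V) (Y : l.-tuple V) (z n : {vspace V}) r :
  basis_of z c -> (n + <<Y>> = fullv)%VS -> comb c r != 0 ->
  (forall u w y, u \in z -> w \in z -> y \in n -> phi (vec3 u w y) = 0) ->
  (kermx (cross_mx c Y (comb c r)) <= r)%MS.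
Proof.
move=> bc nY v0 zzn; set v := comb c r in v0 *.
have vz : v \in z := comb_mem _ bc.
apply/row_subP => i; have := row_sub i (kermx (cross_mx c Y v)).
move: (row i _) => q /sub_kermxP qC.
have : comb c q \in <[v]>%VS.
  apply: (g2_cross_neq0 dV g2 v0) => x; have := memvf x; rewrite -nY.
  move=> /memv_addP[x1 x1n [x2 x2Y ->]].
  rewrite form3D3 // zzn ?(comb_mem _ bc) // add0r (coord_span x2Y).
  apply: (big_ind (fun x => phi (vec3 v (comb c q) x) = 0)).
  - exact: form3_03.
  - by move=> x3 x4 h3 h4; rewrite form3D3 // h3 h4 addr0.
  by move=> j _; rewrite form3Z3 // -mul_cross_mx qC mxE mulr0.
move=> /vlineP[k qk]; have -> : q = k *: r.
  by apply: (comb_inj (basis_free bc)); rewrite linearZ.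
exact: scalemx_sub.
Qed.

End Cross.

(** * Dimension of a traceless ideal centralized by the nilradical *)

Section ExactG2.
Variables (R : realType) (g : lieAlgType R).
Variables (phi : kfun g 3) (alpha : kfun g 2).
Hypotheses (dg : \dim {:g} = 7%N) (sg : lie_solvable g)
  (ug : strongly_unimodular g) (g2 : g2_structure phi)
  (fa : is_form alpha) (phiE : phi = ce_diff alpha).
Implicit Types (u v w x y : g).

Let fphi : is_form phi. Proof. by case: g2. Qed.
Let n := nilradical g.

Variable z : {vspace g}.
Hypotheses (iz : lie_ideal z) (zn : (z <= n)%VS)
  (nz : {in n & z, forall u w, lie u w = 0})
  (trz : forall x, quot_trace z 0 (ad x) = 0).

Lemma phi_zzn v w y : v \in z -> w \in z -> y \in n -> phi (vec3 v w y) = 0.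
Proof.
move=> vz wz yn; rewrite (exact_phiE phiE) (nz (subvP zn _ vz) wz).
by rewrite (lieC v) (lieC w) !nz // !oppr0 !form2_01 // !oppr0 !addr0.
Qed.

Lemma lie_z_comm x y w : w \in z -> lie x (lie y w) = lie y (lie x w).
Proof.
move=> wz; have := lie_jacobi x y w.
rewrite (lieC w (lie x y)) (nz (derived_nilradical x y sg) wz) oppr0 addr0.
by rewrite (lieC w x) linearN /= => /eqP; rewrite subr_eq0 => /eqP.
Qed.

Section Basis.
Variables (m : nat) (c : m.-tuple g).
Hypothesis bc : basis_of z c.

Definition ad_mx x : 'M[R]_m := \matrix_(i, j) coord c j (lie x c`_i).

Lemma ad_mx_nth x (i : 'I_m) : lie x c`_i = \sum_j ad_mx x i j *: c`_j.
Proof.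
have ciz : c`_i \in z by apply: (basis_mem bc); rewrite mem_nth ?size_tuple.
rewrite {1}(coord_basis bc ((lie_idealP z).1 iz x _ ciz)).
by apply: eq_bigr => j _; rewrite mxE.
Qed.

Lemma ad_mx_comb x r : lie x (comb c r) = comb c (r *m ad_mx x).
Proof.
rewrite {1}/comb linear_sum /= /comb.
under [RHS]eq_bigr do rewrite mxE scaler_suml.
rewrite exchange_big; apply: eq_bigr => i _ /=.
rewrite linearZ /= ad_mx_nth scaler_sumr; apply: eq_bigr => j _.
by rewrite scalerA.
Qed.

Lemma ad_mx_trace x : \tr (ad_mx x) = 0.
Proof.
rewrite -(trz x); apply/esym/(quot_trace_basis bc); first exact: ad_stable.
by move=> i; rewrite adE ad_mx_nth.
Qed.

Lemma ad_mx_comm x y : comm_mx (ad_mx x) (ad_mx y).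
Proof.
apply/row_matrixP => i; rewrite !rowE; apply: (comb_inj (basis_free bc)).
by rewrite !mulmxA -!ad_mx_comb lie_z_comm // comb_mem.
Qed.

Lemma ad_mx_linear : linear ad_mx.
Proof. by move=> a x y; apply/matrixP => i j; rewrite !mxE lieDl lieZl linearP. Qed.

HB.instance Definition _ := GRing.isSemilinear.Build R g _ _ ad_mx
  (GRing.semilinear_linear ad_mx_linear).

End Basis.

Lemma z_independent_cross u v : u \in z -> v \in z -> u != 0 ->
  (forall x, phi (vec3 u v x) = 0) -> v \in <[u]>%VS.
Proof. by move=> uz vz u0; apply: (g2_cross_neq0 dg g2 u0). Qed.

Lemma dim_z_le : (\dim z + \dim n <= 8)%N.
Proof.
have [->|zN0] := eqVneq z 0%VS.
  by rewrite dimv0 (leq_trans (dimvS (subvf _))) // dg.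
pose b := vbasis z; pose Y := vbasis (n^C)%VS.
have bb : basis_of z b := vbasisP z.
pose v := vpick z; have vz : v \in z := memv_pick z.
have v0 : v != 0 by rewrite vpick0.
have [r vr] := comb_surj bb vz; rewrite vr in v0.
have nY : (n + <<Y>> = fullv)%VS by rewrite (span_basis (vbasisP _)) addv_complf.
have kC := kermx_cross dg g2 bb nY v0 phi_zzn; set C := cross_mx _ _ _ _ in kC.
have := leq_trans (mxrankS kC) (rank_leq_row r).
have := dimv_compl n; have := dimvS (subvf n); have := rank_leq_col C.
rewrite mxrank_ker dg; move: (\rank C) => rk.
by move: (\dim z) (\dim n) (\dim n^C) => d1 d2 d3; lia.
Qed.

(** A traceless action on a line is zero, so a spanning vector would be central. *)
Lemma dim_z_neq1 : \dim z <> 1%N.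
Proof.
move=> /vspace_basis[c bc]; have : c`_0 != 0.
  by apply: (free_not0 (basis_free bc)); rewrite mem_nth ?size_tuple.
apply/negP/negPn/eqP/(exact_g2_center0 dg sg ug g2 fa phiE) => x.
rewrite lieC -[0%N]/(nat_of_ord (@ord0 0)) (ad_mx_nth bc) big_ord1.
have := ad_mx_trace bc x; rewrite /mxtrace big_ord1 => ->.
by rewrite scale0r oppr0.
Qed.

(** On a plane, [alpha ([x, u], w) + alpha (u, [x, w])] is [alpha (u, w)] times the trace of the
    action of [x]. Hence [phi (u, w, .)] vanishes for a basis [u, w]. *)
Lemma dim_z_neq2 : \dim z <> 2%N.
Proof.
move=> /vspace_basis[c bc].
have cz i : (i < 2)%N -> c`_i \in z.
  by move=> i2; apply: (basis_mem bc); rewrite mem_nth ?size_tuple.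
have c0 : c`_0 != 0.
  by apply: (free_not0 (basis_free bc)); rewrite mem_nth ?size_tuple.
have : c`_1 \in <[c`_0]>%VS.
  apply: z_independent_cross => //; try exact: cz.
  move=> x; rewrite (exact_phiE phiE) (nz (subvP zn _ (cz 0%N isT))) ?cz //.
  rewrite form2_01 // oppr0 add0r (lieC _ x) (lieC _ x) -!scaleN1r !form2Z1 //.
  have := ad_mx_nth bc x ord0; have := ad_mx_nth bc x (lift ord0 ord0).
  rewrite !big_ord_recl !big_ord0 /= !addr0 => -> ->.
  rewrite !form2D1 // !form2Z1 // !form2_xx // (form2C fa c`_1 c`_0).
  have := ad_mx_trace bc x; rewrite /mxtrace !big_ord_recl big_ord0 addr0.
  set p := ad_mx _ _ _ _; set q := ad_mx _ _ (lift _ _) (lift _ _) => pq.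
  have -> : q = - p by apply/eqP; rewrite -addr_eq0 addrC pq.
  by ring.
move=> /vlineP[k kE].
have kE' : comb c (delta_mx 0 (lift ord0 ord0)) = comb c (k *: delta_mx 0 ord0).
  by rewrite linearZ /= !comb_delta.
have /rowP/(_ (lift ord0 ord0)) := comb_inj (basis_free bc) kE'.
by rewrite !mxE /= mulr0 => /eqP; rewrite oner_eq0.
Qed.

(* Every bivector of a 3-dimensional space is decomposable. *)
Lemma bivector3_neq0 u0 u1 u2 (d0 d1 d2 : R) : u0 \in z -> u1 \in z -> u2 \in z ->
  (forall a b c, a *: u0 + b *: u1 + c *: u2 = 0 -> [/\ a = 0, b = 0 & c = 0]) ->
  (forall x, d0 * phi (vec3 u1 u2 x) + d1 * phi (vec3 u2 u0 x)
             + d2 * phi (vec3 u0 u1 x) = 0) -> d0 = 0.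
Proof.
move=> u0z u1z u2z fr H; apply/eqP; apply: contraT => d00.
(* These are chosen so that the bivector with coefficients [d0, d1, d2] equals [d0] times [p] wedge
   [q]. *)
pose p := u1 - (d1 / d0) *: u0; pose q := u2 - (d2 / d0) *: u0.
have p0 : p != 0.
  apply/eqP => p0; have [|_ /eqP b0 _] := fr (- (d1 / d0)) 1 0.
    by rewrite scale0r addr0 scale1r scaleNr addrC.
  by move: b0; rewrite oner_eq0.
have : q \in <[p]>%VS.
  apply: z_independent_cross => //; rewrite ?memvB ?memvZ // => x.
  rewrite /p /q -!scaleNr !form3D1 // !form3D2 // !form3Z1 // !form3Z2 //.
  apply: (mulfI d00); rewrite mulr0 -[RHS](H x).
  by rewrite form3_xx1 // (form3C1 fphi u1 u0) (form3C1 fphi u2 u0); field.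
move=> /vlineP[k qE].
have [|_ _ /eqP] := fr (k * (d1 / d0) - d2 / d0) (- k) 1.
  move/eqP: qE; rewrite -subr_eq0 => /eqP <-.
  rewrite /q /p scale1r scalerBl scalerBr scalerA scaleNr opprB.
  by rewrite [LHS]addrC -!addrA; congr (_ + _); rewrite addrCA.
by rewrite oner_eq0.
Qed.

(* With [a] the row of values of [alpha] on the pairs of basis vectors, the
   values of [phi (., ., x)] on these pairs form the row [a *m ad_mx x]; since these
   rows fill the space, some [ad_mx x] fixes [a], hence, by commutation, every
   row, contradicting its trace being zero. *)
Lemma dim_z_neq3 : \dim z <> 3%N.
Proof.
move=> /vspace_basis[c bc]; have fc := basis_free bc.
pose u0 := c`_0; pose u1 := c`_1; pose u2 := c`_2.
have cz i : (i < 3)%N -> c`_i \in z.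
  by move=> i3; apply: (basis_mem bc); rewrite mem_nth ?size_tuple.
pose o0 : 'I_3 := ord0; pose o1 : 'I_3 := lift ord0 ord0.
pose o2 : 'I_3 := lift ord0 (lift ord0 ord0).
have sum3 (T : zmodType) (f : 'I_3 -> T) : \sum_i f i = f o0 + f o1 + f o2.
  by rewrite !big_ord_recl big_ord0 addr0 addrA.
have ord3 (i : 'I_3) : [\/ i = o0, i = o1 | i = o2].
  case: i => [[|[|[|]]]] // i3; [exact: Or31 (val_inj _) | exact: Or32 (val_inj _)
    | exact: Or33 (val_inj _)].
have fr a b d : a *: u0 + b *: u1 + d *: u2 = 0 -> [/\ a = 0, b = 0 & d = 0].
  pose r : 'rV[R]_3 := a *: delta_mx 0 o0 + b *: delta_mx 0 o1 + d *: delta_mx 0 o2.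
  have -> : a *: u0 + b *: u1 + d *: u2 = comb c r.
    by rewrite /r !linearD !linearZ /= !comb_delta.
  move=> r0; have {}r0 : r = 0 by apply: (comb_inj fc); rewrite linear0.
  have rE i : r 0 i = 0 by rewrite r0 mxE.
  have := rE o0; have := rE o1; have := rE o2.
  rewrite !mxE /= !(mulr0, mulr1, add0r, addr0).
  by move=> -> -> ->.
have [z0 z1 z2] : [/\ u0 \in z, u1 \in z & u2 \in z] by split; apply: cz.
pose w3 (p : R * R * R) : 'rV[R]_3 :=
  \row_j (if j == o0 then p.1.1 else if j == o1 then p.1.2 else p.2).
pose a := w3 (alpha (vec2 u1 u2), alpha (vec2 u2 u0), alpha (vec2 u0 u1)).
pose om x := w3 (phi (vec3 u1 u2 x), phi (vec3 u2 u0 x), phi (vec3 u0 u1 x)).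
have u_lie x : [/\
    lie x u0 = ad_mx c x o0 o0 *: u0 + ad_mx c x o0 o1 *: u1 + ad_mx c x o0 o2 *: u2,
    lie x u1 = ad_mx c x o1 o0 *: u0 + ad_mx c x o1 o1 *: u1 + ad_mx c x o1 o2 *: u2 &
    lie x u2 = ad_mx c x o2 o0 *: u0 + ad_mx c x o2 o1 *: u1 + ad_mx c x o2 o2 *: u2].
  split; [have := ad_mx_nth bc x o0 | have := ad_mx_nth bc x o1 | have := ad_mx_nth
    bc x o2];
  by rewrite sum3.
(* On bivectors of a 3-dimensional space, in the dual basis, an endomorphism acts as its trace minus
   its transpose; the trace is zero here. *)
have omE x : om x = a *m ad_mx c x.
  have tr0 := ad_mx_trace bc x; rewrite /mxtrace sum3 in tr0.
  have [l0 l1 l2] := u_lie x; apply/rowP => j;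
    rewrite [RHS]mxE sum3 /om /a ![w3 _ _ _]mxE /=.
  have ph u v : u \in z -> v \in z -> phi (vec3 u v x) =
      - alpha (vec2 (lie x u) v) + alpha (vec2 (lie x v) u).
    move=> uz vz; rewrite (exact_phiE phiE) (nz (subvP zn _ uz) vz) form2_01 //.
    rewrite (lieC u) (lieC v) -!scaleN1r !form2Z1 //; ring.
  move: l0 l1 l2 tr0.
  set m00 := ad_mx c x o0 o0; set m01 := ad_mx c x o0 o1; set m02 := ad_mx c x o0 o2.
  set m10 := ad_mx c x o1 o0; set m11 := ad_mx c x o1 o1; set m12 := ad_mx c x o1 o2.
  set m20 := ad_mx c x o2 o0; set m21 := ad_mx c x o2 o1; set m22 := ad_mx c x o2 o2.
  move=> l0 l1 l2 tr0; have {}tr0 : m22 = - m00 - m11 by lra.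
  case: (ord3 j) => -> /=; rewrite !ph // !(l0, l1, l2) !form2D1 // !form2Z1 //;
  rewrite !form2_xx // ?(form2C fa u2 u1) ?(form2C fa u1 u0) ?(form2C fa u0 u2);
  by rewrite -/m00 -/m01 -/m02 -/m10 -/m11 -/m12 -/m20 -/m21 -/m22 ?tr0; ring.
pose b := vbasis {:g}.
pose W : 'M[R]_(\dim {:g}, 3) := \matrix_i om b`_i.
have Wrow (r : 'rV_(\dim {:g})) : r *m W = om (comb b r).
  rewrite omE; have -> : ad_mx c (comb b r) = \sum_i r 0 i *: ad_mx c b`_i.
    by rewrite /comb linear_sum; apply: eq_bigr => i _; rewrite linearZ.
  rewrite mulmx_sumr mulmx_sum_row; apply: eq_bigr => i _.
  by rewrite -scalemxAr -omE rowK.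
(* A linear relation [d] between the columns is a bivector of [z] on which all [phi (., ., x)]
   vanish; [bivector3_neq0], applied to the three cyclic orders, makes it zero. *)
have W_full : row_full W.
  rewrite /row_full -mxrank_tr -/(row_free W^T) -kermx_eq0.
  apply/rowV0P => d /sub_kermxP dW.
  have H x : d 0 o0 * phi (vec3 u1 u2 x) + d 0 o1 * phi (vec3 u2 u0 x)
      + d 0 o2 * phi (vec3 u0 u1 x) = 0.
    have [r ->] := comb_surj (vbasisP {:g}) (memvf x).
    have /matrixP/(_ 0 0) : d *m (om (comb b r))^T = 0.
      by rewrite -Wrow trmx_mul mulmxA dW mul0mx.
    by rewrite mxE sum3 !mxE /=.
  apply/rowP => j; rewrite mxE; case: (ord3 j) => ->.
  - exact: (bivector3_neq0 z0 z1 z2 fr H).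
  - apply: (bivector3_neq0 z1 z2 z0 _ (d1 := d 0 o2) (d2 := d 0 o0)).
      move=> p q s pqs; have [|h0 h1 h2] := fr s p q; last by split.
      by rewrite -[RHS]pqs [RHS]addrC [RHS]addrA.
    by move=> x; rewrite -(H x); ring.
  apply: (bivector3_neq0 z2 z0 z1 _ (d1 := d 0 o0) (d2 := d 0 o1)).
    move=> p q s pqs; have [|h0 h1 h2] := fr q s p; last by split.
    by rewrite -[RHS]pqs -[RHS]addrA [RHS]addrC.
  by move=> x; rewrite -(H x); ring.
have /submxP[D DW] : (a <= W)%MS by apply: submx_full.
pose x := comb b D; have ax : a *m ad_mx c x = a by rewrite -omE -Wrow -DW.
have act1 : ad_mx c x = 1%:M.
  apply: (row_full_inj W_full); rewrite mulmx1; apply/row_matrixP => i.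
  by rewrite row_mul rowK omE -mulmxA ad_mx_comm // mulmxA ax.
have := ad_mx_trace bc x; rewrite act1 mxtrace1 => /eqP.
by rewrite pnatr_eq0.
Qed.

End ExactG2.

(** * An abelian coassociative ideal *)


(** If orthogonal [x, y] had values of opposite signs, some [x + t *: y] would be isotropic. So [B]
    is definite on [a], Gram-Schmidt applies, and [s] is the common sign. *)
Lemma anisotropic_orthonormal3 (R : realType) (V : vectType R) (a : {vspace V})
    (B : V -> V -> R) :
  (forall c x y t, B (c *: x + y) t = c * B x t + B y t) ->
  (forall x y, B x y = B y x) ->
  {in a, forall x, x != 0 -> B x x != 0} -> \dim a = 3%N ->
  exists s x1 x2 x3, [/\ s != 0, [/\ x1 \in a, x2 \in a & x3 \in a],
    [/\ B x1 x1 = s, B x2 x2 = s & B x3 x3 = s] &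
    [/\ B x1 x2 = 0, B x1 x3 = 0 & B x2 x3 = 0]].
Proof.
move=> BP BC aniso /vspace_basis[c bc]; have fc := basis_free bc.
have B0 t : B 0 t = 0.
  by have := BP 1 0 0 t; rewrite scale1r addr0; lra.
have BD x y t : B (x + y) t = B x t + B y t.
  by rewrite -[x]scale1r BP scale1r mul1r.
have BZ k x t : B (k *: x) t = k * B x t.
  by rewrite -[k *: x]addr0 BP B0 addr0.
have BDr x y t : B t (x + y) = B t x + B t y by rewrite BC BD !(BC t).
have BZr k x t : B t (k *: x) = k * B t x by rewrite BC BZ (BC t).
have samesign x y : x \in a -> y \in a -> x != 0 -> y != 0 -> B x y = 0 ->
    0 < B x x * B y y.
  move=> xa ya x0 y0 xy; have qx := aniso x xa x0; have qy := aniso y ya y0.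
  rewrite lt_neqAle eq_sym mulf_neq0 //= leNgt; apply/negP => neg.
  pose t := Num.sqrt (- (B x x / B y y)).
  have t2 : t ^+ 2 = - (B x x / B y y).
    rewrite sqr_sqrtr // oppr_ge0 -(pmulr_lle0 _ (_ : 0 < B y y ^+ 2)).
      have -> : B x x / B y y * B y y ^+ 2 = B x x * B y y by field.
      exact: ltW.
    by rewrite exprn_even_gt0.
  have xy0 : x + t *: y != 0.
    apply/eqP => xty; have := BD x (t *: y) x; rewrite xty B0 BZ (BC y) xy mulr0 addr0.
    by move=> h; move: qx; rewrite -h eqxx.
  have := aniso _ (memvD xa (memvZ t ya)) xy0.
  rewrite BD !BDr !BZ !BZr (BC y) xy !mulr0 addr0 add0r mulrA -expr2 t2.
  by rewrite mulNr divfK // subrr eqxx.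
pose y0 := c`_0; pose y1 := c`_1; pose y2 := c`_2.
have cz i : (i < 3)%N -> c`_i \in a.
  by move=> i3; apply: (basis_mem bc); rewrite mem_nth ?size_tuple.
have fr p q d : p *: y0 + q *: y1 + d *: y2 = 0 -> [/\ p = 0, q = 0 & d = 0].
  move=> h; pose r : 'rV[R]_3 := \row_j nth 0 [:: p; q; d] j.
  have r0 : r = 0.
    apply: (comb_inj fc); rewrite linear0 /comb !big_ord_recl big_ord0 !mxE /=.
    by rewrite addr0 addrA.
  have rE i : r 0 i = 0 by rewrite r0 mxE.
  by have := rE ord0; have := rE (lift ord0 ord0);
    have := rE (lift ord0 (lift ord0 ord0)); rewrite !mxE /= => -> -> ->.
have [a0 a1 a2] : [/\ y0 \in a, y1 \in a & y2 \in a] by split; apply: cz.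
have n0 : y0 != 0.
  apply/eqP => h; have [|/eqP] := fr 1 0 0; rewrite ?oner_eq0 //.
  by rewrite h scaler0 !scale0r !addr0.
pose k01 := B y1 y0 / B y0 y0; pose z1 := y1 - k01 *: y0.
have za1 : z1 \in a by rewrite memvB ?memvZ.
have n1 : z1 != 0.
  apply/eqP => h; have [|_ /eqP] := fr (- k01) 1 0; rewrite ?oner_eq0 //.
  by rewrite scale0r addr0 scale1r scaleNr addrC.
have q0 := aniso _ a0 n0; have q1 := aniso _ za1 n1.
have o01 : B y0 z1 = 0.
  by rewrite /z1 -scaleNr BDr BZr /k01 (BC y0 y1) mulNr divfK // subrr.
pose k02 := B y2 y0 / B y0 y0; pose k12 := B y2 z1 / B z1 z1.
pose z2 := y2 - k02 *: y0 - k12 *: z1.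
have za2 : z2 \in a by rewrite !memvB ?memvZ.
have n2 : z2 != 0.
  apply/eqP => h; have [|_ _ /eqP] := fr (k12 * k01 - k02) (- k12) 1;
    rewrite ?oner_eq0 //.
  rewrite -h /z2 /z1 scale1r scalerBl scalerBr scalerA scaleNr opprB.
  by rewrite [LHS]addrC -!addrA; congr (_ + _); rewrite addrCA.
have o02 : B y0 z2 = 0.
  rewrite /z2 -!scaleNr !BDr !BZr o01 mulr0 addr0 /k02 (BC y0 y2).
  by rewrite mulNr divfK // subrr.
have o12 : B z1 z2 = 0.
  rewrite /z2 -!scaleNr !BDr !BZr (BC z1 y0) o01 mulr0 addr0 /k12 (BC z1 y2).
  by rewrite mulNr divfK // subrr.
have q2 := aniso _ za2 n2.
have s01 := samesign _ _ a0 za1 n0 n1 o01.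
have s02 := samesign _ _ a0 za2 n0 n2 o02.
pose nrm x := (Num.sqrt `|B x x|)^-1 *: x.
have nE x : B x x != 0 -> B (nrm x) (nrm x) = Num.sg (B x x).
  move=> qx; rewrite /nrm BZ BZr mulrA -expr2 exprVn sqr_sqrtr ?normr_ge0 //.
  by rewrite {2}[B x x]numEsg mulrCA mulVf ?mulr1 // normr_eq0.
have nO x y : B x y = 0 -> B (nrm x) (nrm y) = 0.
  by move=> xy; rewrite /nrm BZ BZr xy !mulr0.
have sgE x : x != 0 :> R -> 0 < B y0 y0 * x -> Num.sg x = Num.sg (B y0 y0).
  move=> x0 h; have := gtr0_sg h; rewrite sgrM => hs.
  have ss : Num.sg x * Num.sg x = 1 by rewrite -expr2 sqr_sg x0.
  by rewrite -[LHS]mul1r -hs -mulrA ss mulr1.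
exists (Num.sg (B y0 y0)), (nrm y0), (nrm z1), (nrm z2); split.
- by rewrite sgr_eq0.
- by split; apply: memvZ.
- by rewrite !nE // !sgE.
by split; apply: nO.
Qed.

Section Dim4.
Variables (R : realType) (g : lieAlgType R).
Variables (phi : kfun g 3) (alpha : kfun g 2).
Hypotheses (dg : \dim {:g} = 7%N) (g2 : g2_structure phi)
  (fa : is_form alpha) (phiE : phi = ce_diff alpha)
  (center0 : forall v : g, (forall x, lie v x = 0) -> v = 0).
Implicit Types (u v w x y : g).

Let fphi : is_form phi. Proof. by case: g2. Qed.

Variable z : {vspace g}.
Hypotheses (zab : {in z &, forall u w, lie u w = 0})
  (zder : forall x y, lie x y \in z) (dz : \dim z = 4%N).

Lemma phi_z3 u v w : u \in z -> v \in z -> w \in z -> phi (vec3 u v w) = 0.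
Proof.
move=> uz vz wz; rewrite (exact_phiE phiE) !zab // !form2_01 //.
by rewrite !oppr0 !addr0.
Qed.

Lemma z_act_comm x y w : w \in z -> lie x (lie y w) = lie y (lie x w).
Proof.
move=> wz; have := lie_jacobi x y w.
rewrite (zab wz (zder x y)) addr0 (lieC w x) linearN /=.
by move=> /eqP; rewrite subr_eq0 => /eqP.
Qed.

Lemma z_ideal : lie_ideal z.
Proof. by apply/lie_idealP => x y _. Qed.

(** The complement is the kernel of [ad X] for an [X] acting invertibly on [z]. If [x, y] commute
    with [X], so does [[x, y]], which lies in [z] and is therefore zero. Such an [X] comes from
    [comm3_unitmx], since a common null vector in [z] would be central. *)
Lemma abelian_complement : exists a : {vspace g},
  [/\ {in a &, forall x y, lie x y = 0}, (z :&: a = 0)%VS & (z + a = fullv)%VS].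
Proof.
have [c bc] := vspace_basis dz; have fc := basis_free bc.
have dzC : \dim (z^C)%VS = 3%N by rewrite dimv_compl dg dz.
have [Y bY] := vspace_basis dzC.
have zact := ad_mx_comb z_ideal bc.
have cact x y : comm_mx (ad_mx c x) (ad_mx c y).
  apply/row_matrixP => i; rewrite !rowE; apply: (comb_inj fc).
  by rewrite !mulmxA -!zact z_act_comm // (comb_mem _ bc).
have [||||s [t U]] := @comm3_unitmx _ 3 (ad_mx c Y`_0) (ad_mx c Y`_1) (ad_mx c Y`_2);
  try exact: cact.
  move=> r r0 r1 r2; apply: (comb_inj fc); rewrite linear0; apply: center0 => x.
  have : x \in (z + z^C)%VS by rewrite addv_complf memvf.
  move=> /memv_addP[x1 x1z [x2 x2Y ->]].
  have [q ->] := comb_surj bY x2Y; rewrite linearD /= zab ?(comb_mem _ bc) // add0r.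
  rewrite lieC [comb Y q]/comb !big_ord_recl big_ord0 addr0 !lieDl !lieZl.
  by rewrite !zact /= r0 r1 r2 !linear0 ?scaler0 !addr0 oppr0.
pose X := Y`_0 + s *: Y`_1 + t *: Y`_2.
have {}U : ad_mx c X \in unitmx by rewrite /X !linearD !linearZ.
have Xinj : {in z, forall u, lie X u = 0 -> u = 0}.
  move=> _ /(comb_surj bc)[r ->]; rewrite zact => H.
  have rX : r *m ad_mx c X = 0 by apply: (comb_inj fc); rewrite H linear0.
  by rewrite -[r](mulmxK U) rX mul0mx linear0.
exists (lker (ad X)); split.
- move=> x y; rewrite !memv_ker !adE => /eqP Xx /eqP Xy.
  apply: Xinj; first exact: zder.
  have := lie_jacobi X x y; rewrite (lieC y X) Xx Xy oppr0 !linear0.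
  by rewrite !addr0.
- apply/eqP; rewrite -subv0; apply/subvP => u; rewrite memv_cap memv_ker adE.
  by case/andP=> uz /eqP Xu; rewrite memv0 (Xinj u).
apply/eqP; rewrite eqEsubv subvf; apply/subvP => x _.
have [q qE] := comb_surj bc (zder X x).
(* The unique [h] in [z] with [[X, h] = [X, x]], so that [x - h] is in the kernel. *)
pose h := comb c (q *m invmx (ad_mx c X)).
rewrite -[x](subrK h) addrC memv_add ?(comb_mem _ bc) //.
by rewrite memv_ker linearB /= !adE qE zact mulmxKV // subrr.
Qed.

Section Frame.
Variable a : {vspace g}.
Hypotheses (aab : {in a &, forall x y, lie x y = 0})
  (za0 : (z :&: a = 0)%VS) (zaT : (z + a = fullv)%VS).

Lemma dim_complement : \dim a = 3%N.
Proof.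
have := dimv_disjoint_sum za0; rewrite zaT dg dz.
by move=> h; apply/eqP; rewrite -(eqn_add2l 4) -h.
Qed.

Lemma cross_mx_full (c : 4.-tuple g) (Y : 3.-tuple g) r :
  basis_of z c -> basis_of a Y -> comb c r != 0 ->
  row_full (cross_mx phi c Y (comb c r)).
Proof.
move=> bc bY v0.
have nY : (z + <<Y>> = fullv)%VS by rewrite (span_basis bY) zaT.
have := mxrankS (kermx_cross dg g2 bc nY v0 phi_z3).
rewrite mxrank_ker => h; have := leq_trans h (rank_leq_row r).
have := rank_leq_col (cross_mx phi c Y (comb c r)); rewrite /row_full.
by move: (\rank _) => k; lia.
Qed.

(** The cross product with [u] maps the 4-dimensional [z] with a one-dimensional kernel, hence onto
    the dual of the 3-dimensional [a]. No nonzero [x] in [a] is annihilated by this image. *)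
Lemma complement_nondegenerate x u : x \in a -> u \in z -> x != 0 -> u != 0 ->
  ~ {in z, forall w, phi (vec3 x u w) = 0}.
Proof.
move=> xa uz x0 u0 H; have [c bc] := vspace_basis dz.
have [Y bY] := vspace_basis dim_complement.
have [r ur] := comb_surj bc uz; rewrite ur in u0.
have [d xd] := comb_surj bY xa.
have Cd : cross_mx phi c Y (comb c r) *m d^T = 0.
  apply/row_matrixP => i; rewrite row0 rowE mulmxA; apply/rowP => j; rewrite ord1 mxE.
  rewrite [RHS]mxE -[RHS](H (comb c (delta_mx 0 i))) ?(comb_mem _ bc) //.
  rewrite xd ur form3C1 // form3C2 // opprK [comb Y d]/comb.
  under eq_bigr do rewrite mul_cross_mx // [d^T _ _]mxE mulrC.
  apply/esym; apply: (big_ind2 (fun x s => phi (vec3 (comb c r) (comb c (delta_mx 0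
    i)) x) = s)).
  - exact: form3_03.
  - by move=> x1 s1 x2 s2 <- <-; rewrite form3D3.
  by move=> k _; rewrite form3Z3.
have /eqP : d = 0.
  have /row_fullP[D DC] := cross_mx_full bc bY u0.
  by apply: trmx_inj; rewrite trmx0 -[LHS]mul1mx -DC -mulmxA Cd mulmx0.
by apply/negP; apply: contraNneq x0 => d0; rewrite xd d0 linear0.
Qed.

Definition dual_frame v1 v2 v3 v4 x1 x2 x3 : Prop :=
  [/\ [/\ phi (vec3 x1 v1 v2) = 1, phi (vec3 x1 v1 v3) = 0 & phi (vec3 x1 v1 v4) = 0],
      [/\ phi (vec3 x2 v1 v2) = 0, phi (vec3 x2 v1 v3) = 1 & phi (vec3 x2 v1 v4) = 0] &
      [/\ phi (vec3 x3 v1 v2) = 0, phi (vec3 x3 v1 v3) = 0 & phi (vec3 x3 v1 v4) = 1]].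

(** Together with [dual_frame] this says that, in the basis [t *: v1, v2, v3, v4] of [z], the forms
    [phi (x_i, ., .)] are [t] times the standard anti-self-dual triple [e12 - e34], [e13 + e24],
    [e14 - e23]. *)
Definition normal_frame t v1 v2 v3 v4 x1 x2 x3 : Prop :=
  [/\ [/\ phi (vec3 x1 v2 v3) = 0, phi (vec3 x1 v2 v4) = 0 & phi (vec3 x1 v3 v4) = - t],
      [/\ phi (vec3 x2 v2 v3) = 0, phi (vec3 x2 v2 v4) = t & phi (vec3 x2 v3 v4) = 0] &
      [/\ phi (vec3 x3 v2 v3) = - t, phi (vec3 x3 v2 v4) = 0 & phi (vec3 x3 v3 v4)
        = 0]].

Lemma dual_frame_basis v1 v2 v3 v4 x1 x2 x3 :
  v1 \in z -> v2 \in z -> v3 \in z -> v4 \in z -> v1 != 0 ->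
  dual_frame v1 v2 v3 v4 x1 x2 x3 -> basis_of z [tuple v1; v2; v3; v4].
Proof.
move=> z1 z2 z3 z4 v0 [[h12 h13 h14] [k12 k13 k14] [l12 l13 l14]].
apply: basis_of_comb => // [u|r].
  by rewrite !inE => /or4P[] /eqP->.
rewrite /comb !big_ord_recl big_ord0 /= addr0.
set r1 := r _ _; set r2 := r _ _; set r3 := r _ _; set r4 := r _ _ => r0.
have H x : r2 * phi (vec3 x v1 v2) + (r3 * phi (vec3 x v1 v3) + r4 * phi (vec3 x v1
  v4)) = 0.
  have := form3_03 fphi x v1; rewrite -r0 !form3D3 // !form3Z3 //.
  by rewrite form3_xx2 // mulr0 add0r.
have := H x1; have := H x2; have := H x3.
rewrite h12 h13 h14 k12 k13 k14 l12 l13 l14 !(mulr0, mulr1, addr0, add0r).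
move=> e4 e3 e2; move: r0; rewrite e2 e3 e4 !scale0r !addr0 => /eqP.
rewrite scaler_eq0 (negbTE v0) orbF => /eqP e1.
apply/rowP; case=> [[|[|[|[|]]]] // hi]; rewrite mxE.
- by rewrite -[RHS]e1; congr (r _ _); apply: val_inj.
- by rewrite -[RHS]e2; congr (r _ _); apply: val_inj.
- by rewrite -[RHS]e3; congr (r _ _); apply: val_inj.
by rewrite -[RHS]e4; congr (r _ _); apply: val_inj.
Qed.

Lemma dual_frame_basisX v1 v2 v3 v4 x1 x2 x3 :
  x1 \in a -> x2 \in a -> x3 \in a ->
  dual_frame v1 v2 v3 v4 x1 x2 x3 -> basis_of a [tuple x1; x2; x3].
Proof.
move=> z1 z2 z3 [[h12 h13 h14] [k12 k13 k14] [l12 l13 l14]].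
apply: basis_of_comb => [|u|r]; first exact: dim_complement.
  by rewrite !inE => /or3P[] /eqP->.
rewrite /comb !big_ord_recl big_ord0 /= addr0.
set r1 := r _ _; set r2 := r _ _; set r3 := r _ _ => r0.
have H v : r1 * phi (vec3 x1 v1 v) + (r2 * phi (vec3 x2 v1 v) + r3 * phi (vec3 x3
  v1 v)) = 0.
  by have := form3_01 fphi v1 v; rewrite -r0 !form3D1 // !form3Z1.
have := H v2; have := H v3; have := H v4.
rewrite h12 h13 h14 k12 k13 k14 l12 l13 l14 !(mulr0, mulr1, addr0, add0r).
move=> e3 e2 e1; apply/rowP; case=> [[|[|[|]]] // hi]; rewrite mxE.
- by rewrite -[RHS]e1; congr (r _ _); apply: val_inj.
- by rewrite -[RHS]e2; congr (r _ _); apply: val_inj.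
by rewrite -[RHS]e3; congr (r _ _); apply: val_inj.
Qed.

(** On [a] the bilinear form [B] is the wedge product of the 2-forms [phi (x, ., .)] on [z]. A
    2-form with zero Pfaffian has a radical, which [complement_nondegenerate] forbids; so [B] is
    anisotropic and has an orthogonal basis [x_i] with equal values. *)
Lemma exists_normal_frame : exists t v1 v2 v3 v4 x1 x2 x3,
  [/\ 0 < t, v1 != 0, [/\ v1 \in z, v2 \in z, v3 \in z & v4 \in z],
      [/\ x1 \in a, x2 \in a & x3 \in a] &
      dual_frame v1 v2 v3 v4 x1 x2 x3 /\ normal_frame t v1 v2 v3 v4 x1 x2 x3].
Proof.
have [c bc] := vspace_basis dz; have fc := basis_free bc.
have cz i : (i < 4)%N -> c`_i \in z.
  by move=> i4; apply: (basis_mem bc); rewrite mem_nth ?size_tuple.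
have [c0 c1 c2 c3] : [/\ c`_0 \in z, c`_1 \in z, c`_2 \in z & c`_3 \in z].
  by split; apply: cz.
pose B x y := wedge (interior x phi) (interior y phi) (vec4 c`_0 c`_1 c`_2 c`_3).
have fi x : is_form (interior x phi) := interior_form x fphi.
have BE x y : B x y = phi (vec3 x c`_0 c`_1) * phi (vec3 y c`_2 c`_3)
  - phi (vec3 x c`_0 c`_2) * phi (vec3 y c`_1 c`_3)
  + phi (vec3 x c`_0 c`_3) * phi (vec3 y c`_1 c`_2)
  + phi (vec3 x c`_1 c`_2) * phi (vec3 y c`_0 c`_3)
  - phi (vec3 x c`_1 c`_3) * phi (vec3 y c`_0 c`_2)
  + phi (vec3 x c`_2 c`_3) * phi (vec3 y c`_0 c`_1) by rewrite /B wedge22E.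
have BP k x y s : B (k *: x + y) s = k * B x s + B y s.
  by rewrite !BE !form3P1 //; ring.
have BC x y : B x y = B y x by rewrite /B wedge22C.
have v0 : c`_0 != 0.
  by apply: (free_not0 fc); rewrite mem_nth ?size_tuple.
have comb4 (p q r s : R) : p *: c`_0 + q *: c`_1 + r *: c`_2 + s *: c`_3 = 0 ->
    [/\ p = 0, q = 0, r = 0 & s = 0].
  move=> h; pose w : 'rV[R]_4 := \row_j nth 0 [:: p; q; r; s] j.
  have w0 : w = 0.
    apply: (comb_inj fc); rewrite linear0 /comb !big_ord_recl big_ord0 !mxE /=.
    by rewrite addr0 !addrA.
  have wE i : w 0 i = 0 by rewrite w0 mxE.
  by have := wE ord0; have := wE (lift ord0 ord0);
    have := wE (lift ord0 (lift ord0 ord0));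
    have := wE (lift ord0 (lift ord0 (lift ord0 ord0)));
    rewrite !mxE /= => -> -> -> ->.
have aniso : {in a, forall x, x != 0 -> B x x != 0}.
  move=> x xa x0; apply/eqP; rewrite BE.
  set w01 := phi (vec3 x c`_0 c`_1); set w02 := phi (vec3 x c`_0 c`_2).
  set w03 := phi (vec3 x c`_0 c`_3); set w12 := phi (vec3 x c`_1 c`_2).
  set w13 := phi (vec3 x c`_1 c`_3); set w23 := phi (vec3 x c`_2 c`_3) => q0.
  have pf : w01 * w23 - w02 * w13 + w03 * w12 = 0 by lra.
  (* The rows of the Pfaffian adjoint of the form are in its radical. *)
  have null p q r s :
      - q * w01 - r * w02 - s * w03 = 0 -> p * w01 - r * w12 - s * w13 = 0 ->
      p * w02 + q * w12 - s * w23 = 0 -> p * w03 + q * w13 + r * w23 = 0 ->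
      [/\ p = 0, q = 0, r = 0 & s = 0].
    move=> e0 e1 e2 e3; apply: comb4; apply/eqP; apply: contraT => u0.
    case: (complement_nondegenerate xa _ x0 u0); first by rewrite !memvD ?memvZ.
    move=> _ /(comb_surj bc)[l ->].
    rewrite /comb !big_ord_recl big_ord0 /= addr0 !form3D3 // !form3Z3 //.
    rewrite !form3D2 // !form3Z2 // !(form3_xx2 fphi).
    rewrite (form3C2 fphi x c`_1 c`_0) (form3C2 fphi x c`_2 c`_0)
      (form3C2 fphi x c`_3 c`_0) (form3C2 fphi x c`_2 c`_1)
      (form3C2 fphi x c`_3 c`_1) (form3C2 fphi x c`_3 c`_2).
    rewrite -/w01 -/w02 -/w03 -/w12 -/w13 -/w23.
    set l0 := l _ _; set l1 := l _ _; set l2 := l _ _; set l3 := l _ _.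
    transitivity (l0 * (- q * w01 - r * w02 - s * w03)
      + l1 * (p * w01 - r * w12 - s * w13) + l2 * (p * w02 + q * w12 - s * w23)
      + l3 * (p * w03 + q * w13 + r * w23)); first by ring.
    by rewrite e0 e1 e2 e3; ring.
  have [||||_ f23 f13 f12] := null 0 w23 (- w13) w12; try lra.
  have [||||_ _ f03 f02] := null (- w23) 0 w03 (- w02); try lra.
  have [||||_ _ _ f01] := null w13 (- w03) 0 w01; try lra.
  case: (complement_nondegenerate xa c0 x0 v0) => _ /(comb_surj bc)[l ->].
  rewrite /comb !big_ord_recl big_ord0 /= addr0 !form3D3 // !form3Z3 //.
  rewrite form3_xx2 // -/w01 -/w02 -/w03 f01 -[w02]opprK f02 f03.
  by rewrite oppr0 !mulr0 !addr0.
have [s [x1 [x2 [x3 [s0 [xa1 xa2 xa3] [B11 B22 B33] [B12 B13 B23]]]]]] :=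
  anisotropic_orthonormal3 BP BC aniso dim_complement.
have bX : basis_of a [tuple x1; x2; x3].
  apply: basis_of_comb => [|u|r]; first exact: dim_complement.
    by rewrite !inE => /or3P[] /eqP->.
  rewrite /comb !big_ord_recl big_ord0 /= addr0.
  set r1 := r _ _; set r2 := r _ _; set r3 := r _ _ => r0.
  have B0 y : B 0 y = 0 by have := BP 1 0 0 y; rewrite scale1r addr0; lra.
  have H y : r1 * B x1 y + (r2 * B x2 y + r3 * B x3 y) = 0.
    by rewrite -(B0 y) -r0 !BP -[r3 *: x3]addr0 BP B0 addr0.
  have := H x1; have := H x2; have := H x3.
  rewrite (BC x2 x1) (BC x3 x1) (BC x3 x2) B11 B22 B33 B12 B13 B23.
  rewrite !(mulr0, addr0, add0r) => /eqP + /eqP + /eqP.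
  rewrite !mulf_eq0 (negbTE s0) !orbF => /eqP e3 /eqP e2 /eqP e1.
  apply/rowP; case=> [[|[|[|]]] // hi]; rewrite mxE.
  - by rewrite -[RHS]e1; congr (r _ _); apply: val_inj.
  - by rewrite -[RHS]e2; congr (r _ _); apply: val_inj.
  by rewrite -[RHS]e3; congr (r _ _); apply: val_inj.
have [D DC] : exists D, D *m cross_mx phi c [tuple x1; x2; x3] c`_0 = 1%:M.
  have e0 : c`_0 = comb c (delta_mx 0 ord0) by rewrite comb_delta.
  by rewrite e0; apply/row_fullP/cross_mx_full => //; rewrite -e0.
pose v1 := c`_0; pose w i := comb c (row i D).
have wz i : w i \in z by apply: comb_mem bc.
have wE (i j : 'I_3) : phi (vec3 v1 (w i) [tuple x1; x2; x3]`_j) = (i == j)%:R.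
  by rewrite -mul_cross_mx // -row_mul DC !mxE.
pose o0 : 'I_3 := ord0; pose o1 : 'I_3 := lift ord0 ord0.
pose o2 : 'I_3 := lift ord0 (lift ord0 ord0).
(* Multiples of [v1] do not disturb duality. These three coefficients kill three of the nine
   components required by [normal_frame]; the six values of [B] on the [x_i] then determine the
   other six. *)
pose v2 := - phi (vec3 x2 (w o0) (w o1)) *: v1 + w o0.
pose v3 := phi (vec3 x1 (w o0) (w o1)) *: v1 + w o1.
pose v4 := phi (vec3 x1 (w o0) (w o2)) *: v1 + w o2.
have cyc x y u : phi (vec3 x y u) = phi (vec3 y u x).
  by rewrite form3C1 // form3C2 // opprK.
have wx1 i : phi (vec3 x1 v1 (w i)) = (i == o0)%:R by rewrite cyc -wE.
have wx2 i : phi (vec3 x2 v1 (w i)) = (i == o1)%:R by rewrite cyc -wE.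
have wx3 i : phi (vec3 x3 v1 (w i)) = (i == o2)%:R by rewrite cyc -wE.
have [z1 z2 z3 z4] : [/\ v1 \in z, v2 \in z, v3 \in z & v4 \in z].
  by split=> //; rewrite memvD ?memvZ.
have df : dual_frame v1 v2 v3 v4 x1 x2 x3.
  split; split; rewrite form3P3 // form3_xx2 // mulr0 add0r ?wx1 ?wx2 ?wx3 //.
have [f23 f24 f23'] : [/\ phi (vec3 x1 v2 v3) = 0, phi (vec3 x1 v2 v4) = 0
    & phi (vec3 x2 v2 v3) = 0].
  split; rewrite form3P2 // !form3P3 // form3_xx2 // (form3C2 fphi _ (w o0) v1);
  by rewrite ?wx1 ?wx2 /=; ring.
have bV := dual_frame_basis z1 z2 z3 z4 v0 df.
have rowE (u : g) : u \in z -> exists r, u = comb c r by move=> /(comb_surj bc).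
have [p1 p1E] := rowE _ z1; have [p2 p2E] := rowE _ z2.
have [p3 p3E] := rowE _ z3; have [p4 p4E] := rowE _ z4.
pose P : 'M[R]_4 := \matrix_i nth 0 [:: p1; p2; p3; p4] i.
have PE : vec4 v1 v2 v3 v4 = fun i => \sum_j P i j *: vec4 c`_0 c`_1 c`_2 c`_3 j.
  have combE r : comb c r = \sum_j r 0 j *: vec4 c`_0 c`_1 c`_2 c`_3 j.
    apply: eq_bigr => j _; congr (_ *: _).
    rewrite /vec4; case: (unliftP ord0 j) => [k ->|->]; last by rewrite cons_vec0.
    by rewrite cons_vec_lift vec3E; case: k => [[|[|[|]]]].
  apply: funext => i; transitivity (comb c (row i P)); last first.
    by rewrite combE; apply: eq_bigr => j _; rewrite mxE.
  rewrite rowK /vec4; case: (unliftP ord0 i) => [k ->|->].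
    by rewrite cons_vec_lift vec3E; case: k => [[|[|[|]]]].
  by rewrite cons_vec0.
have dP : \det P != 0.
  rewrite -unitfE -unitmxE -row_free_unit -kermx_eq0; apply/rowV0P => r /sub_kermxP rP.
  apply: (comb_inj (basis_free bV)); rewrite linear0 -[RHS](linear0 (comb c)) -rP.
  rewrite mulmx_sum_row linear_sum /comb; apply: eq_bigr => i _.
  rewrite linearZ /= rowK; congr (_ *: _).
  by case: i => [[|[|[|[|]]]]].
pose B' x y := wedge (interior x phi) (interior y phi) (vec4 v1 v2 v3 v4).
have B'B x y : B' x y = \det P * B x y.
  rewrite /B' PE form_det //.
  exact: wedge_form (proj1 (fi x)) (proj1 (fi y)).
have B'E x y : B' x y = phi (vec3 x v1 v2) * phi (vec3 y v3 v4)
  - phi (vec3 x v1 v3) * phi (vec3 y v2 v4)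
  + phi (vec3 x v1 v4) * phi (vec3 y v2 v3)
  + phi (vec3 x v2 v3) * phi (vec3 y v1 v4)
  - phi (vec3 x v2 v4) * phi (vec3 y v1 v3)
  + phi (vec3 x v3 v4) * phi (vec3 y v1 v2) by rewrite /B' wedge22E.
have s'0 : \det P * s != 0 by rewrite mulf_neq0.
have [[a12 a13 a14] [b12 b13 b14] [d12 d13 d14]] := df.
have := B'B x1 x1; have := B'B x2 x2; have := B'B x3 x3.
have := B'B x1 x2; have := B'B x1 x3; have := B'B x2 x3.
rewrite B11 B22 B33 B12 B13 B23 !B'E a12 a13 a14 b12 b13 b14 d12 d13 d14.
rewrite f23 f24 f23'; move: (\det P * s) s'0 => s' s'0.
rewrite !(mulr0, mulr1, mul1r, mul0r, subr0, add0r, addr0, sub0r) => g23 g13 g12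
  g33 g22 g11.
pose t := - s' / 2%:R.
have nf : normal_frame t v1 v2 v3 v4 x1 x2 x3.
  by split; split => //; rewrite /t; clear -g11 g22 g33 g12 g13 g23; lra.
have [tp|tn|t0] := ltrgt0P t; last 1 first.
- by move: t0 s'0; rewrite /t => /eqP;
  rewrite mulf_eq0 oppr_eq0 invr_eq0 pnatr_eq0 orbF => ->.
- by exists t, v1, v2, v3, v4, x1, x2, x3; split.
(* Changing these six signs preserves the components involving [v1] and reverses the others, hence
   [t]. *)
exists (- t), v1, (- v2), (- v3), (- v4), (- x1), (- x2), (- x3).
have [[_ _ h1] [_ h2 h3] [h4 h5 h6]] := nf.
split; rewrite ?memvN ?oppr_gt0 //; split; split; split;
  rewrite -!scaleN1r !(form3Z1 fphi, form3Z2 fphi, form3Z3 fphi);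
  by rewrite ?a12 ?a13 ?a14 ?b12 ?b13 ?b14 ?d12 ?d13 ?d14 ?f23 ?f24 ?f23' ?h1 ?h2
    ?h3 ?h4 ?h5 ?h6; ring.
Qed.

(** The map [x |-> x + [x, u]] is the inner automorphism [exp (- ad u)], whose series stops here
    because [z] is an abelian ideal. *)
Lemma lie_shift x y u : x \in a -> y \in a -> u \in z ->
  lie (x + lie x u) (y + lie y u) = 0.
Proof.
move=> xa ya uz; rewrite lieDl !linearD /= aab // add0r (zab (zder x u) (zder y u))
  addr0.
by rewrite (lieC (lie x u)) z_act_comm // addrN.
Qed.

Lemma phi_shift x1 x2 x3 u : x1 \in a -> x2 \in a -> x3 \in a -> u \in z ->
  phi (vec3 (x1 + lie x1 u) (x2 + lie x2 u) (x3 + lie x3 u)) = 0.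
Proof.
move=> a1 a2 a3 uz; rewrite (exact_phiE phiE) !lie_shift // !form2_01 //.
by rewrite !oppr0 !addr0.
Qed.

(* The part of [phi_shift] that is quadratic in [u]. *)
Lemma phi_shift_quadratic x1 x2 x3 u : x1 \in a -> x2 \in a -> x3 \in a -> u \in z ->
  phi (vec3 x1 (lie x2 u) (lie x3 u)) + phi (vec3 x2 (lie x3 u) (lie x1 u))
  + phi (vec3 x3 (lie x1 u) (lie x2 u)) = 0.
Proof.
move=> a1 a2 a3 uz.
have nuz : - u \in z by rewrite memvN.
(* Adding the values at [u] and [- u] cancels the odd part, and the constant term is zero because
   [a] is abelian. *)
have := phi_shift a1 a2 a3 nuz; have := phi_shift a1 a2 a3 uz.
have e0 : phi (vec3 x1 x2 x3) = 0.
  by rewrite (exact_phiE phiE) !aab // !form2_01 // !oppr0 !addr0.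
rewrite !linearN /= -!scaleN1r.
rewrite !form3D1 // !form3D2 // !form3D3 // !form3Z1 // !form3Z2 // !form3Z3 //.
rewrite e0 (phi_z3 (zder _ _) (zder _ _) (zder _ _)).
have cyc x y v : phi (vec3 x y v) = phi (vec3 y v x).
  by rewrite form3C1 // form3C2 // opprK.
rewrite (cyc (lie x1 u) x2 (lie x3 u)) (cyc (lie x1 u) (lie x2 u) x3).
by rewrite (cyc (lie x2 u) x3 (lie x1 u)); lra.
Qed.

Lemma coassociative_ideal_absurd : False.
Proof.
have [t [v1 [v2 [v3 [v4 [x1 [x2 [x3 [t0 v0 [z1 z2 z3 z4] [a1 a2 a3] [df nf]]]]]]]]]] :=
  exists_normal_frame.
have bV := dual_frame_basis z1 z2 z3 z4 v0 df.
have bX := dual_frame_basisX a1 a2 a3 df.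
pose V := [tuple v1; v2; v3; v4].
have [[a12 a13 a14] [b12 b13 b14] [d12 d13 d14]] := df.
have [[a23 a24 a34] [b23 b24 b34] [d23 d24 d34]] := nf.
pose o0 : 'I_4 := ord0; pose o1 : 'I_4 := lift ord0 ord0.
pose o2 : 'I_4 := lift ord0 (lift ord0 ord0).
pose o3 : 'I_4 := lift ord0 (lift ord0 (lift ord0 ord0)).
have sum4 (T : zmodType) (f : 'I_4 -> T) :
    \sum_i f i = f o0 + f o1 + f o2 + f o3.
  by rewrite !big_ord_recl big_ord0 addr0 !addrA.
pose A x := ad_mx V x.
have lieE x r : lie x (comb V r) = comb V (r *m A x) := ad_mx_comb z_ideal bV x r.
have combE r : comb V r = r 0 o0 *: v1 + r 0 o1 *: v2 + r 0 o2 *: v3 + r 0 o3 *: v4.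
  by rewrite /comb sum4.
have p12 := form3_perm fphi a12; have p13 := form3_perm fphi a13.
have p14 := form3_perm fphi a14; have p23 := form3_perm fphi a23.
have p24 := form3_perm fphi a24; have p34 := form3_perm fphi a34.
have q12 := form3_perm fphi b12; have q13 := form3_perm fphi b13.
have q14 := form3_perm fphi b14; have q23 := form3_perm fphi b23.
have q24 := form3_perm fphi b24; have q34 := form3_perm fphi b34.
have r12 := form3_perm fphi d12; have r13 := form3_perm fphi d13.
have r14 := form3_perm fphi d14; have r23 := form3_perm fphi d23.
have r24 := form3_perm fphi d24; have r34 := form3_perm fphi d34.
pose rules := (p12, p13, p14, p23, p24, p34, q12, q13, q14, q23, q24, q34,
  (r12, r13, r14, r23, r24, r34)).
have expand := (form3D1 fphi, form3D2 fphi, form3D3 fphi, form3Z1 fphi,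
  form3Z2 fphi, form3Z3 fphi).
have diag := (form3_xx1 fphi, form3_xx2 fphi, form3_xx3 fphi).
have bil x f h : phi (vec3 x (comb V f) (comb V h)) =
    (f 0 o0 * h 0 o1 - f 0 o1 * h 0 o0) * phi (vec3 x v1 v2)
    + (f 0 o0 * h 0 o2 - f 0 o2 * h 0 o0) * phi (vec3 x v1 v3)
    + (f 0 o0 * h 0 o3 - f 0 o3 * h 0 o0) * phi (vec3 x v1 v4)
    + (f 0 o1 * h 0 o2 - f 0 o2 * h 0 o1) * phi (vec3 x v2 v3)
    + (f 0 o1 * h 0 o3 - f 0 o3 * h 0 o1) * phi (vec3 x v2 v4)
    + (f 0 o2 * h 0 o3 - f 0 o3 * h 0 o2) * phi (vec3 x v3 v4).
  rewrite !combE !(form3D2 fphi) !(form3D3 fphi) !(form3Z2 fphi) !(form3Z3 fphi).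
  rewrite !(form3_xx2 fphi) (form3C2 fphi x v2 v1) (form3C2 fphi x v3 v1).
  rewrite (form3C2 fphi x v4 v1) (form3C2 fphi x v3 v2) (form3C2 fphi x v4 v2).
  by rewrite (form3C2 fphi x v4 v3); ring.
have quad f1 f2 f3 : phi (vec3 x1 (comb V f2) (comb V f3))
    + phi (vec3 x2 (comb V f3) (comb V f1)) + phi (vec3 x3 (comb V f1) (comb V f2))
    = f2 0 o0 * f3 0 o1 - f2 0 o1 * f3 0 o0 - t * (f2 0 o2 * f3 0 o3 - f2 0 o3 * f3
      0 o2)
    + (f3 0 o0 * f1 0 o2 - f3 0 o2 * f1 0 o0 + t * (f3 0 o1 * f1 0 o3 - f3 0 o3 *
      f1 0 o1))
    + (f1 0 o0 * f2 0 o3 - f1 0 o3 * f2 0 o0 - t * (f1 0 o1 * f2 0 o2 - f1 0 o2 *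
      f2 0 o1)).
  rewrite !bil a12 a13 a14 a23 a24 a34 b12 b13 b14 b23 b24 b34.
  by rewrite d12 d13 d14 d23 d24 d34; ring.
(* The map [u |-> sum_k J_k [x_k, u]] in coordinates, up to scaling of its components: the
   projection of the triple of the [[x_k, u]] onto the 4-dimensional part of [z (x) R^3]. *)
pose K : 'M[R]_4 := \matrix_(i, j) nth 0
  [:: A x1 i o1 + A x2 i o2 + A x3 i o3; A x1 i o0 - t * A x2 i o3 + t * A x3 i o2;
      A x2 i o0 + t * A x1 i o3 - t * A x3 i o1;
      A x3 i o0 - t * A x1 i o2 + t * A x2 i o1] j.
have KE (r : 'rV_4) :
  [/\ (r *m K) 0 o0 = (r *m A x1) 0 o1 + (r *m A x2) 0 o2 + (r *m A x3) 0 o3,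
      (r *m K) 0 o1 = (r *m A x1) 0 o0 - t * (r *m A x2) 0 o3 + t * (r *m A x3) 0 o2,
      (r *m K) 0 o2 = (r *m A x2) 0 o0 + t * (r *m A x1) 0 o3 - t * (r *m A x3) 0 o1 &
      (r *m K) 0 o3 = (r *m A x3) 0 o0 - t * (r *m A x1) 0 o2 + t * (r *m A x2) 0 o1].
  by split; rewrite ![(r *m _) 0 _]mxE !sum4 ![K _ _]mxE /=; ring.
have KU : K \in unitmx.
  rewrite -row_free_unit -kermx_eq0; apply/rowV0P => r /sub_kermxP rK.
  have [] := KE r; rewrite rK ![(0 : 'rV_4) 0 _]mxE.
  have := phi_shift_quadratic a1 a2 a3 (comb_mem r bV).
  rewrite !lieE quad.
  set f1 := r *m A x1; set f2 := r *m A x2; set f3 := r *m A x3 => Q0 e1 e2 e3 e4.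
  pose F0 := [:: f1 0 o0; f2 0 o0; f3 0 o0; t * f1 0 o1; t * f1 0 o2; t * f1 0 o3;
    t * f2 0 o1; t * f2 0 o2; t * f2 0 o3; t * f3 0 o1; t * f3 0 o2; t * f3 0 o3].
  (* On the kernel of [K], [2 t] times the form of [phi_shift_quadratic] is a sum of squares of all
     coordinates. So every [[x_k, u]] vanishes, and [u] is central. *)
  have S0 : \sum_(c <- F0) c ^+ 2 = 0.
    rewrite /F0 !big_cons big_nil.
    transitivity ((t * (f1 0 o1 + f2 0 o2 + f3 0 o3)) ^+ 2
      + (f1 0 o0 - t * f2 0 o3 + t * f3 0 o2) ^+ 2
      + (f2 0 o0 + t * f1 0 o3 - t * f3 0 o1) ^+ 2
      + (f3 0 o0 - t * f1 0 o2 + t * f2 0 o1) ^+ 2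
      + 2%:R * t * (f2 0 o0 * f3 0 o1 - f2 0 o1 * f3 0 o0
          - t * (f2 0 o2 * f3 0 o3 - f2 0 o3 * f3 0 o2)
        + (f3 0 o0 * f1 0 o2 - f3 0 o2 * f1 0 o0
          + t * (f3 0 o1 * f1 0 o3 - f3 0 o3 * f1 0 o1))
        + (f1 0 o0 * f2 0 o3 - f1 0 o3 * f2 0 o0
          - t * (f1 0 o1 * f2 0 o2 - f1 0 o2 * f2 0 o1)))); first by ring.
    by rewrite Q0 -e1 -e2 -e3 -e4 !expr0n /= !(mulr0, addr0) expr0n.
  have F00 c : c \in F0 -> c = 0.
    move=> cF; apply/eqP; rewrite -sqrf_eq0.
    move: S0; rewrite (big_rem c cF) /= => /eqP; rewrite paddr_eq0 ?sqr_ge0 //.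
      by case/andP.
    by apply: sumr_ge0 => d _; apply: sqr_ge0.
  have tF c : t * c \in F0 -> c = 0.
    by move=> /F00/eqP; rewrite mulf_eq0 gt_eqF //= => /eqP.
  have ord4 (i : 'I_4) : i \in [:: o0; o1; o2; o3].
    by case: i => [[|[|[|[|]]]]].
  have [f10 f20 f30] : [/\ f1 = 0, f2 = 0 & f3 = 0].
    split; apply/rowP => i; rewrite [RHS]mxE; have := ord4 i;
    rewrite !inE => /or4P[] /eqP->;
    by [apply: F00; rewrite !inE eqxx ?orbT | apply: tF; rewrite !inE eqxx ?orbT].
  apply: (comb_inj (basis_free bV)); rewrite linear0; apply: center0 => x.
  have := memvf x; rewrite -zaT => /memv_addP[y yz [w wa ->]].
  have [d ->] := comb_surj bX wa.
  rewrite linearD /= zab ?(comb_mem _ bV) // add0r lieC [comb _ d]/comb.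
  rewrite !big_ord_recl big_ord0 addr0 !lieDl !lieZl !lieE /=.
  by rewrite -/f1 -/f2 -/f3 f10 f20 f30 !linear0 ?scaler0 !addr0 oppr0.
pose ps v y w := phi (vec3 v y w).
(* Translating by [u] changes the four expressions to be annihilated by [- 2 t] times the first
   component of [K] at [u], and by [- 2] times the other three; the denominators of [tau] come from
   these factors. *)
pose tau : 'rV[R]_4 := \row_j nth 0
  [:: (ps v2 x2 x3 + ps v3 x3 x1 + ps v4 x1 x2) / (2%:R * t);
      (t * ps v1 x2 x3 - ps v4 x3 x1 + ps v3 x1 x2) / 2%:R;
      (t * ps v1 x3 x1 + ps v4 x2 x3 - ps v2 x1 x2) / 2%:R;
      (t * ps v1 x1 x2 + ps v2 x3 x1 - ps v3 x2 x3) / 2%:R] j.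
pose r := tau *m invmx K; pose u := comb V r.
have rK : r *m K = tau by rewrite mulmxKV.
have uz : u \in z by apply: comb_mem bV.
pose y1 := x1 + lie x1 u; pose y2 := x2 + lie x2 u; pose y3 := x3 + lie x3 u.
have [k0 k1 k2 k3] := KE r; rewrite rK in k0 k1 k2 k3.
rewrite ![tau _ _]mxE /= in k0 k1 k2 k3.
have ynz i y v w c : c != 0 -> phi (vec3 (y + lie y i) v w) = c -> y + lie y i != 0.
  by move=> c0 e; apply/eqP => y0; move: e c0; rewrite y0 form3_01 // => <-;
    rewrite eqxx.
have f0 x v w : v \in z -> w \in z -> phi (vec3 (x + lie x u) v w) = phi (vec3 x v w).
  by move=> vz wz; rewrite form3D1 // (phi_z3 (zder _ _) vz wz) addr0.
have y10 : y1 != 0 by apply: (ynz _ _ v1 v2 1); rewrite ?oner_eq0 // f0.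
have y20 : y2 != 0 by apply: (ynz _ _ v1 v3 1); rewrite ?oner_eq0 // f0.
have y30 : y3 != 0 by apply: (ynz _ _ v1 v4 1); rewrite ?oner_eq0 // f0.
have psE v x y : v \in z -> phi (vec3 v (x + lie x u) (y + lie y u)) =
    ps v x y + phi (vec3 v (lie x u) y) + phi (vec3 v x (lie y u)).
  move=> vz; rewrite !expand (phi_z3 vz (zder _ _) (zder _ _)) addr0 /ps.
  by rewrite addrAC.
have liev x : lie x u = comb V (r *m A x) by rewrite /u lieE.
apply: (@g2_coassociative_normal_form R g phi v1 v2 v3 v4 y1 y2 y3 t
  _ _ _ _ _ _ _ _ _ _ _ _ dg g2 t0 v0 y10 y20 y30 (phi_z3 z1 z2 z3)
  (phi_z3 z1 z2 z4) (phi_z3 z1 z3 z4) (phi_z3 z2 z3 z4) (phi_shift a1 a2 a3 uz)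
  _ _ _ _ _ _ _ _ _ _ _ _ _ _ _ _ _ _ erefl erefl erefl erefl
  erefl erefl erefl erefl erefl erefl erefl erefl);
  try by rewrite f0.
all: rewrite !psE // !liev !combE !expand !diag !rules.
all: have tn0 : t != 0 by rewrite gt_eqF.
- transitivity (ps v2 x2 x3 + ps v3 x3 x1 + ps v4 x1 x2 - 2%:R * t *
    ((r *m A x1) 0 o1 + (r *m A x2) 0 o2 + (r *m A x3) 0 o3)); first by ring.
  by rewrite -k0; field.
- transitivity (t * ps v1 x2 x3 - ps v4 x3 x1 + ps v3 x1 x2 - 2%:R *
    ((r *m A x1) 0 o0 - t * (r *m A x2) 0 o3 + t * (r *m A x3) 0 o2)); first by ring.
  by rewrite -k1; field.
- transitivity (t * ps v1 x3 x1 + ps v4 x2 x3 - ps v2 x1 x2 - 2%:R *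
    ((r *m A x2) 0 o0 + t * (r *m A x1) 0 o3 - t * (r *m A x3) 0 o1)); first by ring.
  by rewrite -k2; field.
transitivity (t * ps v1 x1 x2 + ps v2 x3 x1 - ps v3 x2 x3 - 2%:R *
  ((r *m A x3) 0 o0 - t * (r *m A x1) 0 o2 + t * (r *m A x2) 0 o1)); first by ring.
by rewrite -k3; field.
Qed.

End Frame.

End Dim4.


(** * The last nonzero term of the central series and the conclusion *)

Lemma nilradical_neq0 (F : numFieldType) (g : lieAlgType F) :
  lie_solvable g -> \dim {:g} != 0%N -> nilradical g != 0%VS.
Proof.
move=> sg; apply: contraNneq => n0.
have [_ _ nmax] := nilradicalP g.
have : ({:g} <= nilradical g)%VS.
  apply: nmax; first by apply/lie_idealP => x y _; apply: memvf.
  exists 1%N; apply/eqP; rewrite -subv0; apply/lievP => x y _ _.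
  by rewrite -n0 derived_nilradical.
by rewrite n0 subv0 => /eqP->; rewrite dimv0.
Qed.

Lemma lcs_sub (F : fieldType) (g : lieAlgType F) (I : {vspace g}) i :
  lie_ideal I -> (lcs I i <= I)%VS.
Proof.
move=> iI; elim: i => [|i IH] /=; first exact: subvv.
apply/lievP => x y _ yI; apply: (lie_idealP I).1 => //.
exact: (subvP IH).
Qed.

Lemma last_lcs (F : fieldType) (g : lieAlgType F) (I : {vspace g}) :
  lie_nilpotent I -> I != 0%VS -> exists k, lcs I k != 0%VS /\ lcs I k.+1 = 0%VS.
Proof.
move=> [i0 Ii0] I0; have ex : exists i, lcs I i == 0%VS by exists i0; rewrite Ii0.
have [[|k] /eqP k0 kmin] := ex_minnP ex; first by move: I0; rewrite -{1}k0 eqxx.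
by exists k; split=> //; apply/negP => /kmin; rewrite ltnn.
Qed.

Theorem theorem3p2 (R : realType) (g : lieAlgType R) :
  \dim {:g} = 7%N -> lie_solvable g -> strongly_unimodular g ->
  ~ (exists phi : kfun g 3, g2_structure phi /\ exact_form phi).
Proof.
move=> dg sg ug [phi [g2 [alpha [fa phiE]]]].
have [iN nN _] := nilradicalP g; set n := nilradical g in iN nN.
have n0 : n != 0%VS by apply: nilradical_neq0; rewrite ?dg.
have [k [z0 zk]] := last_lcs nN n0; pose z := lcs n k.
have iz : lie_ideal z by apply: lie_ideal_lcs.
have zn : (z <= n)%VS by apply: lcs_sub.
have nz : {in n & z, forall u w, lie u w = 0}.
  by move=> u w un wz; apply/eqP; rewrite -memv0 -zk; apply: memv_lie.
(* As the next term of the series is zero, [z] is itself one of the quotients in the definition of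
   strong unimodularity. *)
have trz x : quot_trace z 0 (ad x) = 0 by rewrite -zk ug.
have le8 := dim_z_le dg g2 fa phiE zn nz; have := dimvS zn.
have := dim_z_neq1 dg sg ug g2 fa phiE iz trz.
have := dim_z_neq2 dg g2 fa phiE iz zn nz trz.
have := dim_z_neq3 dg sg g2 fa phiE iz zn nz trz.
have dz0 : \dim z <> 0%N by move/eqP; rewrite dimv_eq0 (negbTE z0).
(* From [\dim z >= 4], [\dim z <= \dim n] and [\dim z + \dim n <= 8]. *)
move=> d3 d2 d1 dle; have [dz dn] : \dim z = 4%N /\ \dim n = 4%N.
  by move: dz0 d1 d2 d3 dle le8; rewrite -/n; move: (\dim z) (\dim n) => p q; lia.
have zE : z = n by apply/eqP; rewrite eqEdim zn dz dn leqnn.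
have zab : {in z &, forall u w, lie u w = 0}.
  by move=> u w uz wz; apply: nz; rewrite -?zE.
have zder x y : lie x y \in z by rewrite zE derived_nilradical.
have center0 := exact_g2_center0 dg sg ug g2 fa phiE.
have [a [aab za0 zaT]] := abelian_complement dg center0 zab zder dz.
exact: (coassociative_ideal_absurd dg g2 fa phiE center0 zab zder dz aab za0 zaT).
Qed.
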